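(* Let $r>0$, let $\vec{\mathbf g}\in G^{1/2}_r(\mathbb R^3)$, and let $(\vec u,\theta)\in\dot H^1(\mathbb R^3)$ be a weak solution of the homogeneous stationary Boussinesq system $$-\Delta \vec u+\operatorname{div}(\vec u\otimes \vec u)+\vec\nabla P=\theta\,\vec{\mathbf g},\qquad \operatorname{div}(\vec u)=0,\qquad -\Delta\theta+\operatorname{div}(\theta\vec u)=0\qquad\text{in }\mathbb R^3.$$ For $k\in\mathbb N$ let $\mathscr C_k:=\{\xi\in\mathbb R^3: 2^{-(k+1)}\le|\xi|\le 2^{-k}\}$. If there is a constant $C>0$ independent of $k$ such that, for all $k\in\mathbb N$, $$\|\widehat{\vec u}\|_{L^\infty(\mathscr C_k)}+\|\widehat\theta\|_{L^\infty(\mathscr C_k)}\le C\,2^k,$$ then $\vec u=0$ and $\theta=0$.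
   Context: For $s\in\mathbb R$, $\dot H^s(\mathbb R^3)$ is the homogeneous Sobolev space with norm $\||\xi|^s\widehat\varphi\|_{L^2}$ (componentwise for vector fields). For $r>0$, $e^{r\sqrt{-\Delta}}$ is the Fourier multiplier with symbol $e^{r|\xi|}$, and $G^s_r(\mathbb R^3):=\{\varphi\in\dot H^s(\mathbb R^3): e^{r\sqrt{-\Delta}}\varphi\in\dot H^s(\mathbb R^3)\}$. Here $\vec u,\vec{\mathbf g}:\mathbb R^3\to\mathbb R^3$, $\theta,P:\mathbb R^3\to\mathbb R$, $\widehat{\cdot}$ is the Fourier transform, and $\mathbb N$ includes $0$. A weak solution $(\vec u,\theta)\in\dot H^1(\mathbb R^3)$ satisfies the system in the sense of distributions, with pressure $P=(-\Delta)^{-1}\operatorname{div}(\operatorname{div}(\vec u\otimes\vec u))-(-\Delta)^{-1}\operatorname{div}(\theta\,\vec{\mathbf g})$. *)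

(* Defs.v *)
From HB Require Import structures.
From mathcomp Require Import all_boot all_order all_algebra.
From mathcomp Require Import all_classical all_reals all_analysis.
From mathcomp.real_closed Require Import complex.
Set Implicit Arguments.
Unset Strict Implicit.
Unset Printing Implicit Defensive.
Import Order.TTheory GRing.Theory Num.Theory.
Import numFieldNormedType.Exports.
Local Open Scope classical_set_scope.
Local Open Scope complex_scope.
Local Open Scope ring_scope.

Notation R3 R := ((R * R * R)%type).

(* [lebesgue_measure] lives on [measurableTypeR R]; it is moved here, unchanged, to
   the canonical measurable structure of [R], which is the one inferred on
   [R * R * R]. *)
Section Lebesgue.
Variable R : realType.

Definition leb (A : set R) : \bar R := @lebesgue_measure R A.

Let leb0 : leb set0 = 0%E. Proof. exact: measure0. Qed.

Let leb_ge0 A : (0 <= leb A)%E. Proof. exact: measure_ge0. Qed.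

Let leb_semi_sigma_additive : semi_sigma_additive leb.
Proof. exact: (@measure_semi_sigma_additive _ _ _ (@lebesgue_measure R)). Qed.

HB.instance Definition _ :=
  isMeasure.Build _ R R leb leb0 leb_ge0 leb_semi_sigma_additive.

Let leb_sigma_finite : sigma_finite setT leb.
Proof. exact: (@sigma_finiteT _ _ _ (@lebesgue_measure R)). Qed.

HB.instance Definition _ := Measure_isSigmaFinite.Build _ R R leb leb_sigma_finite.

Definition leb2 : {measure set (R * R)%type -> \bar R} := (leb \x leb)%E.

Definition leb3 : {measure set (R3 R) -> \bar R} := (leb2 \x leb)%E.

End Lebesgue.

Section Euclidean.
Variable R : realType.
Implicit Types (x y : R3 R) (i : 'I_3).

Definition coord x i : R := tnth [tuple x.1.1; x.1.2; x.2] i.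

Definition evec i : R3 R :=
  (((i : nat) == 0)%:R, ((i : nat) == 1)%:R, ((i : nat) == 2)%:R).

Definition dot x y : R := \sum_(i < 3) coord x i * coord y i.

(* The norm `|x| that the library puts on a product is the sup norm. *)
Definition enorm x : R := Num.sqrt (dot x x).

End Euclidean.

Section Complex_valued.
Variable R : realType.
Local Notation C := R[i].
Implicit Types (f : R3 R -> C).

Definition cabs (z : C) : R := ComplexField.Normc.normc z.

Definition expi (t : R) : C := cos t +i* sin t.

Definition re_fun f : R3 R -> R := fun x => complex.Re (f x).
Definition im_fun f : R3 R -> R := fun x => complex.Im (f x).

Definition cmeasurable f : Prop :=
  measurable_fun [set: R3 R] (re_fun f) /\ measurable_fun [set: R3 R] (im_fun f).

Definition cintegrable f : Prop :=
  (leb3 R).-integrable [set: R3 R] (EFin \o re_fun f) /\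
  (leb3 R).-integrable [set: R3 R] (EFin \o im_fun f).

Definition cintegral f : C :=
  (\int[leb3 R]_x re_fun f x) +i* (\int[leb3 R]_x im_fun f x).

Definition partial (i : 'I_3) f : R3 R -> C :=
  fun x => ('D_(evec R i) (re_fun f) x) +i* ('D_(evec R i) (im_fun f) x).

Definition partials (s : seq 'I_3) f : R3 R -> C := foldr partial f s.

Definition smooth f : Prop := forall (s : seq 'I_3) (x : R3 R),
  differentiable (re_fun (partials s f)) x /\
  differentiable (im_fun (partials s f)) x.

Definition test_function f : Prop :=
  smooth f /\ exists M : R, forall x, M < enorm x -> f x = 0.

Definition schwartz f : Prop :=
  smooth f /\ forall (N : nat) (s : seq 'I_3), exists M : R, forall x,
    (1 + enorm x) ^+ N * cabs (partials s f x) <= M.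

(* With this normalization (no 2 pi in the exponent) d/dx_j has symbol i xi_j and
   sqrt (- Delta) has symbol |xi|. *)
Definition fourier_schwartz f : R3 R -> C :=
  fun xi => cintegral (fun x => expi (- dot x xi) * f x).

End Complex_valued.

Section Distributions.
Variable R : realType.
Local Notation C := R[i].
(* A distribution is a functional on all functions, of which only the values on
   Schwartz functions (or on test functions) matter. *)
Local Notation functional := ((R3 R -> C) -> C).
Implicit Types (f F : R3 R -> C) (T S : functional).

(* Linearity, and continuity for the Schwartz seminorms: |T phi| is bounded by c
   times the maximum of finitely many of them, here given through an upper bound M. *)
Definition tempered T : Prop :=
  (forall (a : C) phi psi, schwartz phi -> schwartz psi ->
     T (fun x => a * phi x + psi x) = a * T phi + T psi) /\
  (exists (N : nat) (c : R), forall phi (M : R), schwartz phi ->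
     (forall (s : seq 'I_3) x, (size s <= N)%N ->
        (1 + enorm x) ^+ N * cabs (partials s phi x) <= M) ->
     cabs (T phi) <= c * M).

(* For such f the functional [distr f] is the tempered distribution f. *)
Definition tempered_function f : Prop :=
  cmeasurable f /\
  forall phi, schwartz phi -> cintegrable (fun x => f x * phi x).

Definition distr f : functional := fun phi => cintegral (fun x => f x * phi x).

Definition dpartial (i : 'I_3) T : functional := fun phi => - T (partial i phi).

Definition dlaplacian T : functional :=
  \sum_(i < 3) dpartial i (dpartial i T).

Definition ddiv (V : 'I_3 -> functional) : functional :=
  \sum_(i < 3) dpartial i (V i).

Definition eq_tempered T S : Prop := forall phi, schwartz phi -> T phi = S phi.

Definition eq_distr T S : Prop := forall phi, test_function phi -> T phi = S phi.

(* <T^, phi> = <T, phi^> *)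
Definition dfourier T : functional := fun phi => T (fourier_schwartz phi).

(* The Fourier transform of T is a function, namely F (unique up to a null set). *)
Definition has_fourier T F : Prop :=
  [/\ tempered T, tempered_function F & eq_tempered (dfourier T) (distr F)].

(* The elements of Hdot^s are tempered distributions whose Fourier transform is a
   function. For F in L^1_loc with |xi|^s F in L^2, the integrability of F phi for
   every Schwartz phi, part of [has_fourier], is automatic. *)
Definition Hdot (s : R) T : Prop :=
  exists F, has_fourier T F /\
    ('N[leb3 R]_2%:E [(fun xi => (enorm xi `^ s * cabs (F xi))%:E)] < +oo)%E.

Definition fourier_multiplier (m : R3 R -> R) T S : Prop :=
  exists F, has_fourier T F /\ has_fourier S (fun xi => (m xi)%:C * F xi).

(* The multiplier is applied to T in the sense of distributions: S is
   e^(r sqrt (- Delta)) T. *)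
Definition Gspace (s r : R) T : Prop :=
  Hdot s T /\
  exists S, fourier_multiplier (fun xi => expR (r * enorm xi)) T S /\ Hdot s S.

(* The symbol is undefined only at xi = 0, a null set. *)
Definition inv_neg_laplacian T S : Prop :=
  fourier_multiplier (fun xi => (enorm xi ^+ 2)^-1) T S.

End Distributions.

Section Boussinesq.
Variable R : realType.
Local Notation C := R[i].
Implicit Types (f theta P : R3 R -> R) (u g : R3 R -> R3 R).

Definition cfun f : R3 R -> C := fun x => (f x)%:C.

Definition component u (i : 'I_3) : R3 R -> R := fun x => coord (u x) i.

Definition Hdot_fun (s : R) f : Prop :=
  tempered_function (cfun f) /\ Hdot s (distr (cfun f)).

Definition Gspace_fun (s r : R) f : Prop :=
  tempered_function (cfun f) /\ Gspace s r (distr (cfun f)).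

Definition Hdot_field (s : R) u : Prop := forall i, Hdot_fun s (component u i).

Definition Gspace_field (s r : R) u : Prop := forall i, Gspace_fun s r (component u i).

Local Notation "[[ f ]]" := (distr (cfun f)).

(* j-th component of div (u tensor u). The products of functions appearing below
   are locally integrable for u, theta in Hdot^1 (so in L^6) and g in Hdot^(1/2)
   (so in L^3). *)
Definition div_tensor u (j : 'I_3) : (R3 R -> C) -> C :=
  ddiv (fun i => [[ fun x => component u i x * component u j x ]]).

Definition pressure g u theta P : Prop :=
  tempered_function (cfun P) /\
  exists A B : (R3 R -> C) -> C,
    [/\ inv_neg_laplacian (ddiv (div_tensor u)) A,
        inv_neg_laplacian (ddiv (fun j => [[ fun x => theta x * component g j x ]])) B
      & eq_tempered [[ P ]] (A - B)].

Definition boussinesq g u theta P : Prop :=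
  [/\ forall j : 'I_3,
        eq_distr
          (- dlaplacian [[ component u j ]] + div_tensor u j + dpartial j [[ P ]])
          [[ fun x => theta x * component g j x ]],
      eq_distr (ddiv (fun i => [[ component u i ]])) 0
    & eq_distr
        (- dlaplacian [[ theta ]]
           + ddiv (fun i => [[ fun x => theta x * component u i x ]])) 0].

Definition weak_solution g u theta : Prop :=
  exists P, pressure g u theta P /\ boussinesq g u theta P.

End Boussinesq.

Section Annuli.
Variable R : realType.

Definition annulus (k : nat) : set (R3 R) :=
  [set xi | 2 ^- k.+1 <= enorm xi <= 2 ^- k].

Definition Linfty_norm (A : set (R3 R)) (f : R3 R -> R) : \bar R :=
  'N[leb3 R]_+oo [ EFin \o (f \_ A) ].

Definition cabs3 (z : 'I_3 -> R[i]) : R :=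
  Num.sqrt (\sum_(i < 3) cabs (z i) ^+ 2).

End Annuli.

Arguments annulus R k : clear implicits.

(* Main.v *)
(* Let U and Theta be the Fourier transforms of u and theta. The dyadic bounds give
   |U|, |Theta| <= C / |xi| near the origin, which is square integrable there in
   dimension 3; together with the H^1 bound this makes (1 + |xi|^2) |U|^2 and
   (1 + |xi|^2) |Theta|^2 integrable.  The temperature equation becomes
     |xi|^2 Theta + i kappa sum_j xi_j (U_j * Theta) = 0   almost everywhere.
   Multiply it by conj(Theta) and integrate: the double integral of
   (xi . U(xi - eta)) Theta(eta) conj(Theta(xi)) is absolutely convergent, and it is
   real, because U(-xi) = conj(U(xi)) and xi . U(xi) = 0.  So the integral of
   |xi|^2 |Theta|^2 is both real and imaginary, hence zero, and theta = 0.  The force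
   then vanishes, and the same argument gives u = 0: testing the j-th and the k-th
   equations against d_k phi and d_j phi removes the pressure and shows that the
   symbol of the momentum equation is parallel to xi, so orthogonal to U. *)

Require Import Defs.
From HB Require Import structures.
From mathcomp Require Import all_boot all_order all_algebra.
From mathcomp Require Import all_classical all_reals all_analysis.
From mathcomp.real_closed Require Import complex.
From mathcomp Require Import ring lra measurable_realfun ess_sup_inf.
Set Implicit Arguments.
Unset Strict Implicit.
Unset Printing Implicit Defensive.
(* Again, since [coord] is also the name of a function of the vector library. *)
Import Defs.
Import Order.TTheory GRing.Theory Num.Theory.
Import numFieldNormedType.Exports.
Local Open Scope classical_set_scope.
Local Open Scope complex_scope.
Local Open Scope ring_scope.

(** The hypotheses give Fourier transforms only in the sense of distributions, while the energy
    argument needs the transforms of [u_i u_j] and [theta u_j] to be convolutions; this passage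
    shapes the proof. All testing is reduced to one family with explicit transforms, the modulated
    Gaussians. Against them, the relation between [f] and its transform [F] says that the Gaussian
    mollification of [f] is the inverse transform of [F] times a Gaussian. A Bessel inequality then
    turns the [H^1] bound on [F] into almost everywhere convergence of the mollifications, with an
    integrable majorant of their squares, and this is what lets products of two such functions pass
    to the limit. The equations, known only against compactly supported functions, reach the
    Gaussians through dilated cutoffs. Every test function is a tensor product of functions of one
    variable, so derivatives and transforms are computed on the line. The [kappa] of the overview is
    [(2 pi)^-3], the constant of Fourier inversion when the exponent carries no [2 pi]. *)

Local Notation Re := complex.Re.
Local Notation Im := complex.Im.

(** * Complex-valued integration *)

Section Modulus.
Variable R : realType.
Implicit Types (z w : R[i]).

Lemma ReD z w : Re (z + w) = Re z + Re w. Proof. by case: z w => [a b] [c d]. Qed.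
Lemma ImD z w : Im (z + w) = Im z + Im w. Proof. by case: z w => [a b] [c d]. Qed.
Lemma ReN z : Re (- z) = - Re z. Proof. by case: z. Qed.
Lemma ImN z : Im (- z) = - Im z. Proof. by case: z. Qed.
Lemma ReM z w : Re (z * w) = Re z * Re w - Im z * Im w.
Proof. by case: z w => [a b] [c d]. Qed.
Lemma ImM z w : Im (z * w) = Re z * Im w + Im z * Re w.
Proof. by case: z w => [a b] [c d]. Qed.
Lemma ReJ z : Re z^* = Re z. Proof. by case: z. Qed.
Lemma ImJ z : Im z^* = - Im z. Proof. by case: z. Qed.
Lemma cext z w : Re z = Re w -> Im z = Im w -> z = w.
Proof. by case: z w => [a b] [c d] /= -> ->. Qed.

Lemma conjcM z w : (z * w)^* = z^* * w^*.
Proof. by apply: cext; rewrite !(ReJ, ImJ, ReM, ImM); ring. Qed.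
Lemma conjcD z w : (z + w)^* = z^* + w^*.
Proof. by apply: cext; rewrite !(ReJ, ImJ, ReD, ImD)//; ring. Qed.
Lemma conjcN z : (- z)^* = - z^*.
Proof. by apply: cext; rewrite !(ReJ, ImJ, ReN, ImN). Qed.
Lemma conjcR (x : R) : (x%:C)^* = x%:C.
Proof. by apply: cext; rewrite /= ?oppr0. Qed.

Lemma cabs_ge0 z : 0 <= cabs z.
Proof. by case: z => a b; rewrite /cabs /=; exact: sqrtr_ge0. Qed.
Lemma cabs2 z : cabs z ^+ 2 = Re z ^+ 2 + Im z ^+ 2.
Proof. by case: z => a b; rewrite /cabs /= sqr_sqrtr// addr_ge0// sqr_ge0. Qed.
Lemma cabs2E z : (cabs z ^+ 2)%:C = z * z^*.
Proof. by rewrite cabs2; apply: cext; rewrite /= !(ReM, ImM, ReJ, ImJ); ring. Qed.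
Lemma cabsM z w : cabs (z * w) = cabs z * cabs w.
Proof. exact: ComplexField.Normc.normcM. Qed.
Lemma cabsR (x : R) : cabs x%:C = `|x|.
Proof. by rewrite /cabs /= expr0n /= addr0 sqrtr_sqr. Qed.
Lemma cabsJ z : cabs z^* = cabs z.
Proof. by case: z => a b; rewrite /cabs /= sqrrN. Qed.
Lemma cabsN z : cabs (- z) = cabs z.
Proof. by case: z => a b; rewrite /cabs /= !sqrrN. Qed.
Lemma cabs_Re z : `|Re z| <= cabs z.
Proof.
rewrite -(@ler_pXn2r _ 2)// ?nnegrE ?cabs_ge0// cabs2 real_normK ?num_real//.
by rewrite lerDl sqr_ge0.
Qed.
Lemma cabs_Im z : `|Im z| <= cabs z.
Proof.
rewrite -(@ler_pXn2r _ 2)// ?nnegrE ?cabs_ge0// cabs2 real_normK ?num_real//.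
by rewrite lerDr sqr_ge0.
Qed.
Lemma cabs_le z : cabs z <= `|Re z| + `|Im z|.
Proof.
rewrite -(@ler_pXn2r _ 2)// ?nnegrE ?cabs_ge0 ?addr_ge0// cabs2 sqrrD.
rewrite !real_normK ?num_real// -addrA lerD2l lerDr.
by rewrite mulrn_wge0// mulr_ge0.
Qed.
Lemma cabsD z w : cabs (z + w) <= cabs z + cabs w.
Proof.
have := ComplexField.lec_normD z w; rewrite /ComplexField.lec /= => /andP[_].
by [].
Qed.
Lemma cabsB z w : cabs (z - w) <= cabs z + cabs w.
Proof. by rewrite (le_trans (cabsD _ _))// cabsN. Qed.
Lemma cabs_eq0 z : cabs z = 0 -> z = 0. Proof. exact: ComplexField.Normc.eq0_normc. Qed.
Lemma cabsX z n : cabs (z ^+ n) = cabs z ^+ n.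
Proof.
elim: n => [|n IH]; first by rewrite !expr0 -(normr1 R) -cabsR.
by rewrite !exprS cabsM IH.
Qed.
Lemma cabs_expi (t : R) : cabs (expi t) = 1.
Proof. by rewrite /cabs /expi /= cos2Dsin2 sqrtr1. Qed.
Lemma expiD (s t : R) : expi (s + t) = expi s * expi t.
Proof. by apply: cext; rewrite ?ReM ?ImM /= ?cosD ?sinD//; ring. Qed.
Lemma expi0 : expi 0 = 1 :> R[i].
Proof. by apply: cext; rewrite /= ?cos0 ?sin0. Qed.
Lemma expiN (t : R) : expi (- t) = (expi t)^*.
Proof. by apply: cext; rewrite /= ?cosN ?sinN. Qed.

End Modulus.

Section ComplexMeasurable.
Context d (T : measurableType d) (R : realType).
Implicit Types (f g : T -> R[i]).

Definition cmeas f := measurable_fun setT (fun x => Re (f x)) /\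
  measurable_fun setT (fun x => Im (f x)).

Lemma cmeasD f g : cmeas f -> cmeas g -> cmeas (fun x => f x + g x).
Proof.
move=> [? ?] [? ?]; split.
  by under eq_fun do rewrite ReD; exact: measurable_funD.
by under eq_fun do rewrite ImD; exact: measurable_funD.
Qed.
Lemma cmeasN f : cmeas f -> cmeas (fun x => - f x).
Proof.
move=> [? ?]; split.
  by under eq_fun do rewrite ReN; exact: measurableT_comp.
by under eq_fun do rewrite ImN; exact: measurableT_comp.
Qed.
Lemma cmeasB f g : cmeas f -> cmeas g -> cmeas (fun x => f x - g x).
Proof. by move=> mf mg; apply: cmeasD => //; exact: cmeasN. Qed.
Lemma cmeasJ f : cmeas f -> cmeas (fun x => (f x)^*).
Proof.
move=> [? ?]; split.
  by under eq_fun do rewrite ReJ.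
by under eq_fun do rewrite ImJ; exact: measurableT_comp.
Qed.
Lemma cmeasM f g : cmeas f -> cmeas g -> cmeas (fun x => f x * g x).
Proof.
move=> [? ?] [? ?]; split.
  under eq_fun do rewrite ReM.
  by apply: measurable_funB; apply: measurable_funM.
under eq_fun do rewrite ImM.
by apply: measurable_funD; apply: measurable_funM.
Qed.
Lemma cmeas_cst (c : R[i]) : cmeas (fun=> c).
Proof. by split; exact: measurable_cst. Qed.
Lemma cmeasR (h : T -> R) : measurable_fun setT h -> cmeas (fun x => (h x)%:C).
Proof. by move=> mh; split => //=; exact: measurable_cst. Qed.
Lemma cmeas_expi (h : T -> R) : measurable_fun setT h -> cmeas (fun x => expi (h x)).
Proof.
move=> mh; split => /=.
  by apply: measurableT_comp => //; apply: continuous_measurable_fun; exact: continuous_cos.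
by apply: measurableT_comp => //; apply: continuous_measurable_fun; exact: continuous_sin.
Qed.
Lemma cmeas_cabs f : cmeas f -> measurable_fun setT (fun x => cabs (f x)).
Proof.
move=> [mr mi].
have -> : (fun x => cabs (f x)) = (fun x => Num.sqrt (Re (f x) ^+ 2 + Im (f x) ^+ 2)).
  by apply/funext => x; rewrite -cabs2 sqrtr_sqr ger0_norm// cabs_ge0.
have ms : measurable_fun setT (@Num.sqrt R).
  by apply: continuous_measurable_fun; exact: sqrt_continuous.
apply: (measurableT_comp ms).
by apply: measurable_funD; apply: measurable_funX.
Qed.
Lemma cmeas_sum (I : Type) (s : seq I) (F : I -> T -> R[i]) :
  (forall i, cmeas (F i)) -> cmeas (fun x => \sum_(i <- s) F i x).
Proof.
move=> mF; elim: s => [|i s IH].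
  by under eq_fun do rewrite big_nil; exact: cmeas_cst.
by under eq_fun do rewrite big_cons; exact: cmeasD.
Qed.

End ComplexMeasurable.

Lemma cmeas_comp d d' (T : measurableType d) (T' : measurableType d') (R : realType)
  (f : T -> R[i]) (h : T' -> T) : cmeas f -> measurable_fun setT h ->
  cmeas (fun x => f (h x)).
Proof.
move=> [mr mi] mh; split.
  exact: (measurableT_comp mr mh).
exact: (measurableT_comp mi mh).
Qed.

Section ComplexIntegral.
Context d (T : measurableType d) (R : realType) (mu : {measure set T -> \bar R}).
Implicit Types (f g : T -> R[i]).

(** Componentwise and over an arbitrary measure: the same calculus serves on the line, on [R^3] and
    on [R^3 x R^3]. On [leb3s] the integral [cint] is convertible to [cintegral]. *)
Definition cintb f := mu.-integrable setT (fun x => (Re (f x))%:E) /\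
  mu.-integrable setT (fun x => (Im (f x))%:E).

Definition cint f : R[i] := (\int[mu]_x Re (f x)) +i* (\int[mu]_x Im (f x)).

Lemma rintegrable_le (h k : T -> R) : measurable_fun setT h ->
  mu.-integrable setT (EFin \o k) -> (forall x, `|h x| <= k x) ->
  mu.-integrable setT (EFin \o h).
Proof.
move=> mh ik hk; apply: (le_integrable measurableT _ _ ik).
  exact/measurable_EFinP.
by move=> x _ /=; rewrite lee_fin (le_trans (hk x))// ler_norm.
Qed.

Lemma cintb_meas f : cintb f -> cmeas f.
Proof. by move=> [/measurable_int/measurable_EFinP ? /measurable_int/measurable_EFinP ?]. Qed.

Lemma cintb_abs f : cintb f -> mu.-integrable setT (EFin \o (fun x => cabs (f x))).
Proof.
move=> fi; have mf := cintb_meas fi; case: fi => ir mul_imag.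
apply: (@rintegrable_le _ (fun x => `|Re (f x)| + `|Im (f x)|)).
- exact: cmeas_cabs.
- have -> : EFin \o (fun x => `|Re (f x)| + `|Im (f x)|) =
    (EFin \o (fun x => `|Re (f x)|)) \+ (EFin \o (fun x => `|Im (f x)|)).
    by apply/funext => x; rewrite /= EFinD.
  by apply: integrableD => //; exact: integrable_norm.
- by move=> x; rewrite ger0_norm ?cabs_ge0// cabs_le.
Qed.

Lemma cintb_le f (k : T -> R) : cmeas f -> mu.-integrable setT (EFin \o k) ->
  (forall x, cabs (f x) <= k x) -> cintb f.
Proof.
move=> [mr mi] ik fk; split.
  by apply: (rintegrable_le mr ik) => x; rewrite (le_trans (cabs_Re _)).
by apply: (rintegrable_le mi ik) => x; rewrite (le_trans (cabs_Im _)).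
Qed.

Lemma cintbD f g : cintb f -> cintb g -> cintb (fun x => f x + g x).
Proof.
move=> [? ?] [? ?]; split.
  by under eq_fun do rewrite ReD EFinD; apply: integrableD.
by under eq_fun do rewrite ImD EFinD; apply: integrableD.
Qed.

Lemma cintbN f : cintb f -> cintb (fun x => - f x).
Proof.
move=> [? ?]; split.
  by under eq_fun do rewrite ReN EFinN; apply: integrableN.
by under eq_fun do rewrite ImN EFinN; apply: integrableN.
Qed.

Lemma cintbJ f : cintb f -> cintb (fun x => (f x)^*).
Proof.
move=> [? ?]; split.
  by under eq_fun do rewrite ReJ.
by under eq_fun do rewrite ImJ EFinN; apply: integrableN.
Qed.

Lemma cintbZ (c : R[i]) f : cintb f -> cintb (fun x => c * f x).
Proof.
move=> fi; apply: (@cintb_le _ (fun x => cabs c * cabs (f x))).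
- by apply: cmeasM; [exact: cmeas_cst|exact: cintb_meas].
- by rewrite /comp; under eq_fun do rewrite EFinM; apply: integrableZl => //; exact: cintb_abs.
- by move=> x; rewrite cabsM.
Qed.

Lemma cintb0 : cintb (fun=> 0).
Proof. by split; exact: integrable0. Qed.

Lemma cintb_sum (I : Type) (s : seq I) (F : I -> T -> R[i]) :
  (forall i, cintb (F i)) -> cintb (fun x => \sum_(i <- s) F i x).
Proof.
move=> mF; elim: s => [|i s IH].
  by under eq_fun do rewrite big_nil; exact: cintb0.
by under eq_fun do rewrite big_cons; exact: cintbD.
Qed.

Lemma cintD f g : cintb f -> cintb g -> cint (fun x => f x + g x) = cint f + cint g.
Proof.
move=> [? ?] [? ?]; apply: cext => /=.
  by under eq_Rintegral do rewrite ReD; rewrite RintegralD.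
by under eq_Rintegral do rewrite ImD; rewrite RintegralD.
Qed.

Lemma cint0 : cint (fun=> 0) = 0.
Proof.
by rewrite /cint /= /Rintegral integral0.
Qed.

Lemma cintZ (c : R[i]) f : cintb f -> cint (fun x => c * f x) = c * cint f.
Proof.
move=> [ir mul_imag].
have h (a : R) (k : T -> R) : mu.-integrable setT (fun x => (k x)%:E) ->
    mu.-integrable setT (EFin \o (fun x => a * k x)).
  by move=> ik; rewrite /comp; under eq_fun do rewrite EFinM; apply: integrableZl.
apply: cext => /=.
  under eq_Rintegral do rewrite ReM.
  by rewrite RintegralB//; try exact: h; rewrite !RintegralZl// ReM.
under eq_Rintegral do rewrite ImM.
by rewrite RintegralD//; try exact: h; rewrite !RintegralZl// ImM.
Qed.

Lemma cintN f : cintb f -> cint (fun x => - f x) = - cint f.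
Proof.
move=> fi; rewrite -mulN1r -cintZ//; congr cint.
by apply/funext => x; rewrite mulN1r.
Qed.

Lemma cintB f g : cintb f -> cintb g -> cint (fun x => f x - g x) = cint f - cint g.
Proof. by move=> fi gi; rewrite cintD//; [rewrite cintN|exact: cintbN]. Qed.

Lemma cintJ f : cintb f -> cint (fun x => (f x)^*) = (cint f)^*.
Proof.
move=> [ir mul_imag]; apply: cext => /=.
  by under eq_Rintegral do rewrite ReJ.
under eq_Rintegral do rewrite ImJ -mulN1r.
by rewrite RintegralZl// mulN1r.
Qed.

Lemma cint_sum (I : Type) (s : seq I) (F : I -> T -> R[i]) :
  (forall i, cintb (F i)) -> cint (fun x => \sum_(i <- s) F i x) = \sum_(i <- s) cint (F i).
Proof.
move=> mF; elim: s => [|i s IH].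
  by rewrite big_nil; under eq_fun do rewrite big_nil; exact: cint0.
rewrite big_cons -IH -cintD//; last exact: cintb_sum.
by under eq_fun do rewrite big_cons.
Qed.

Lemma cint_ae f g : cmeas f -> cmeas g -> {ae mu, forall x, f x = g x} -> cint f = cint g.
Proof.
move=> [m1 m2] [m3 m4] fg; apply: cext => /=; congr fine.
  apply: ae_eq_integral => //; try exact/measurable_EFinP.
  by apply: filterS fg => x /= ->.
apply: ae_eq_integral => //; try exact/measurable_EFinP.
by apply: filterS fg => x /= ->.
Qed.

Lemma cintbR (h : T -> R) : mu.-integrable setT (EFin \o h) -> cintb (fun x => (h x)%:C).
Proof. by move=> ih; split => //=; exact: integrable0. Qed.

Lemma cintR (h : T -> R) : cint (fun x => (h x)%:C) = (\int[mu]_x h x)%:C.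
Proof. by apply: cext => //=; rewrite /Rintegral integral0. Qed.

End ComplexIntegral.

(** * Limits of complex sequences and dominated convergence *)

Section ComplexLimits.
Variable R : realType.

(** Componentwise, so that limit theorems for real sequences and integrals apply directly; [ccvgP]
    is the equivalent form with the modulus. *)
Definition ccvg (z : nat -> R[i]) (l : R[i]) :=
  (Re (z n) @[n --> \oo] --> Re l) /\ (Im (z n) @[n --> \oo] --> Im l).

Lemma ccvg_unique z l l' : ccvg z l -> ccvg z l' -> l = l'.
Proof. by move=> [h1 h2] [h3 h4]; apply: cext; [exact: (cvg_unique _ h1 h3)|exact: (cvg_unique _ h2 h4)]. Qed.

Lemma ccvgM z w l m : ccvg z l -> ccvg w m -> ccvg (fun n => z n * w n) (l * m).
Proof.
move=> [h1 h2] [h3 h4]; split.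
  under eq_fun do rewrite ReM; rewrite ReM.
  by apply: cvgB; apply: cvgM.
under eq_fun do rewrite ImM; rewrite ImM.
by apply: cvgD; apply: cvgM.
Qed.
Lemma ccvgD z w l m : ccvg z l -> ccvg w m -> ccvg (fun n => z n + w n) (l + m).
Proof.
move=> [h1 h2] [h3 h4]; split.
  by under eq_fun do rewrite ReD; rewrite ReD; apply: cvgD.
by under eq_fun do rewrite ImD; rewrite ImD; apply: cvgD.
Qed.
Lemma ccvg_cst l : ccvg (fun=> l) l.
Proof. by split; exact: cvg_cst. Qed.
Lemma ccvgR (x : nat -> R) (l : R) : x n @[n --> \oo] --> l -> ccvg (fun n => (x n)%:C) l%:C.
Proof. by move=> h; split => //=; exact: cvg_cst. Qed.
Lemma ccvgP z l : ccvg z l <-> cabs (z n - l) @[n --> \oo] --> (0 : R).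
Proof.
split=> [[h1 h2]|h].
  have h0 : `|Re (z n) - Re l| + `|Im (z n) - Im l| @[n --> \oo] --> (0 : R).
    rewrite -[X in _ --> X](addr0 0); apply: cvgD; apply/norm_cvg0P.
      by rewrite -(subrr (Re l)); apply: cvgB => //; exact: cvg_cst.
    by rewrite -(subrr (Im l)); apply: cvgB => //; exact: cvg_cst.
  apply: (squeeze_cvgr _ (cvg_cst 0) h0); apply: nearW => n.
  by rewrite cabs_ge0 /= (le_trans (cabs_le _))// ReD ReN ImD ImN.
split; apply/subr_cvg0/norm_cvg0P.
  apply: (squeeze_cvgr _ (cvg_cst 0) h); apply: nearW => n.
  by rewrite normr_ge0 /= -ReN -ReD cabs_Re.
apply: (squeeze_cvgr _ (cvg_cst 0) h); apply: nearW => n.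
by rewrite normr_ge0 /= -ImN -ImD cabs_Im.
Qed.

End ComplexLimits.

Section Dominated.
Context d (T : measurableType d) (R : realType) (mu : {measure set T -> \bar R}).

Lemma Rint_dominated_ae (f_ : nat -> T -> R) (f g : T -> R) :
  (forall n, measurable_fun setT (f_ n)) -> measurable_fun setT f ->
  {ae mu, forall x, f_ n x @[n --> \oo] --> f x} ->
  mu.-integrable setT (EFin \o g) -> {ae mu, forall x, forall n, `|f_ n x| <= g x} ->
  mu.-integrable setT (EFin \o f) /\
  (\int[mu]_x f_ n x) @[n --> \oo] --> \int[mu]_x f x.
Proof.
move=> mf_ mf cf ig fg.
have [||||i1 _ i3] := @dominated_convergence _ T R mu setT measurableT
  (fun n x => (f_ n x)%:E) (EFin \o f) (EFin \o g) _ _ _ ig _.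
- by move=> n; exact/measurable_EFinP.
- exact/measurable_EFinP.
- apply: filterS cf => x h _; apply: cvg_EFin => //; exact: nearW.
- by apply: filterS fg => x h n _; rewrite /= lee_fin.
split => //; apply: fine_cvg; rewrite fineK//.
by apply: integrable_fin_num.
Qed.

Lemma cint_dominated_ae (f_ : nat -> T -> R[i]) (f : T -> R[i]) (g : T -> R) :
  (forall n, cmeas (f_ n)) -> cmeas f ->
  {ae mu, forall x, ccvg (f_ ^~ x) (f x)} ->
  mu.-integrable setT (EFin \o g) -> {ae mu, forall x, forall n, cabs (f_ n x) <= g x} ->
  cintb mu f /\ ccvg (fun n => cint mu (f_ n)) (cint mu f).
Proof.
move=> mf_ [mr mi] cf ig fg.
have [||i1 c1] := @Rint_dominated_ae (fun n x => Re (f_ n x)) _ g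
  (fun n => (mf_ n).1) mr _ ig _.
- by apply: filterS cf => x [].
- by apply: filterS fg => x h n; exact: le_trans (cabs_Re _) (h n).
have [||i2 c2] := @Rint_dominated_ae (fun n x => Im (f_ n x)) _ g
  (fun n => (mf_ n).2) mi _ ig _.
- by apply: filterS cf => x [].
- by apply: filterS fg => x h n; exact: le_trans (cabs_Im _) (h n).
by [].
Qed.

Lemma cint_dominated (f_ : nat -> T -> R[i]) (f : T -> R[i]) (g : T -> R) :
  (forall n, cmeas (f_ n)) -> cmeas f ->
  {ae mu, forall x, ccvg (f_ ^~ x) (f x)} ->
  mu.-integrable setT (EFin \o g) -> (forall n x, cabs (f_ n x) <= g x) ->
  cintb mu f /\ ccvg (fun n => cint mu (f_ n)) (cint mu f).
Proof.
move=> mf_ mf cf ig fg; apply: (cint_dominated_ae mf_ mf cf ig).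
by apply: aeW => x n; exact: fg.
Qed.

End Dominated.

(** * Product measures and Fubini's theorem *)

Section ProductMeasure.
Context d1 d2 (T1 : measurableType d1) (T2 : measurableType d2) (R : realType).
Variables (m1 : {sigma_finite_measure set T1 -> \bar R})
  (m2 : {sigma_finite_measure set T2 -> \bar R}).

Lemma product_sigma_finite : sigma_finite setT (m1 \x m2)%E.
Proof.
have /sigma_finiteP[F [TF ndF Foo]] := sigma_finiteT m1.
have /sigma_finiteP[G [TG ndG Goo]] := sigma_finiteT m2.
exists (fun n => F n `*` G n).
  rewrite -setXTT TF TG predeqE => -[x y]; split.
    move=> [/= [n _ Fnx] [k _ Gky]]; exists (maxn n k) => //; split.
    - by move: x Fnx; exact/subsetPset/ndF/leq_maxl.
    - by move: y Gky; exact/subsetPset/ndG/leq_maxr.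
  by move=> [n _ []/= ? ?]; split; exists n.
move=> k; have [? ?] := Foo k; have [? ?] := Goo k.
split; first exact: measurableX.
by rewrite product_measure1E// lte_mul_pinfty// ge0_fin_numE.
Qed.

(** The product measure under a name of its own, to which a sigma-finite structure is attached:
    products can then be iterated, as in [leb3s] and in the measure on [R^3 x R^3]. *)
Definition prod_measure : set (T1 * T2) -> \bar R := (m1 \x m2)%E.
HB.instance Definition _ := Measure.on prod_measure.
HB.instance Definition _ := Measure_isSigmaFinite.Build _ _ _ prod_measure product_sigma_finite.

End ProductMeasure.

Section Fubini.
Context d1 d2 (T1 : measurableType d1) (T2 : measurableType d2) (R : realType).
Variables (m1 : {sigma_finite_measure set T1 -> \bar R})
  (m2 : {sigma_finite_measure set T2 -> \bar R}).
Implicit Type f : T1 * T2 -> R[i].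

(** The real-valued inner integral is [fine] of the extended one; the two agree where the section is
    integrable, hence almost everywhere, and that is enough for the outer integral. *)
Lemma rfubini1 (h : T1 * T2 -> R) : (m1 \x m2)%E.-integrable setT (EFin \o h) ->
  m1.-integrable setT (EFin \o (fun x => \int[m2]_y h (x, y))) /\
  \int[(m1 \x m2)%E]_z h z = \int[m1]_x \int[m2]_y h (x, y).
Proof.
move=> ih; have iF := integrable_fubini_F ih.
have ae : {ae m1, forall x, fubini_F m2 (EFin \o h) x = (\int[m2]_y h (x, y))%:E}.
  have := ae_integrable1 ih; apply: filterS => x ix.
  by rewrite /fubini_F /Rintegral fineK//; exact: integrable_fin_num.
have mF : measurable_fun setT (EFin \o (fun x => \int[m2]_y h (x, y))).
  apply/measurable_EFinP; rewrite /Rintegral.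
  apply: (@measurableT_comp _ _ _ _ _ _ fine) => //.
  exact: (measurable_int _ iF).
split.
  apply: (le_integrable measurableT mF _ iF) => x _ /=.
  (* [fine] sends an infinite inner integral to 0, so the bound persists there. *)
  by rewrite /fubini_F /Rintegral; case: integral => //= ; rewrite normr0 leey.
rewrite {1}/Rintegral -(integral12_prod_meas1 ih) /Rintegral; congr fine.
apply: ae_eq_integral => //; first exact: (measurable_int _ iF).
by apply: filterS ae => x.
Qed.

Lemma rfubini2 (h : T1 * T2 -> R) : (m1 \x m2)%E.-integrable setT (EFin \o h) ->
  m2.-integrable setT (EFin \o (fun y => \int[m1]_x h (x, y))) /\
  \int[(m1 \x m2)%E]_z h z = \int[m2]_y \int[m1]_x h (x, y).
Proof.
move=> ih; have mG := measurable_fubini_G ih.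
(* Integrability of the marginal, by Tonelli for [|h|] and [|int h| <= int |h|]. *)
have iG : m2.-integrable setT (fubini_G m1 (EFin \o h)).
  apply/integrableP; split => //.
  have /(integrable21ltyP _ _ (measurable_int _ ih)) := ih.
  apply: le_lt_trans; apply: ge0_le_integral => //.
  - exact: measurableT_comp.
  - apply: (measurable_fun_fubini_tonelli_G (fun z => `|(EFin \o h) z|%E)) => //.
    by apply: measurableT_comp => //; exact: (measurable_int _ ih).
  - move=> y _; apply: le_abse_integral => //.
    exact: (measurableT_comp (measurable_int _ ih)).
have ae : {ae m2, forall x, fubini_G m1 (EFin \o h) x = (\int[m1]_y h (y, x))%:E}.
  have := ae_integrable2 ih; apply: filterS => x ix.
  by rewrite /fubini_G /Rintegral fineK//; exact: integrable_fin_num.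
have mF : measurable_fun setT (EFin \o (fun x => \int[m1]_y h (y, x))).
  apply/measurable_EFinP; rewrite /Rintegral.
  apply: (@measurableT_comp _ _ _ _ _ _ fine) => //.
split.
  apply: (le_integrable measurableT mF _ iG) => x _ /=.
  by rewrite /fubini_G /Rintegral; case: integral => //= ; rewrite normr0 leey.
rewrite {1}/Rintegral -(integral21_prod_meas1 ih) /Rintegral; congr fine.
apply: ae_eq_integral => //.
by apply: filterS ae => x.
Qed.

Lemma cfubini1 f : cintb (m1 \x m2)%E f ->
  cintb m1 (fun x => cint m2 (fun y => f (x, y))) /\
  cint (m1 \x m2)%E f = cint m1 (fun x => cint m2 (fun y => f (x, y))).
Proof.
move=> [/rfubini1[i1 e1] /rfubini1[i2 e2]].
by split => //; apply: cext.
Qed.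

Lemma cfubini2 f : cintb (m1 \x m2)%E f ->
  cintb m2 (fun y => cint m1 (fun x => f (x, y))) /\
  cint (m1 \x m2)%E f = cint m2 (fun y => cint m1 (fun x => f (x, y))).
Proof.
move=> [/rfubini2[i1 e1] /rfubini2[i2 e2]].
by split => //; apply: cext.
Qed.

Lemma cfubini f : cintb (m1 \x m2)%E f ->
  cint m1 (fun x => cint m2 (fun y => f (x, y))) =
  cint m2 (fun y => cint m1 (fun x => f (x, y))).
Proof. by move=> fi; rewrite -(cfubini1 fi).2 (cfubini2 fi).2. Qed.

Lemma rintegrable_tensor (a : T1 -> R) (b : T2 -> R) :
  m1.-integrable setT (EFin \o a) -> m2.-integrable setT (EFin \o b) ->
  (m1 \x m2)%E.-integrable setT (EFin \o (fun z => a z.1 * b z.2)).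
Proof.
move=> ia ib.
have ma : measurable_fun setT a by apply/measurable_EFinP; exact: (measurable_int _ ia).
have mb : measurable_fun setT b by apply/measurable_EFinP; exact: (measurable_int _ ib).
have mab : measurable_fun setT (fun z : T1 * T2 => a z.1 * b z.2).
  by apply: measurable_funM; apply: measurableT_comp.
apply/integrable12ltyP; first exact/measurable_EFinP.
rewrite [ltLHS](_ : _ = (\int[m1]_x `|(a x)%:E| * \int[m2]_y `|(b y)%:E|)%E).
  apply: lte_mul_pinfty => /=.
  - by apply: integral_ge0 => *; rewrite ?abse_ge0 ?lee_fin.
  - have /integrableP[_ ] := ia; rewrite -ge0_fin_numE//.
    by apply: integral_ge0 => *; rewrite ?abse_ge0 ?lee_fin.
  - by have /integrableP[_ ] := ib.
rewrite -ge0_integralZr//; last 2 first.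
- by apply: measurableT_comp => //; exact/measurable_EFinP.
- by apply: integral_ge0 => *; rewrite ?abse_ge0 ?lee_fin.
apply: eq_integral => x _.
rewrite -ge0_integralZl//; last by apply: measurableT_comp => //; exact/measurable_EFinP.
by apply: eq_integral => y _; rewrite /= normrM EFinM.
Qed.

Lemma cintb_tensor (a : T1 -> R[i]) (b : T2 -> R[i]) : cintb m1 a -> cintb m2 b ->
  cintb (m1 \x m2)%E (fun z => a z.1 * b z.2).
Proof.
move=> ia ib; apply: (@cintb_le _ _ _ _ _ (fun z => cabs (a z.1) * cabs (b z.2))).
- apply: cmeasM; first by apply: (cmeas_comp (h := fst)) => //; exact: cintb_meas ia.
  by apply: (cmeas_comp (h := snd)) => //; exact: cintb_meas ib.
- exact: (@rintegrable_tensor (fun x => cabs (a x)) (fun y => cabs (b y)) (cintb_abs ia) (cintb_abs ib)).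
- by move=> z; rewrite cabsM.
Qed.

Lemma cint_tensor (a : T1 -> R[i]) (b : T2 -> R[i]) : cintb m1 a -> cintb m2 b ->
  cint (m1 \x m2)%E (fun z => a z.1 * b z.2) = cint m1 a * cint m2 b.
Proof.
move=> ia ib; rewrite (cfubini1 (cintb_tensor ia ib)).2 /=.
under eq_fun do rewrite cintZ// mulrC.
by rewrite cintZ// mulrC.
Qed.

End Fubini.

(** * Measure-preserving changes of variables *)

Section MeasurePreserving.
Context (R : realType).

Definition mpres d (T : measurableType d) (m : set T -> \bar R) (phi : T -> T) :=
  measurable_fun setT phi /\ forall A, measurable A -> m (phi @^-1` A) = m A.

Section one.
Context d (T : measurableType d).
Variables (m : {measure set T -> \bar R}) (phi : T -> T).
Hypothesis mp : mpres m phi.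

Let pm : {measure set T -> \bar R} :=
  @measure_function_pushforward__canonical__measure_function_Measure _ _ _ _ _ m phi mp.1.

Lemma ge0_mpres (f : T -> \bar R) : measurable_fun setT f -> (forall x, (0 <= f x)%E) ->
  (\int[m]_x f (phi x) = \int[m]_x f x)%E.
Proof.
move=> mf f0; have := @ge0_integral_pushforward _ _ _ _ _ phi mp.1 m setT f measurableT mf (fun x _ => f0 x).
rewrite preimage_setT => <-.
apply: (@eq_measure_integral _ _ _ _ m pm) => A mA _.
exact: mp.2.
Qed.

Lemma integrable_mpres (f : T -> \bar R) : m.-integrable setT f ->
  m.-integrable setT (f \o phi).
Proof.
move=> /integrableP[mf fi]; apply/integrableP; split.
  by apply: (measurableT_comp mf); exact: mp.1.
rewrite (@ge0_mpres (fun y => `|f y|%E))//; exact: measurableT_comp.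
Qed.

Lemma integral_mpres (f : T -> \bar R) : m.-integrable setT f ->
  (\int[m]_x f (phi x) = \int[m]_x f x)%E.
Proof.
move=> fi; rewrite [in RHS]integralE [in LHS]integralE; congr (_ - _)%E.
  under eq_integral do rewrite (funepos_comp f phi).
  by apply: (@ge0_mpres f^\+%E) => //; apply: measurable_funepos; exact: measurable_int fi.
under eq_integral do rewrite (funeneg_comp f phi).
by apply: (@ge0_mpres f^\-%E) => //; apply: measurable_funeneg; exact: measurable_int fi.
Qed.

Lemma cintb_mpres (f : T -> R[i]) : cintb m f -> cintb m (fun x => f (phi x)).
Proof. by move=> [/integrable_mpres ? /integrable_mpres ?]; split. Qed.

Lemma cint_mpres (f : T -> R[i]) : cintb m f -> cint m (fun x => f (phi x)) = cint m f.
Proof. by move=> [/integral_mpres h1 /integral_mpres h2]; apply: cext; congr fine. Qed.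

End one.

Section two.
Context d1 d2 (T1 : measurableType d1) (T2 : measurableType d2).
Variables (m1 : {sigma_finite_measure set T1 -> \bar R})
  (m2 : {sigma_finite_measure set T2 -> \bar R}).

Lemma mpres_prod (phi : T1 -> T1) (psi : T2 -> T2) : mpres m1 phi -> mpres m2 psi ->
  mpres (m1 \x m2)%E (fun z => (phi z.1, psi z.2)).
Proof.
move=> [mphi p1] [mpsi p2].
have mm : measurable_fun setT (fun z : T1 * T2 => (phi z.1, psi z.2)).
  by apply/measurable_fun_pair; apply: measurableT_comp.
split => // A mA; symmetry.
apply: (@product_measure_unique _ _ _ _ _ m1 m2 (@measure_function_pushforward__canonical__measure_function_Measure _ _ _ _ _ (m1 \x m2)%E _ mm)) => //= B D mB mD.
transitivity ((m1 \x m2)%E ((phi @^-1` B) `*` (psi @^-1` D))) => //.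
have mB' : measurable (phi @^-1` B) by rewrite -(setTI (phi @^-1` B)); exact: mphi.
have mD' : measurable (psi @^-1` D) by rewrite -(setTI (psi @^-1` D)); exact: mpsi.
by rewrite product_measure1E//; congr (_ * _)%E; [exact: p1|exact: p2].
Qed.

(** On the fibre over [x] the map is [tau x], so every section keeps its measure; integrating over
    [x] gives the claim. It is used for [(x, y) |-> (x, x - y)]. *)
Lemma mpres_shear (tau : T1 -> T2 -> T2) :
  measurable_fun setT (fun z : T1 * T2 => tau z.1 z.2) ->
  (forall x, mpres m2 (tau x)) ->
  mpres (m1 \x m2)%E (fun z => (z.1, tau z.1 z.2)).
Proof.
move=> mt pt.
have mm : measurable_fun setT (fun z : T1 * T2 => (z.1, tau z.1 z.2)).
  by apply/measurable_fun_pair.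
split => // A mA; rewrite /product_measure1; apply: eq_integral => x _ /=.
have mx : measurable (xsection A x) by exact: measurable_xsection.
by rewrite -((pt x).2 _ mx).
Qed.

End two.

Lemma mpres_swap d (T : measurableType d) (m : {sigma_finite_measure set T -> \bar R}) :
  mpres (m \x m)%E (fun z => (z.2, z.1)).
Proof.
have mm : measurable_fun setT (fun z : T * T => (z.2, z.1)).
  by apply/measurable_fun_pair.
split => // A mA; symmetry.
apply: (@product_measure_unique _ _ _ _ _ m m (@measure_function_pushforward__canonical__measure_function_Measure _ _ _ _ _ (m \x m)%E _ mm)) => //= B D mB mD.
transitivity ((m \x m)%E (D `*` B)); last by rewrite product_measure1E// muleC.
congr ((m \x m)%E _).
by apply/seteqP; split => -[x y] [].
Qed.

Lemma mpres_comp d (T : measurableType d) (m : {measure set T -> \bar R}) (f g : T -> T) :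
  mpres m f -> mpres m g -> mpres m (f \o g).
Proof.
move=> [mf pf] [mg pg]; split; first exact: measurableT_comp.
move=> A mA; have mfA : measurable (f @^-1` A) by rewrite -(setTI (f @^-1` A)); exact: mf.
exact: etrans (pg _ mfA) (pf _ mA).
Qed.

Lemma mpres_translation (t : R) : mpres (@leb R) (fun x => x + t).
Proof.
have mm : measurable_fun (setT : set (measurableTypeR R))
    ((fun x => x + t) : measurableTypeR R -> measurableTypeR R) by exact: measurable_funD.
split; first exact: mm.
move=> A mA; symmetry.
have := @lebesgue_measure_unique R (@measure_function_pushforward__canonical__measure_function_Measure _ _ _ _ _ (@lebesgue_measure R) _ mm).
apply => //= X /ocitvP[->|[[a b] /= ab ->]].
  by rewrite /pushforward preimage_set0 !measure0.
rewrite /pushforward [in RHS](_ : _ @^-1` _ = `]a - t, b - t]%classic).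
  rewrite !lebesgue_measure_itv /= !lte_fin ltrD2r; case: ifP => // _.
  by rewrite -!EFinB; congr EFin; ring.
by apply/seteqP; split => y /=; rewrite !in_itv/= ltrBlDr lerBrDr.
Qed.

Lemma mpres_opp : mpres (@leb R) (fun x => - x).
Proof.
have mm : measurable_fun (setT : set (measurableTypeR R))
    ((fun x => - x) : measurableTypeR R -> measurableTypeR R) by exact: oppr_measurable.
split; first exact: mm.
move=> A mA; symmetry.
have := @lebesgue_measure_unique R (@measure_function_pushforward__canonical__measure_function_Measure _ _ _ _ _ (@lebesgue_measure R) _ mm).
apply => //= X /ocitvP[->|[[a b] /= ab ->]].
  by rewrite /pushforward preimage_set0 !measure0.
(* The reflection moves the closed endpoint of []a, b]] to the other side, which does not affect the
   length. *)
rewrite /pushforward [in RHS](_ : _ @^-1` _ = `[- b, - a[%classic).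
  rewrite !lebesgue_measure_itv /= !lte_fin ltrN2; case: ifP => // _.
  by rewrite -!EFinB; congr EFin; ring.
by apply/seteqP; split => y /=; rewrite !in_itv/= lerNl ltrNr andbC.
Qed.

End MeasurePreserving.

(** * Lebesgue measure on the three-dimensional space *)

Section Leb3.
Variable R : realType.

Definition leb2s : {sigma_finite_measure set (R * R)%type -> \bar R} :=
  prod_measure (@leb R) (@leb R).
Definition leb3s : {sigma_finite_measure set (R3 R) -> \bar R} :=
  prod_measure leb2s (@leb R).

Definition add3 (x y : R3 R) : R3 R := (x.1.1 + y.1.1, x.1.2 + y.1.2, x.2 + y.2).
Definition opp3 (x : R3 R) : R3 R := (- x.1.1, - x.1.2, - x.2).

Lemma mpres_add3 (a : R3 R) : mpres leb3s (add3 a).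
Proof.
have h : forall t, mpres (@leb R) (fun x => t + x).
  by move=> t; under eq_fun do rewrite addrC; exact: mpres_translation.
exact: (@mpres_prod _ _ _ _ _ leb2s (@leb R) _ _ (@mpres_prod _ _ _ _ _ (@leb R) (@leb R) _ _ (h a.1.1) (h a.1.2)) (h a.2)).
Qed.
Lemma mpres_opp3 : mpres leb3s opp3.
Proof.
have h := mpres_opp R.
exact: (@mpres_prod _ _ _ _ _ leb2s (@leb R) _ _ (@mpres_prod _ _ _ _ _ (@leb R) (@leb R) _ _ h h) h).
Qed.

Lemma cintegralE (f : R3 R -> R[i]) : cintegral f = cint leb3s f.
Proof. by []. Qed.
End Leb3.

(* [leb] and the library's [lebesgue_measure] have distinct displays, hence
   inconvertible integrals: the former is the pushforward of the latter by the identity. *)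
Section Transfer.
Variable R : realType.

Let idR : measurableTypeR R -> R := fun x => x.
Let mid : measurable_fun setT idR. Proof. by move=> _ A mA; rewrite setTI. Qed.
Let pm : {measure set R -> \bar R} :=
  @measure_function_pushforward__canonical__measure_function_Measure _ _ _ _ _ (@lebesgue_measure R) idR mid.

Lemma leb_integral (D : set R) (f : R -> R) : measurable D -> measurable_fun (setT : set R) f ->
  (@lebesgue_measure R).-integrable D (EFin \o f) ->
  (@leb R).-integrable D (EFin \o f) /\
  (\int[@leb R]_(x in D) (f x)%:E = \int[@lebesgue_measure R]_(x in D) (f x)%:E)%E.
Proof.
move=> mD mf fi; have mf' : measurable_fun setT (EFin \o f) by exact/measurable_EFinP.
have ip := @integrable_pushforward _ _ _ _ R idR mid (@lebesgue_measure R) D (EFin \o f) mf' fi mD.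
have ep := @integral_pushforward _ _ _ _ R idR mid (@lebesgue_measure R) D (EFin \o f) mf' fi mD.
by split => //; rewrite -[RHS]ep.
Qed.

Lemma leb_integralT (f : R -> R) : measurable_fun (setT : set R) f ->
  (@lebesgue_measure R).-integrable setT (EFin \o f) ->
  (@leb R).-integrable setT (EFin \o f) /\
  \int[@leb R]_x f x = \int[@lebesgue_measure R]_x f x.
Proof.
by move=> mf fi; have [h1 h2] := leb_integral measurableT mf fi; split => //; rewrite /Rintegral h2.
Qed.

End Transfer.

(** * Gaussian integrals on the line *)

Section OneDimension.
Variable R : realType.
Implicit Types (f g h : R -> R) (A B : R -> R[i]).

Definition rder f f' := forall t : R, is_derive t (1 : R) f (f' t).

Lemma rder_ext f f' g' : rder f f' -> f' =1 g' -> rder f g'.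
Proof. by move=> df fg t; rewrite -fg. Qed.
Lemma rderM f f' g g' : rder f f' -> rder g g' ->
  rder (fun t => f t * g t) (fun t => f' t * g t + f t * g' t).
Proof.
move=> df dg t; have := df t; have := dg t => dg1 df1.
apply: (@is_derive_eq _ _ _ _ _ _ _ _ (@is_deriveM _ _ f g t 1 _ _ df1 dg1)).
by rewrite /GRing.scale /= addrC mulrC [X in _ + X]mulrC mulrC (mulrC (g' t)) addrC; ring.
Qed.
Lemma rderD f f' g g' : rder f f' -> rder g g' ->
  rder (fun t => f t + g t) (fun t => f' t + g' t).
Proof. by move=> df dg t; have := df t; have := dg t => dg1 df1; exact: (@is_deriveD _ _ _ f g t 1 _ _ df1 dg1). Qed.
Lemma rderN f f' : rder f f' -> rder (fun t => - f t) (fun t => - f' t).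
Proof. by move=> df t; have := df t => df1; exact: (@is_deriveN _ _ _ f t 1 _ df1). Qed.
Lemma rder_cst (c : R) : rder (fun=> c) (fun=> 0).
Proof. by move=> t; exact: is_derive_cst. Qed.
Lemma rder_id : rder (fun t => t) (fun=> 1).
Proof. by move=> t; exact: is_derive_id. Qed.
Lemma rderZ (c : R) f f' : rder f f' -> rder (fun t => c * f t) (fun t => c * f' t).
Proof.
move=> df; apply: (rder_ext (rderM (rder_cst c) df)) => t.
by rewrite mul0r add0r.
Qed.
Lemma rder_comp f f' g g' : rder f f' -> rder g g' ->
  rder (fun t => f (g t)) (fun t => f' (g t) * g' t).
Proof.
move=> df dg t; have := df (g t); have := dg t => dg1 df1.
exact: is_derive1_comp.
Qed.
Lemma rder_expR : rder expR expR. Proof. by move=> t; exact: is_derive_expR. Qed.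
Lemma rder_sin : rder sin cos. Proof. by move=> t; exact: is_derive_sin. Qed.
Lemma rder_cos : rder cos (fun t => - sin t). Proof. by move=> t; exact: is_derive_cos. Qed.
Lemma rder_aff (p q : R) : rder (fun t => p * t + q) (fun=> p).
Proof.
apply: (rder_ext (rderD (rderZ p rder_id) (rder_cst q))) => t.
by rewrite mulr1 addr0.
Qed.
Lemma rder_poly (p : {poly R}) : rder (fun t => p.[t]) (fun t => (deriv p).[t]).
Proof. by move=> t; exact: is_derive_poly. Qed.
Lemma rder_derivable f f' t : rder f f' -> derivable f t 1.
Proof. by move=> df; have := df t => df1; exact: ex_derive. Qed.
Lemma rder_continuous f f' : rder f f' -> continuous f.
Proof.
move=> df t; apply: differentiable_continuous; apply/derivable1_diffP.
exact: rder_derivable df.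
Qed.
Lemma rder_derive1 f f' : rder f f' -> derive1 f =1 f'.
Proof. by move=> df t; rewrite derive1E; have := df t => df1; exact: derive_val. Qed.
Lemma rder_measurable f f' : rder f f' -> measurable_fun setT f.
Proof. by move=> df; apply: continuous_measurable_fun; exact: rder_continuous df. Qed.

Definition gauss (a c t : R) : R := expR (- (a * (t - c) ^+ 2)).

Lemma gauss_ge0 a c t : 0 <= gauss a c t. Proof. exact: expR_ge0. Qed.

Lemma rder_gauss a c : rder (gauss a c) (fun t => - (2 * a * (t - c)) * gauss a c t).
Proof.
have d1 : rder (fun t => - (a * (t - c) ^+ 2)) (fun t => - (2 * a * (t - c))).
  have h := rder_aff 1 (- c).
  apply: (@rder_ext _ (fun t => - (a * (1 * (1 * t - c) + (1 * t - c) * 1)))).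
    have := rderN (rderZ a (rderM h h)); congr rder.
    by apply/funext => t; rewrite mul1r expr2.
  by move=> t; ring.
apply: (rder_ext (rder_comp rder_expR d1)) => t.
by rewrite mulrC.
Qed.

Lemma measurable_gauss a c : measurable_fun setT (gauss a c).
Proof. exact: rder_measurable (rder_gauss a c). Qed.

Lemma integral_gauss a c : 0 < a ->
  (@leb R).-integrable setT (EFin \o gauss a c) /\
  \int[@leb R]_t gauss a c t = Num.sqrt (pi / a).
Proof.
(* A normal density of standard deviation [s] has exponent [- (t - c)^2 / (2 s^2)], so
   [s^2 = (2 a)^-1] matches [gauss a c]; the total mass then comes from the normal law. *)
move=> a0; pose s := Num.sqrt ((2 * a)^-1).
have s2 : s ^+ 2 = (2 * a)^-1 by rewrite sqr_sqrtr// invr_ge0 mulr_ge0// ltW.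
have s0 : s != 0 by rewrite sqrtr_eq0 -ltNge invr_gt0 mulr_gt0.
have np0 := normal_peak_gt0 s0.
have E t : gauss a c t = (normal_peak s)^-1 * normal_pdf c s t.
  rewrite normal_pdfE// mulrA mulVf ?mul1r ?gt_eqF//.
  rewrite /normal_fun s2 /gauss; congr expR.
  by field; rewrite gt_eqF.
have [mul_imag ei] := leb_integralT (measurable_normal_pdf c s) (integrable_normal_pdf c s).
have iE : (@leb R).-integrable setT (EFin \o gauss a c).
  rewrite /comp; under eq_fun do rewrite E EFinM.
  by apply: integrableZl.
split => //.
transitivity (\int[@leb R]_t ((normal_peak s)^-1 * normal_pdf c s t)).
  by apply: eq_Rintegral => t _; rewrite E.
rewrite RintegralZl// ei /Rintegral (integral_normal_pdf c s) /= mulr1.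
rewrite /normal_peak invrK s2; congr Num.sqrt.
by field; rewrite gt_eqF.
Qed.

(* From [y ^ n <= n! exp y] at [y = a t^2 / 2]. *)
Lemma pow_gauss (k : nat) (a : R) : 0 < a -> exists2 K : R, 0 <= K &
  forall t : R, `|t| ^+ k * expR (- (a * t ^+ 2)) <= K * expR (- (a / 2 * t ^+ 2)).
Proof.
move=> a0; exists (1 + k`!%:R * (2 / a) ^+ k).
  by rewrite addr_ge0// mulr_ge0// exprn_ge0// divr_ge0// ltW.
move=> t; have -> : - (a * t ^+ 2) = - (a / 2 * t ^+ 2) + - (a / 2 * t ^+ 2) by field.
rewrite expRD mulrA ler_wpM2r ?expR_ge0//.
have y0 : 0 <= a / 2 * t ^+ 2 by rewrite mulr_ge0 ?sqr_ge0// divr_ge0// ltW.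
set y := a / 2 * t ^+ 2 in y0 *.
rewrite expRN ler_pdivrMr ?expR_gt0// mulrDl mul1r.
have e1 : 1 <= expR y by rewrite (le_trans _ (expR_ge1Dx y))// lerDl.
(* For [|t| <= 1] the summand 1 of the constant suffices; beyond, [|t|^k <= (t^2)^k], which the
   bound on [y^k] controls. *)
have [t1|t1] := lerP `|t| 1.
  rewrite (@le_trans _ _ 1)// ?exprn_ile1//.
  by rewrite -[X in X <= _]addr0 lerD// !mulr_ge0// ?expR_ge0// exprn_ge0// divr_ge0// ltW.
have h : y ^+ k <= k`!%:R * expR y.
  case: (k) => [|n]; first by rewrite expr0 fact0 mul1r.
  rewrite mulrC -ler_pdivrMr ?ltr0n ?fact_gt0//.
  by rewrite (le_trans _ (expR_ge1Dxn n y0))// lerDr.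
rewrite -[X in X <= _]add0r lerD ?expR_ge0//.
have -> : k`!%:R * (2 / a) ^+ k * expR y = (2 / a) ^+ k * (k`!%:R * expR y) by ring.
apply: (@le_trans _ _ ((2 / a) ^+ k * y ^+ k)); last first.
  by rewrite ler_wpM2l// exprn_ge0// divr_ge0// ltW.
rewrite -exprMn /y (_ : 2 / a * (a / 2 * t ^+ 2) = t ^+ 2); last first.
  by field; rewrite gt_eqF.
rewrite -real_normK ?num_real// exprAC expr2 ler_peMl// ?exprn_ge0//.
by rewrite exprn_ege1// ltW.
Qed.

(** The fundamental theorem on growing intervals, with dominated convergence for the integrals. The
    majorant [g] handles both boundary terms; in all uses it is a multiple of a Gaussian. *)
Lemma integral_der0 f f' g : rder f f' -> continuous f' ->
  (@leb R).-integrable setT (EFin \o f') ->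
  (forall t, `|f t| <= g t) -> g n%:R @[n --> \oo] --> (0 : R) ->
  g (- n%:R) @[n --> \oo] --> (0 : R) ->
  \int[@leb R]_t f' t = 0.
Proof.
move=> df cf' if' fg g1 g2.
have mf' : measurable_fun setT f' by apply: continuous_measurable_fun.
(* The index is [n.+1] because the fundamental theorem asks for a nondegenerate interval. *)
have F n : \int[@leb R]_t (f' \_ `[- n.+1%:R, n.+1%:R]) t = f n.+1%:R - f (- n.+1%:R).
  rewrite -Rintegral_mkcond /Rintegral.
  have icc : (@lebesgue_measure R).-integrable `[- n.+1%:R, n.+1%:R] (EFin \o f').
    apply: continuous_compact_integrable; first exact: segment_compact.
    exact: continuous_subspaceT.
  rewrite (leb_integral (measurable_itv _) mf' icc).2.
  rewrite (@continuous_FTC2 _ f' f)//=.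
  - by rewrite gtrN// ltr0n.
  - exact: continuous_subspaceT.
  - split.
    + by move=> x _; exact: rder_derivable df.
    + by apply: cvg_at_right_filter; exact: rder_continuous df _.
    + by apply: cvg_at_left_filter; exact: rder_continuous df _.
  - by move=> x _; exact: rder_derive1.
have [|//||||_ h1] := @Rint_dominated_ae _ _ R (@leb R) (fun n => f' \_ `[- n.+1%:R, n.+1%:R]) f' (fun t => `|f' t|).
- by move=> n; apply/(measurable_restrictT _ _).1 => //; exact: measurable_funTS.
- apply: aeW => t; apply: cvg_near_cst.
  near=> n; rewrite /= patchE mem_set//= in_itv/= -ler_norml.
  near: n; exists (`|Num.ceil `|t| |)%N => // n /= hn.
  rewrite (le_trans (ceil_ge _))// -(@gez0_abs (Num.ceil _)); last by rewrite ceil_ge0 (lt_le_trans _ (normr_ge0 _))// ltrN10.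
  by rewrite -natz mulrz_nat ler_nat leqW.
- exact: integrable_norm.
- by apply: aeW => t n; rewrite patchE; case: ifP => // _; rewrite normr0.
have h2 : (f n.+1%:R - f (- n.+1%:R)) @[n --> \oo] --> (0 : R).
  rewrite -(subrr 0); apply: cvgB.
    apply/norm_cvg0P; apply: (squeeze_cvgr _ (cvg_cst 0)).
      by apply: nearW => n; rewrite normr_ge0; exact: fg.
    by rewrite (cvg_shiftS (fun n => g n%:R)).
  apply/norm_cvg0P; apply: (squeeze_cvgr _ (cvg_cst 0)).
    by apply: nearW => n; rewrite normr_ge0; exact: fg.
  by rewrite (cvg_shiftS (fun n => g (- n%:R))).
move: h1; under eq_fun do rewrite F; move=> h1.
exact: (cvg_unique _ h1 h2).
Unshelve. all: end_near. Qed.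

End OneDimension.

(** * Fourier transform of the Gaussian on the line *)

Section GaussTransform.
Variable R : realType.

Lemma gauss0N (a t : R) : gauss a 0 (- t) = gauss a 0 t.
Proof. by rewrite /gauss !subr0 sqrrN. Qed.

Lemma cvg_gauss_nat (a : R) : 0 < a -> gauss a 0 n%:R @[n --> \oo] --> (0 : R).
Proof.
move=> a0; have h : (expR (- a)) ^+ n @[n --> \oo] --> (0 : R).
  by apply: cvg_expr; rewrite ger0_norm ?expR_ge0// expR_lt1 oppr_lt0.
apply: (squeeze_cvgr _ (cvg_cst 0) h); apply: nearW => n.
rewrite gauss_ge0/= /gauss subr0 -expRM_natl ler_expR mulrN lerN2 mulrC.
rewrite ler_pM2l// -natrX ler_nat; case: n => // n.
by rewrite expnS expn1 leq_pmulr.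
Qed.

Lemma cvg_gaussN_nat (a : R) : 0 < a -> gauss a 0 (- n%:R) @[n --> \oo] --> (0 : R).
Proof. by move=> a0; under eq_fun do rewrite gauss0N; exact: cvg_gauss_nat. Qed.

Lemma cvg_Z0 (K : R) (f : nat -> R) : f n @[n --> \oo] --> (0 : R) ->
  K * f n @[n --> \oo] --> (0 : R).
Proof. by move=> h; rewrite -(mulr0 K); apply: cvgM => //; exact: cvg_cst. Qed.

Lemma integrable_powgauss (k : nat) (a : R) : 0 < a ->
  (@leb R).-integrable setT (EFin \o (fun t => `|t| ^+ k * gauss a 0 t)).
Proof.
move=> a0; have [K K0 HK] := pow_gauss k a0.
apply: (@rintegrable_le _ _ _ _ _ (fun t => K * gauss (a / 2) 0 t)).
- apply: measurable_funM; last exact: measurable_gauss.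
  by apply: measurable_funX; exact: normr_measurable.
- rewrite /comp; under eq_fun do rewrite EFinM; apply: integrableZl => //.
  by have [] := integral_gauss 0 (divr_gt0 a0 (@ltr0n R 2)).
- move=> t; rewrite ger0_norm ?mulr_ge0 ?gauss_ge0// /gauss !subr0; exact: HK.
Qed.

Section cosine.
Variables (a : R).
Hypothesis a0 : 0 < a.
Let g := gauss a 0.
Let h x := \int[@leb R]_t (cos (x * t) * g t).

Let rder_cosx (t : R) : rder (fun x => cos (x * t) * g t) (fun x => - (t * sin (x * t) * g t)).
Proof.
have d : rder (fun x : R => x * t) (fun=> t).
  by apply: (rder_ext (rderM (@rder_id R) (rder_cst t))) => x; ring.
apply: (rder_ext (rderM (rder_comp (@rder_cos R) d) (rder_cst (g t)))) => x; ring.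
Qed.

Let mcos (x : R) : measurable_fun setT (fun t : R => cos (x * t)).
Proof.
apply: (@measurableT_comp _ _ _ _ _ _ cos) => //.
by apply: continuous_measurable_fun; exact: continuous_cos.
Qed.
Let msin (x : R) : measurable_fun setT (fun t : R => sin (x * t)).
Proof.
apply: (@measurableT_comp _ _ _ _ _ _ sin) => //.
by apply: continuous_measurable_fun; exact: continuous_sin.
Qed.

Let icos x : (@leb R).-integrable setT (EFin \o (fun t => cos (x * t) * g t)).
Proof.
apply: (rintegrable_le (k := g)).
- by apply: measurable_funM => //; exact: measurable_gauss.
- by have [] := integral_gauss 0 a0.
- move=> t; rewrite normrM (ger0_norm (gauss_ge0 _ _ _)) ler_piMl ?gauss_ge0//.
  by rewrite ler_norml cos_geN1 cos_le1.
Qed.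

Let G t := `|t| ^+ 1 * g t.
Let itsin x : (@leb R).-integrable setT (EFin \o (fun t => t * sin (x * t) * g t)).
Proof.
apply: (rintegrable_le (k := G)).
- by apply: measurable_funM; [exact: measurable_funM|exact: measurable_gauss].
- exact: integrable_powgauss.
- move=> t; rewrite /G expr1 !normrM (ger0_norm (gauss_ge0 _ _ _)).
  rewrite ler_wpM2r ?gauss_ge0// ler_piMr//.
  by rewrite ler_norml sin_geN1 sin_le1.
Qed.

Let rder_h : rder h (fun x => - \int[@leb R]_t (t * sin (x * t) * g t)).
Proof.
move=> x.
have xI : `]x - 1, x + 1[%classic x by rewrite /= in_itv/= ltrBlDr ltrDl ltr01.
have D := @derivable_under_integral R _ _ (@leb R) (fun x t => cos (x * t) * g t) setT measurableT x _ _ xI (fun x _ => icos x)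
  (fun x t _ _ => rder_derivable (rder_cosx t)) G.
have E := @differentiation_under_integral R _ _ (@leb R) (fun x t => cos (x * t) * g t) setT measurableT x _ _ xI (fun x _ => icos x)
  (fun x t _ _ => rder_derivable (rder_cosx t)) G.
have G0 t : 0 <= G t by rewrite mulr_ge0 ?gauss_ge0.
have iG : (@leb R).-integrable setT (EFin \o G) by exact: integrable_powgauss.
have Gub (y t : R) : `]x - 1, x + 1[%classic y -> setT t ->
    `|partial1of2 (fun x t => cos (x * t) * g t) y t| <= G t.
  move=> _ _; rewrite /partial1of2 (rder_derive1 (rder_cosx t)) normrN /G expr1.
  rewrite !normrM (ger0_norm (gauss_ge0 _ _ _)).
  rewrite ler_wpM2r ?gauss_ge0// ler_piMr//.
  by rewrite ler_norml sin_geN1 sin_le1.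
have {}D := D G0 iG Gub; have {}E := E G0 iG Gub.
apply: DeriveDef => //; rewrite -derive1E E.
rewrite -mulN1r -RintegralZl//; apply: eq_Rintegral => t _.
by rewrite /partial1of2 (rder_derive1 (rder_cosx t)) mulN1r.
Qed.

(** Integrate the [t]-derivative of [sin (x t) g t]: with [rder_h] this becomes the differential
    equation [h' = - x / (2 a) h]. *)
Let ibp x : \int[@leb R]_t (t * sin (x * t) * g t) = x / (2 * a) * h x.
Proof.
have dx : rder (fun t : R => x * t) (fun=> x).
  by apply: (rder_ext (rderM (rder_cst x) (@rder_id R))) => t; ring.
have d1 : rder (fun t => sin (x * t) * g t)
    (fun t => x * (cos (x * t) * g t) - 2 * a * (t * sin (x * t) * g t)).
  apply: (rder_ext (rderM (rder_comp (@rder_sin R) dx) (rder_gauss a 0))) => t.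
  by rewrite subr0 /g; ring.
have I1 : (@leb R).-integrable setT (EFin \o (fun t => x * (cos (x * t) * g t))).
  by rewrite /comp; under eq_fun do rewrite EFinM; exact: integrableZl (icos x).
have I2 : (@leb R).-integrable setT (EFin \o (fun t => 2 * a * (t * sin (x * t) * g t))).
  by rewrite /comp; under eq_fun do rewrite EFinM; exact: integrableZl (itsin x).
have := integral_der0 d1 _ _ _ (cvg_gauss_nat a0) (cvg_gaussN_nat a0).
have cg : continuous g by exact: rder_continuous (rder_gauss a 0).
have cc : continuous (fun t : R => cos (x * t)).
  exact: rder_continuous (rder_comp (@rder_cos R) dx).
have cs : continuous (fun t : R => sin (x * t)).
  exact: rder_continuous (rder_comp (@rder_sin R) dx).
move=> H; have {H} : \int[@leb R]_t (x * (cos (x * t) * g t) - 2 * a * (t * sin (x * t) * g t)) = 0.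
  apply: H.
  - move=> t; apply: cvgB; apply: cvgM; first exact: cvg_cst.
    + by apply: cvgM; [exact: cc|exact: cg].
    + exact: cvg_cst.
    + apply: cvgM; last exact: cg.
      by apply: cvgM; [exact: cvg_id|exact: cs].
  - rewrite /comp; under eq_fun do rewrite EFinB.
    exact: integrableB.
  - move=> t; rewrite normrM (ger0_norm (gauss_ge0 _ _ _)) ler_piMl ?gauss_ge0//.
    by rewrite ler_norml sin_geN1 sin_le1.
rewrite RintegralB// !RintegralZl//; try exact: icos; try exact: itsin.
rewrite -/(h x) => /eqP; rewrite subr_eq0 => /eqP e.
have -> : x / (2 * a) * h x = (x * h x) / (2 * a) by ring.
by rewrite e; field; rewrite gt_eqF.
Qed.

(** By [ibp], [h x * expR (x^2 / (4 a))] has derivative zero, and its value at 0 is the Gaussian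
    integral. *)
Lemma integral_cos_gauss x :
  \int[@leb R]_t (cos (x * t) * gauss a 0 t) = Num.sqrt (pi / a) * expR (- (x ^+ 2 / (4 * a))).
Proof.
have dq : rder (fun x : R => x ^+ 2 / (4 * a)) (fun x => x / (2 * a)).
  have := rderM (rderM (@rder_id R) (@rder_id R)) (rder_cst (4 * a)^-1).
  move=> /rder_ext; apply => t; field; rewrite gt_eqF//.
have d : rder (fun x => h x * expR (x ^+ 2 / (4 * a))) (fun=> 0).
  apply: (rder_ext (rderM rder_h (rder_comp (@rder_expR R) dq))) => y.
  by rewrite ibp; ring.
have := is_derive_0_is_cst x 0 d.
rewrite expr0n /= mul0r expR0 mulr1.
have -> : h 0 = Num.sqrt (pi / a).
  rewrite -(integral_gauss 0 a0).2; apply: eq_Rintegral => t _.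
  by rewrite mul0r cos0 mul1r.
move=> <-; rewrite -mulrA -expRD subrr expR0 mulr1; exact: erefl.
Qed.

Lemma integral_sin_gauss x : \int[@leb R]_t (sin (x * t) * gauss a 0 t) = 0.
Proof.
have i : (@leb R).-integrable setT (EFin \o (fun t => sin (x * t) * g t)).
  apply: (rintegrable_le (k := g)).
  - by apply: measurable_funM => //; exact: measurable_gauss.
  - by have [] := integral_gauss 0 a0.
  - move=> t; rewrite normrM (ger0_norm (gauss_ge0 _ _ _)) ler_piMl ?gauss_ge0//.
    by rewrite ler_norml sin_geN1 sin_le1.
have := integral_mpres (mpres_opp R) i => /(congr1 fine).
set z := \int[@leb R]_t (sin (x * t) * g t).
move=> e; suff : - z = z by move=> h1; rewrite -[LHS]/z; lra.
rewrite -[RHS]e -mulN1r -RintegralZl//; congr fine; apply: eq_integral => t _ /=.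
by rewrite mulrN sinN mulN1r mulNr /g gauss0N.
Qed.

End cosine.

Lemma cintb_gauss (a c x : R) : 0 < a ->
  cintb (@leb R) (fun t => expi (x * t) * (gauss a c t)%:C).
Proof.
move=> a0; apply: (@cintb_le _ _ _ _ _ (gauss a c)).
- apply: cmeasM; first by apply: cmeas_expi.
  by apply: cmeasR; exact: measurable_gauss.
- by have [] := integral_gauss c a0.
- by move=> t; rewrite cabsM cabs_expi mul1r cabsR ger0_norm ?gauss_ge0.
Qed.

Lemma fourier_gauss (a c x : R) : 0 < a ->
  cint (@leb R) (fun t => expi (x * t) * (gauss a c t)%:C) =
  expi (x * c) * (Num.sqrt (pi / a) * expR (- (x ^+ 2 / (4 * a))))%:C.
Proof.
move=> a0.
have E0 : cint (@leb R) (fun t => expi (x * t) * (gauss a 0 t)%:C) =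
    (Num.sqrt (pi / a) * expR (- (x ^+ 2 / (4 * a))))%:C.
  apply: cext => /=.
    rewrite -integral_cos_gauss//; apply: eq_Rintegral => t _ /=.
    by rewrite mulr0 subr0.
  apply: etrans (integral_sin_gauss a0 x); apply: eq_Rintegral => t _.
  by rewrite /= mulr0 add0r.
rewrite -(cint_mpres (mpres_translation c))/=; last exact: cintb_gauss.
rewrite -E0 -cintZ; last exact: cintb_gauss.
congr cint; apply/funext => t.
by rewrite mulrA -expiD /gauss subr0 addrK mulrDr addrC.
Qed.

End GaussTransform.

(** * Jets of smooth functions *)

Section ComplexDerivative.
Variable R : realType.
Implicit Types (A B : R -> R[i]).

Definition cder A A' := rder (fun t => Re (A t)) (fun t => Re (A' t)) /\
  rder (fun t => Im (A t)) (fun t => Im (A' t)).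

Lemma cder_ext A A' B' : cder A A' -> A' =1 B' -> cder A B'.
Proof. by move=> dA /funext <-. Qed.
Lemma cderM A A' B B' : cder A A' -> cder B B' ->
  cder (fun t => A t * B t) (fun t => A' t * B t + A t * B' t).
Proof.
move=> [d1 d2] [d3 d4]; split.
  under eq_fun do rewrite ReM.
  apply: (rder_ext (rderD (rderM d1 d3) (rderN (rderM d2 d4)))) => t.
  by rewrite ReD !ReM; ring.
under eq_fun do rewrite ImM.
apply: (rder_ext (rderD (rderM d1 d4) (rderM d2 d3))) => t.
by rewrite ImD !ImM; ring.
Qed.
Lemma cderD A A' B B' : cder A A' -> cder B B' ->
  cder (fun t => A t + B t) (fun t => A' t + B' t).
Proof.
move=> [d1 d2] [d3 d4]; split.
  under eq_fun do rewrite ReD.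
  by apply: (rder_ext (rderD d1 d3)) => t; rewrite ReD.
under eq_fun do rewrite ImD.
by apply: (rder_ext (rderD d2 d4)) => t; rewrite ImD.
Qed.
Lemma cder_cst (c : R[i]) : cder (fun=> c) (fun=> 0).
Proof. by split; exact: rder_cst. Qed.
Lemma cderZ (c : R[i]) A A' : cder A A' -> cder (fun t => c * A t) (fun t => c * A' t).
Proof.
by move=> dA; apply: (cder_ext (cderM (cder_cst c) dA)) => t; rewrite mul0r add0r.
Qed.
Lemma cderR (f f' : R -> R) : rder f f' -> cder (fun t => (f t)%:C) (fun t => (f' t)%:C).
Proof. by move=> df; split => //=; exact: rder_cst. Qed.
Lemma cder_comp A A' (f f' : R -> R) : cder A A' -> rder f f' ->
  cder (fun t => A (f t)) (fun t => (f' t)%:C * A' (f t)).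
Proof.
move=> [d1 d2] df; split.
  by apply: (rder_ext (rder_comp d1 df)) => t; rewrite ReM /=; ring.
by apply: (rder_ext (rder_comp d2 df)) => t; rewrite ImM /=; ring.
Qed.
Lemma cder_expi : cder (@expi R) (fun t => 'i * expi t).
Proof.
split => /=.
  by apply: (rder_ext (@rder_cos R)) => t; ring.
by apply: (rder_ext (@rder_sin R)) => t; ring.
Qed.
Lemma cder_cmeas A A' : cder A A' -> cmeas A.
Proof. by move=> [/rder_measurable ? /rder_measurable ?]. Qed.

(* Integration by parts: [expi (x t) A t] vanishes at infinity. *)
Lemma fourier_der (b x : R) A A' A'' (K : R) : 0 < b ->
  cder A A' -> cder A' A'' ->
  (forall t, cabs (A t) <= K * gauss b 0 t) ->
  (forall t, cabs (A' t) <= K * gauss b 0 t) ->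
  cint (@leb R) (fun t => expi (x * t) * A' t) =
  - ('i * x%:C) * cint (@leb R) (fun t => expi (x * t) * A t).
Proof.
move=> b0 dA dA' bA bA'.
have ig : (@leb R).-integrable setT (EFin \o (fun t => K * gauss b 0 t)).
  rewrite /comp; under eq_fun do rewrite EFinM; apply: integrableZl => //.
  by have [] := integral_gauss 0 b0.
have dx : rder (fun t : R => x * t) (fun=> x).
  by apply: (rder_ext (rderM (rder_cst x) (@rder_id R))) => t; ring.
have dE := cder_comp cder_expi dx.
have mE : cmeas (fun t : R => expi (x * t)) by apply: cmeas_expi.
have int B : cmeas B -> (forall t, cabs (B t) <= K * gauss b 0 t) ->
    cintb (@leb R) (fun t => expi (x * t) * B t).
  move=> mB bB; apply: (cintb_le _ ig); first exact: cmeasM.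
  by move=> t; rewrite cabsM cabs_expi mul1r.
have i1 := int _ (cder_cmeas dA) bA; have i2 := int _ (cder_cmeas dA') bA'.
have d := cderM dE dA.
(* [A''] enters through the continuity of the integrand [H] below, which [integral_der0] asks
   for. *)
have d2 := cderD (cderM (cderZ x%:C (cderZ 'i dE)) dA) (cderM dE dA').
pose H t := x%:C * ('i * expi (x * t)) * A t + expi (x * t) * A' t.
rewrite -/H in d d2.
have iH : cintb (@leb R) H.
  rewrite /H; apply: cintbD => //.
  have -> : (fun t => x%:C * ('i * expi (x * t)) * A t) =
    (fun t => ('i * x%:C) * (expi (x * t) * A t)).
    by apply/funext => t; move: ('i) (x%:C) => j y; ring.
  exact: cintbZ.
suff : cint (@leb R) H = 0.
  have -> : H = (fun t => ('i * x%:C) * (expi (x * t) * A t) + expi (x * t) * A' t).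
    by apply/funext => t; rewrite /H; move: ('i) (x%:C) => j y; ring.
  rewrite cintD//; last exact: cintbZ.
  rewrite cintZ// => /eqP; rewrite addrC addr_eq0 => /eqP ->.
  by rewrite mulNr.
have z1 := cvg_Z0 K (cvg_gauss_nat b0); have z2 := cvg_Z0 K (cvg_gaussN_nat b0).
apply: cext => /=.
  apply: (integral_der0 (g := fun t => K * gauss b 0 t) d.1 (rder_continuous d2.1) iH.1 _ z1 z2) => t.
  by rewrite (le_trans (cabs_Re _))// cabsM cabs_expi mul1r bA.
apply: (integral_der0 (g := fun t => K * gauss b 0 t) d.2 (rder_continuous d2.2) iH.2 _ z1 z2) => t.
by rewrite (le_trans (cabs_Im _))// cabsM cabs_expi mul1r bA.
Qed.

(* The successive derivatives of a smooth function are carried along explicitly: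
   this makes iterated partial derivatives of tensor products computable. *)
Definition jet (J : nat -> R -> R[i]) := forall n, cder (J n) (J n.+1).

(** Leibniz' rule kept as a recursion [(J K)' = J' K + J K']: there are [2^n] terms instead of
    binomial coefficients, and bounds, zeros and limits all follow by induction on [n]. *)
Fixpoint jmul n (J K : nat -> R -> R[i]) : R -> R[i] :=
  if n is m.+1 then fun t => jmul m (fun k => J k.+1) K t + jmul m J (fun k => K k.+1) t
  else fun t => J 0 t * K 0 t.

Lemma jet_mul J K : jet J -> jet K -> jet (fun n => jmul n J K).
Proof.
move=> jJ jK n; elim: n J K jJ jK => [|n IH] J K jJ jK /=.
  exact: cderM.
by apply: cderD; apply: IH => // k; first [exact: jJ | exact: jK].
Qed.

Definition jbound (J : nat -> R -> R[i]) (u : R -> R) :=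
  forall n, exists2 C : R, 0 <= C & forall t, cabs (J n t) <= C * u t.

(** The family index [I] makes the constant uniform: besides single jets, this serves for the
    cutoffs dilated by a varying [N]. *)
Lemma jmul_bound (I : Type) n (J : I -> nat -> R -> R[i]) (K : nat -> R -> R[i]) u v :
  (forall t, 0 <= u t) -> (forall t, 0 <= v t) ->
  (forall k, exists2 C : R, 0 <= C & forall i t, cabs (J i k t) <= C * u t) ->
  jbound K v -> exists2 C : R, 0 <= C & forall i t, cabs (jmul n (J i) K t) <= C * (u t * v t).
Proof.
move=> u0 v0; elim: n J K => [|n IH] J K bJ bK /=.
  have [C C0 HC] := bJ 0%N; have [D D0 HD] := bK 0%N.
  exists (C * D); first exact: mulr_ge0.
  by move=> i t; rewrite cabsM mulrACA ler_pM ?cabs_ge0.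
have [|//|C C0 HC] := IH (fun i k => J i k.+1) K; first by move=> k; exact: bJ.
have [//||D D0 HD] := IH J (fun k => K k.+1); first by move=> k; exact: bK.
exists (C + D); first exact: addr_ge0.
by move=> i t; rewrite mulrDl; apply: (le_trans (cabsD _ _)); exact: lerD.
Qed.

Lemma jbound_mul J K u v : (forall t, 0 <= u t) -> (forall t, 0 <= v t) ->
  jbound J u -> jbound K v -> jbound (fun n => jmul n J K) (fun t => u t * v t).
Proof.
move=> u0 v0 bJ bK n.
have [k|C C0 HC] := @jmul_bound unit n (fun=> J) K u v u0 v0 _ bK.
  by have [C C0 HC] := bJ k; exists C.
by exists C => // t; exact: (HC tt).
Qed.

Definition mod_jet (s : R) n (t : R) : R[i] := ('i * s%:C) ^+ n * expi (s * t).

Lemma jet_mod s : jet (mod_jet s).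
Proof.
move=> n; have dx : rder (fun t : R => s * t) (fun=> s).
  by apply: (rder_ext (rderM (rder_cst s) (@rder_id R))) => t; ring.
apply: (cder_ext (cderZ _ (cder_comp cder_expi dx))) => t.
by rewrite /mod_jet exprSr; ring.
Qed.

Lemma jbound_mod s : jbound (mod_jet s) (fun=> 1).
Proof.
move=> n; exists (cabs (('i * s%:C) ^+ n)); first exact: cabs_ge0.
by move=> t; rewrite cabsM cabs_expi.
Qed.

(** Hermite polynomials up to sign and scaling: for [w t = exp (- a t^2)] one has
    [(p w)' = (p' - 2 a X p) w]. *)
Fixpoint gauss_poly (a : R) n : {poly R} :=
  if n is m.+1 then deriv (gauss_poly a m) - (2 * a) *: 'X * gauss_poly a m else 1.

Definition gauss_jet (a c : R) n (t : R) : R[i] :=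
  ((gauss_poly a n).[t - c] * gauss a c t)%:C.

Lemma gauss_jet0 a c t : gauss_jet a c 0 t = (gauss a c t)%:C.
Proof. by rewrite /gauss_jet /= hornerC mul1r. Qed.

Lemma jet_gauss a c : jet (gauss_jet a c).
Proof.
move=> n; apply: cderR.
have dx : rder (fun t : R => t - c) (fun=> 1).
  by apply: (rder_ext (rderD (@rder_id R) (rder_cst (- c)))) => t; rewrite addr0.
apply: (rder_ext (rderM (rder_comp (rder_poly (gauss_poly a n)) dx) (rder_gauss a c))) => t.
by rewrite /= hornerD hornerN hornerM hornerZ hornerX; ring.
Qed.

Lemma poly_gauss (p : {poly R}) (a : R) : 0 < a -> exists2 K : R, 0 <= K &
  forall t : R, `|p.[t]| * expR (- (a * t ^+ 2)) <= K * expR (- (a / 2 * t ^+ 2)).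
Proof.
move=> a0.
have /choice[K HK] : forall k : nat, exists K : R, 0 <= K /\
    forall t : R, `|t| ^+ k * expR (- (a * t ^+ 2)) <= K * expR (- (a / 2 * t ^+ 2)).
  by move=> k; have [K K0 HK] := pow_gauss k a0; exists K.
exists (\sum_(i < size p) `|p`_i| * K i).
  by apply: sumr_ge0 => i _; apply: mulr_ge0 => //; have [] := HK i.
move=> t; rewrite horner_coef.
apply: (@le_trans _ _ (\sum_(i < size p) `|p`_i| * (`|t| ^+ i * expR (- (a * t ^+ 2))))).
  apply: (@le_trans _ _ ((\sum_(i < size p) `|p`_i * t ^+ i|) * expR (- (a * t ^+ 2)))).
    by rewrite ler_wpM2r ?expR_ge0// ler_norm_sum.
  rewrite mulr_suml ler_sum// => i _.
  by rewrite normrM normrX mulrA.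
rewrite mulr_suml ler_sum// => i _; rewrite -[leRHS]mulrA ler_wpM2l//.
by have [_] := HK i; exact.
Qed.

Lemma jbound_gauss a c : 0 < a -> jbound (gauss_jet a c) (gauss (a / 2) c).
Proof.
move=> a0 n; have [K K0 HK] := poly_gauss (gauss_poly a n) a0.
exists K => // t; rewrite cabsR normrM (ger0_norm (gauss_ge0 _ _ _)).
exact: HK.
Qed.

(** The difference of the exponents is the square [a / 2 (t - 2 c)^2]. Half of the decay is given up
    to forget the centre. *)
Lemma gauss_recenter (a c t : R) : 0 < a ->
  gauss a c t <= expR (a * c ^+ 2) * gauss (a / 2) 0 t.
Proof.
move=> a0; rewrite /gauss -expRD ler_expR subr0.
have : 0 <= a / 2 * (t - 2 * c) ^+ 2 by rewrite mulr_ge0 ?sqr_ge0// divr_ge0// ltW.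
by set z := _ * _ => z0; rewrite -subr_ge0 (_ : _ - _ = z)// /z; field.
Qed.

Definition aff_jet (J : nat -> R -> R[i]) (p q : R) n (t : R) : R[i] :=
  (p ^+ n)%:C * J n (p * t + q).

Lemma jet_aff J p q : jet J -> jet (aff_jet J p q).
Proof.
move=> jJ n; apply: (cder_ext (cderZ _ (cder_comp (jJ n) (rder_aff p q)))) => t.
by rewrite /aff_jet exprSr rmorphM /=; ring.
Qed.

(** The derivatives of [exp (- 1/t)]: if [f t = p(1/t) exp (- 1/t)], then
    [f' t = q(1/t) exp (- 1/t)] with [q = X^2 (p - p')]. *)
Fixpoint bump_poly n : {poly R} :=
  if n is m.+1 then 'X^2 * (bump_poly m - deriv (bump_poly m)) else 1.

Definition bump n (t : R) : R :=
  if 0 < t then (bump_poly n).[t^-1] * expR (- t^-1) else 0.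

(** Read at [s = 1/t]: with [k = 2] it makes [bump n] of order [t^2] at 0, hence differentiable
    there, and with [k = 0] it bounds [bump n]. *)
Lemma poly_exp (p : {poly R}) (k : nat) : exists2 K : R, 0 <= K &
  forall s, 0 <= s -> `|p.[s]| * expR (- s) * s ^+ k <= K.
Proof.
have pw (n : nat) (s : R) : 0 <= s -> s ^+ n * expR (- s) <= n`!%:R.
  move=> s0; rewrite expRN ler_pdivrMr ?expR_gt0//.
  case: n => [|n]; first by rewrite expr0 fact0 mul1r (le_trans _ (expR_ge1Dx s))// lerDl.
  rewrite mulrC -ler_pdivrMr ?ltr0n ?fact_gt0//.
  by rewrite (le_trans _ (expR_ge1Dxn n s0))// lerDr.
exists (\sum_(i < size p) `|p`_i| * (i + k)`!%:R).
  by apply: sumr_ge0 => i _; apply: mulr_ge0.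
move=> s s0; rewrite horner_coef.
apply: (@le_trans _ _ ((\sum_(i < size p) `|p`_i * s ^+ i|) * (expR (- s) * s ^+ k))).
  rewrite mulrA ler_wpM2r ?exprn_ge0// ler_wpM2r ?expR_ge0//.
  exact: ler_norm_sum.
rewrite mulr_suml ler_sum// => i _; rewrite normrM normrX (ger0_norm s0).
rewrite -mulrA ler_wpM2l// (_ : _ * _ = s ^+ (i + k) * expR (- s)); first exact: pw.
by rewrite exprD; ring.
Qed.

Lemma is_derive0_sqr (f : R -> R) (C : R) : f 0 = 0 -> (forall h, `|f h| <= C * h ^+ 2) ->
  is_derive (0 : R) (1 : R) f 0.
Proof.
move=> f0 Hf.
have lim0 : h^-1 *: (f (h *: (1 : R) + 0) - f 0) @[h --> (0 : R)^'] --> (0 : R).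
  have : C * `|h| @[h --> (0 : R)^'] --> C * `|0 : R|.
    apply: cvgM; first exact: cvg_cst.
    apply: cvg_within_filter; exact: norm_continuous.
  rewrite normr0 mulr0 => h0.
  apply/norm_cvg0P; apply: (squeeze_cvgr _ (cvg_cst 0) h0).
  near=> h; have hn : h != 0 by near: h; exact: nbhs_dnbhs_neq.
  rewrite normr_ge0 /= f0 subr0 addr0 normrM normfV.
  rewrite ler_pdivrMl ?normr_gt0// (le_trans (Hf _))// /GRing.scale /= mulr1.
  by rewrite -real_normK ?num_real// expr2 mulrCA.
apply: DeriveDef; first by apply/cvg_ex; exists 0.
exact: cvg_lim lim0.
Unshelve. all: end_near. Qed.

Lemma rder_bump n : rder (bump n) (bump n.+1).
Proof.
move=> t; have [t0|t0|->] := ltgtP t 0.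
- have -> : bump n.+1 t = 0 by rewrite /bump ltNge (ltW t0).
  apply: (near_eq_is_derive (f := cst 0)).
    near=> u; rewrite /bump ltNge ltW//.
    by near: u; exact: lt_nbhsl.
- have -> : bump n.+1 t = (bump_poly n.+1).[t^-1] * expR (- t^-1) by rewrite /bump t0.
  pose f0 (u : R) : R := (bump_poly n).[u^-1] * expR (- u^-1).
  apply: (near_eq_is_derive (f := f0)).
    near=> u; rewrite /bump ifT//.
    by near: u; exact: lt_nbhsr.
  have dv : is_derive t (1 : R) (fun u : R => u^-1) (- t ^- 2).
    have := @is_deriveV R id t 1 1 (lt0r_neq0 t0) _; rewrite /GRing.scale /= mulr1.
    by apply; exact: is_derive_id.
  have d1 : is_derive t (1 : R) (fun u => (bump_poly n).[u^-1])
      ((deriv (bump_poly n)).[t^-1] * (- t ^- 2)) by exact: is_derive1_comp.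
  have dn : is_derive t (1 : R) (fun u : R => - u^-1) (t ^- 2).
    by rewrite -[t ^- 2]opprK; exact: is_deriveN.
  have d2 : is_derive t (1 : R) (fun u : R => expR (- u^-1)) (expR (- t^-1) * t ^- 2).
    exact: is_derive1_comp.
  apply: (is_derive_eq (is_deriveM d1 d2)).
  have -> : bump_poly n.+1 = 'X^2 * (bump_poly n - deriv (bump_poly n)) by [].
  rewrite hornerM hornerXn hornerD hornerN exprVn /GRing.scale /=.
  by ring.
have -> : bump n.+1 0 = 0 by rewrite /bump ltxx.
have [K K0 HK] := poly_exp (bump_poly n) 2.
apply: (@is_derive0_sqr _ K); first by rewrite /bump ltxx.
move=> h; rewrite /bump; case: ifPn => [h0|_]; last by rewrite normr0 mulr_ge0// sqr_ge0.
have hi : 0 <= h^-1 by rewrite invr_ge0 ltW.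
have := HK _ hi; rewrite normrM (ger0_norm (expR_ge0 _)) exprVn.
by rewrite ler_pdivrMr ?exprn_gt0.
Unshelve. all: end_near. Qed.

Definition bump_jet n (t : R) : R[i] := (bump n t)%:C.

Lemma jet_bump : jet bump_jet.
Proof. by move=> n; apply: cderR; exact: rder_bump. Qed.

Lemma bump_bounded n : exists2 K : R, 0 <= K &
  forall t, cabs (bump_jet n t) <= K * \1_(`]0, +oo[%classic) t.
Proof.
have [K K0 HK] := poly_exp (bump_poly n) 0.
exists K => // t; rewrite cabsR /bump indicE; case: ifPn => [t0|t0].
  rewrite mem_set /= ?in_itv/= ?t0// mulr1.
  have hi : 0 <= t^-1 by rewrite invr_ge0 ltW.
  by have := HK _ hi; rewrite normrM (ger0_norm (expR_ge0 _)) expr0 mulr1.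
by rewrite normr0 memNset ?mulr0//= in_itv/= andbT; exact/negP.
Qed.

(** At order 0 this is [exp (2 - 2 / (1 - t^2))] on []-1, 1[] and 0 elsewhere, since
    [1/(1+t) + 1/(1-t) = 2/(1-t^2)]; the factor [expR 2] gives the value 1 at 0. *)
Definition cutoff_jet n (t : R) : R[i] :=
  (expR 2)%:C * jmul n (aff_jet bump_jet 1 1) (aff_jet bump_jet (-1) 1) t.

Lemma jet_cutoff : jet cutoff_jet.
Proof.
by move=> n; apply: cderZ; apply: jet_mul; apply: jet_aff; exact: jet_bump.
Qed.

Lemma cutoff0 : cutoff_jet 0 0 = 1.
Proof.
rewrite /cutoff_jet /= /aff_jet !expr0 !mulr0 !add0r !mul1r /bump_jet /bump ltr01.
rewrite /= hornerC mul1r invr1 -!rmorphM /= -!expRD.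
by have -> : (2 + (-1 - 1) : R) = 0; [ring|rewrite expR0].
Qed.

(** Indicators carry the supports through the product bound: the half-lines [t > -1] and [t < 1] of
    the two factors meet in []-1, 1[]. *)
Lemma cutoff_bounded n : exists2 K : R, 0 <= K &
  forall t, cabs (cutoff_jet n t) <= K * \1_(`]-1, 1[%classic) t.
Proof.
have b1 : jbound (aff_jet bump_jet 1 1) (\1_(`]-1, +oo[%classic)).
  move=> m; have [K K0 HK] := bump_bounded m; exists K => // t.
  rewrite /aff_jet cabsM expr1n cabsR normr1 mul1r mul1r (le_trans (HK _))//.
  rewrite ler_wpM2l// !indicE ler_nat.
  suff -> : (t + 1 \in `]0, +oo[%classic) = (t \in `]-1, +oo[%classic) by [].
  by rewrite !mem_setE !in_itv/= !andbT -ltrBlDr sub0r.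
have b2 : jbound (aff_jet bump_jet (-1) 1) (\1_(`]-oo, 1[%classic)).
  move=> m; have [K K0 HK] := bump_bounded m; exists K => // t.
  rewrite /aff_jet cabsM cabsR normrX normrN normr1 expr1n mul1r mulN1r (le_trans (HK _))//.
  rewrite ler_wpM2l// !indicE ler_nat.
  suff -> : (- t + 1 \in `]0, +oo[%classic) = (t \in `]-oo, 1[%classic) by [].
  by rewrite !mem_setE !in_itv/= !andbT addrC subr_gt0.
have ind0 (D : set R) (t : R) : 0 <= \1_D t :> R by rewrite indicE.
have [C C0 HC] := jbound_mul (ind0 _) (ind0 _) b1 b2 n.
exists (expR 2 * C); first by rewrite mulr_ge0// expR_ge0.
move=> t; rewrite cabsM cabsR (ger0_norm (expR_ge0 _)) -mulrA ler_wpM2l ?expR_ge0//.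
rewrite (le_trans (HC t))// ler_wpM2l// !indicE -natrM mulnb.
suff -> : (t \in `]-1, +oo[%classic) && (t \in `]-oo, 1[%classic) = (t \in `]-1, 1[%classic) by [].
by rewrite !mem_setE !in_itv/= andbT.
Qed.

End ComplexDerivative.

(** * Tensor products as test functions *)

Section Coordinates.
Variable R : realType.
Implicit Types (x y z : R3 R) (i j : 'I_3).

Lemma ord3P (P : 'I_3 -> Prop) :
  P ord0 -> P (lift ord0 ord0) -> P (lift ord0 (lift ord0 ord0)) -> forall i, P i.
Proof.
move=> p0 p1 p2 [[|[|[|//]]] Hi].
- by rewrite (_ : Ordinal Hi = ord0)//; apply: val_inj.
- by rewrite (_ : Ordinal Hi = lift ord0 ord0)//; apply: val_inj.
- by rewrite (_ : Ordinal Hi = lift ord0 (lift ord0 ord0))//; apply: val_inj.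
Qed.

Lemma measurable_coord i : measurable_fun setT (fun x : R3 R => coord x i).
Proof.
have m1 : measurable_fun setT (fun x : R3 R => x.1.1).
  exact: (measurableT_comp measurable_fst measurable_fst).
have m2 : measurable_fun setT (fun x : R3 R => x.1.2).
  exact: (measurableT_comp measurable_snd measurable_fst).
have m3 : measurable_fun setT (fun x : R3 R => x.2) by exact: measurable_snd.
by move: i; apply: ord3P.
Qed.

Lemma coord_add3 x y i : coord (add3 x y) i = coord x i + coord y i.
Proof. by move: i; apply: ord3P. Qed.
Lemma coord_opp3 x i : coord (opp3 x) i = - coord x i.
Proof. by move: i; apply: ord3P. Qed.
Lemma coord_ext x y : (forall i, coord x i = coord y i) -> x = y.
Proof.
case: x y => [[a b] c] [[a' b'] c'] e.
by congr (_, _, _); [exact: (e ord0)|exact: (e (lift ord0 ord0))|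
  exact: (e (lift ord0 (lift ord0 ord0)))].
Qed.

Lemma dotDl x y z : dot (add3 x y) z = dot x z + dot y z.
Proof. by rewrite /dot -big_split; apply: eq_bigr => i _; rewrite coord_add3 mulrDl. Qed.
Lemma dotC x y : dot x y = dot y x.
Proof. by rewrite /dot; apply: eq_bigr => i _; rewrite mulrC. Qed.
Lemma dotDr x y z : dot z (add3 x y) = dot z x + dot z y.
Proof. by rewrite dotC dotDl !(dotC z). Qed.
Lemma dotNl x y : dot (opp3 x) y = - dot x y.
Proof. by rewrite /dot -sumrN; apply: eq_bigr => i _; rewrite coord_opp3 mulNr. Qed.
Lemma dotNr x y : dot x (opp3 y) = - dot x y.
Proof. by rewrite dotC dotNl dotC. Qed.

Lemma dot_ge0 x : 0 <= dot x x.
Proof. by apply: sumr_ge0 => i _; rewrite -expr2 sqr_ge0. Qed.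
Lemma enorm_ge0 x : 0 <= enorm x. Proof. exact: sqrtr_ge0. Qed.
Lemma enorm2 x : enorm x ^+ 2 = dot x x.
Proof. by rewrite sqr_sqrtr// dot_ge0. Qed.
Lemma enorm2E x : enorm x ^+ 2 = \sum_(i < 3) coord x i ^+ 2.
Proof. by rewrite enorm2; apply: eq_bigr => i _; rewrite expr2. Qed.
Lemma coord_enorm x i : `|coord x i| <= enorm x.
Proof.
rewrite -(@ler_pXn2r _ 2)// ?nnegrE ?enorm_ge0// enorm2E real_normK ?num_real//.
by rewrite (bigD1 i)//= lerDl sumr_ge0// => j _; rewrite sqr_ge0.
Qed.
Lemma enorm_le x : enorm x <= \sum_(i < 3) `|coord x i|.
Proof.
rewrite -(@ler_pXn2r _ 2)// ?nnegrE ?enorm_ge0 ?sumr_ge0// enorm2E.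
rewrite !big_ord_recl !big_ord0 -!(real_normK (num_real (coord _ _))).
have h (a b c : R) : 0 <= a -> 0 <= b -> 0 <= c ->
    a ^+ 2 + (b ^+ 2 + (c ^+ 2 + 0)) <= (a + (b + (c + 0))) ^+ 2.
  move=> a0 b0 c0; rewrite !addr0.
  rewrite (_ : (a + (b + c)) ^+ 2 = a ^+ 2 + (b ^+ 2 + c ^+ 2) + 2 * (a * b + a * c + b * c)); last by ring.
  by rewrite lerDl mulr_ge0// !addr_ge0// mulr_ge0.
exact: h.
Qed.
Lemma measurable_dot x : measurable_fun setT (fun y => dot x y).
Proof.
by apply: measurable_sum => i; apply: measurable_funM => //; exact: measurable_coord.
Qed.
Lemma measurable_enorm : measurable_fun setT (fun x : R3 R => enorm x).
Proof.
have ms : measurable_fun setT (@Num.sqrt R).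
  by apply: continuous_measurable_fun; exact: sqrt_continuous.
apply: (measurableT_comp ms); apply: measurable_sum => i.
by apply: measurable_funM; exact: measurable_coord.
Qed.

Lemma expi_sum (I : Type) (s : seq I) (F : I -> R) :
  expi (\sum_(i <- s) F i) = \prod_(i <- s) expi (F i).
Proof.
elim: s => [|i s IH]; first by rewrite !big_nil expi0.
by rewrite !big_cons expiD IH.
Qed.

Lemma expi_dot x y : expi (dot x y) = \prod_(i < 3) expi (coord x i * coord y i).
Proof. exact: expi_sum. Qed.

Definition prod3 (F : 'I_3 -> R -> R[i]) x : R[i] := \prod_(i < 3) F i (coord x i).

Lemma prod3E F x : prod3 F x = F ord0 x.1.1 * F (lift ord0 ord0) x.1.2 *
  F (lift ord0 (lift ord0 ord0)) x.2.
Proof. by rewrite /prod3 !big_ord_recl big_ord0 mulr1 mulrA. Qed.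

Lemma prod3M F G x : prod3 (fun i t => F i t * G i t) x = prod3 F x * prod3 G x.
Proof. exact: big_split. Qed.

Lemma cintb_prod3 F : (forall i, cintb (@leb R) (F i)) -> cintb (leb3s R) (prod3 F).
Proof.
move=> iF; rewrite (funext (prod3E F)).
have i2 := @cintb_tensor _ _ _ _ _ (@leb R) (@leb R) _ _ (iF ord0) (iF (lift ord0 ord0)).
exact: (@cintb_tensor _ _ _ _ _ (leb2s R) (@leb R) _ _ i2 (iF _)).
Qed.

Lemma cint_prod3 F : (forall i, cintb (@leb R) (F i)) ->
  cint (leb3s R) (prod3 F) = \prod_(i < 3) cint (@leb R) (F i).
Proof.
move=> iF; rewrite (funext (prod3E F)).
have i2 := @cintb_tensor _ _ _ _ _ (@leb R) (@leb R) _ _ (iF ord0) (iF (lift ord0 ord0)).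
have e2 := @cint_tensor _ _ _ _ _ (@leb R) (@leb R) _ _ (iF ord0) (iF (lift ord0 ord0)).
rewrite !big_ord_recl big_ord0 mulr1 mulrA -e2.
exact: (@cint_tensor _ _ _ _ _ (leb2s R) (@leb R) _ _ i2 (iF _)).
Qed.

Lemma cmeas_prod3 F : (forall i, cmeas (F i)) -> cmeas (prod3 F).
Proof.
move=> mF; rewrite (funext (prod3E F)).
have m i := cmeas_comp (mF i) (measurable_coord i).
by apply: cmeasM (m (lift ord0 (lift ord0 ord0))); apply: cmeasM (m ord0) (m (lift ord0 ord0)).
Qed.

End Coordinates.

Section Tensor.
Variable R : realType.
Implicit Types (J : 'I_3 -> nat -> R -> R[i]) (m : 'I_3 -> nat) (x : R3 R).

(** When the [J i] are jets, this is the partial derivative of multi-index [m] of the tensor product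
    of the [J i 0]: differentiating only shifts [m]. *)
Definition tens J m x : R[i] := prod3 (fun i => J i (m i)) x.

Lemma coord_shift j (h : R) x i :
  coord (h *: evec R j + x) i = h * (i == j)%:R + coord x i.
Proof.
by move: i j; apply: ord3P; apply: ord3P; rewrite /coord /evec /=.
Qed.

Lemma differentiable_fst (U V : normedModType R) (z : U * V) :
  differentiable (fun w : U * V => w.1) z.
Proof. exact: (@linear_differentiable R _ _ fst z (fun w => cvg_fst)). Qed.

Lemma differentiable_snd (U V : normedModType R) (z : U * V) :
  differentiable (fun w : U * V => w.2) z.
Proof. exact: (@linear_differentiable R _ _ snd z (fun w => cvg_snd)). Qed.

Lemma diff_coord i x : differentiable (fun y : R3 R => coord y i) x.
Proof.
have d1 : differentiable (fun w : R3 R => w.1) x by exact: differentiable_fst.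
have d11 : differentiable (fun w : R3 R => w.1.1) x.
  by apply: (@differentiable_comp _ _ _ _ (fun w : R3 R => w.1) (fun w => w.1)) => //; exact: differentiable_fst.
have d12 : differentiable (fun w : R3 R => w.1.2) x.
  by apply: (@differentiable_comp _ _ _ _ (fun w : R3 R => w.1) (fun w => w.2)) => //; exact: differentiable_snd.
have d2 : differentiable (fun w : R3 R => w.2) x by exact: differentiable_snd.
by move: i; apply: ord3P.
Qed.

Definition cdiff (f : R3 R -> R[i]) x :=
  differentiable (re_fun f) x /\ differentiable (im_fun f) x.

Lemma cdiffM f g x : cdiff f x -> cdiff g x -> cdiff (fun y => f y * g y) x.
Proof.
move=> [d1 d2] [d3 d4]; split.
  have -> : re_fun (fun y => f y * g y) = re_fun f * re_fun g - im_fun f * im_fun g.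
    by apply/funext => y; rewrite /re_fun /im_fun ReM.
  by apply: differentiableB; apply: differentiableM.
have -> : im_fun (fun y => f y * g y) = re_fun f * im_fun g + im_fun f * re_fun g.
  by apply/funext => y; rewrite /re_fun /im_fun ImM.
by apply: differentiableD; apply: differentiableM.
Qed.


Lemma cdiff_coord A A' i x : cder A A' -> cdiff (fun y => A (coord y i)) x.
Proof.
move=> [d1 d2]; split.
  apply: (@differentiable_comp _ _ _ _ (fun y => coord y i) (fun t => Re (A t))).
    exact: diff_coord.
  by apply/derivable1_diffP; exact: rder_derivable d1.
apply: (@differentiable_comp _ _ _ _ (fun y => coord y i) (fun t => Im (A t))).
  exact: diff_coord.
by apply/derivable1_diffP; exact: rder_derivable d2.
Qed.

Lemma cdiff_tens J m x : (forall i, jet (J i)) -> cdiff (tens J m) x.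
Proof.
move=> jJ; rewrite /tens (funext (prod3E _)).
have d i := cdiff_coord i x (jJ i (m i)).
by apply: cdiffM (d (lift ord0 (lift ord0 ord0))); apply: cdiffM (d ord0) (d (lift ord0 ord0)).
Qed.

Lemma partial_tens J m j : (forall i, jet (J i)) ->
  partial j (tens J m) = tens J (fun i => ((i == j) + m i)%N).
Proof.
move=> jJ; apply/funext => x.
pose c := \prod_(i < 3 | i != j) J i (m i) (coord x i).
(* [phi] is the restriction to the line through [x] in direction [evec R j], along which the other
   factors stay equal to [c]. *)
pose phi t := J j (m j) t * c.
have dphi : cder phi (fun t => J j (m j).+1 t * c).
  apply: (cder_ext (cderM (jJ j (m j)) (cder_cst c))) => t.
  by rewrite mulr0 addr0.
have phiE h : tens J m (h *: evec R j + x) = phi (h *: (1 : R) + coord x j).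
  rewrite /tens /prod3 (bigD1 j)//= /phi; congr (_ * _).
    by rewrite coord_shift eqxx.
  by apply: eq_bigr => i ij; rewrite coord_shift (negbTE ij) mulr0 add0r.
have E (p : R[i] -> R) : 'D_(evec R j) (fun y => p (tens J m y)) x = 'D_(1 : R) (fun t => p (phi t)) (coord x j).
  have phi0 : tens J m x = phi (coord x j).
    by have := phiE 0; rewrite !scale0r !add0r.
  rewrite /derive; set g1 := fun h => h^-1 *: _; set g2 := fun h => h^-1 *: _.
  suff -> : g1 = g2 by [].
  by apply/funext => h; rewrite /g1 /g2 /= phiE phi0.
have -> : tens J (fun i => ((i == j) + m i)%N) x = J j (m j).+1 (coord x j) * c.
  rewrite /tens /prod3 (bigD1 j)//= eqxx; congr (_ * _).
  by apply: eq_bigr => i /negbTE ->.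
rewrite /partial /re_fun /im_fun !E; apply: cext => /=.
  exact: (@derive_val _ _ _ _ _ _ _ (dphi.1 (coord x j))).
exact: (@derive_val _ _ _ _ _ _ _ (dphi.2 (coord x j))).
Qed.

Lemma partials_tens J m s : (forall i, jet (J i)) ->
  partials s (tens J m) = tens J (fun i => (count_mem i s + m i)%N).
Proof.
move=> jJ; elim: s => [|j s IH] //=.
rewrite -/(partials s (tens J m)) IH partial_tens//; congr tens; apply/funext => i.
by rewrite addnA eq_sym.
Qed.

Lemma smooth_tens J : (forall i, jet (J i)) -> smooth (tens J (fun=> 0%N)).
Proof. by move=> jJ s x; rewrite partials_tens//; exact: cdiff_tens. Qed.

Lemma cabs_prod (F : 'I_3 -> R[i]) : cabs (\prod_i F i) = \prod_i cabs (F i).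
Proof.
apply: (big_morph (@cabs R)); first exact: cabsM.
by rewrite -(normr1 R) -cabsR.
Qed.

Lemma tens_bound J (u : R -> R) m : (forall i, jbound (J i) u) ->
  exists2 K : R, 0 <= K & forall x, cabs (tens J m x) <= K * \prod_(i < 3) u (coord x i).
Proof.
move=> bJ; have /choice[K HK] : forall i : 'I_3, exists K : R, 0 <= K /\
    forall t, cabs (J i (m i) t) <= K * u t.
  by move=> i; have [K K0 HK] := bJ i (m i); exists K.
exists (\prod_(i < 3) K i); first by apply: prodr_ge0 => i _; have [] := HK i.
move=> x; rewrite /tens /prod3 cabs_prod -big_split /=.
by apply: ler_prod => i _; rewrite cabs_ge0 /=; have [_] := HK i; exact.
Qed.

Lemma test_tens J (L : R) : (forall i, jet (J i)) ->
  (forall i n t, L < `|t| -> J i n t = 0) -> test_function (tens J (fun=> 0%N)).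
Proof.
move=> jJ zJ; split; first exact: smooth_tens.
(* If no coordinate exceeds [L], the Euclidean norm is at most the sum of the three, hence at most
   [L + L + L]; beyond that radius some factor vanishes. *)
exists (L + L + L) => x Lx.
have [[i Hi]|H] := pselect (exists i, L < `|coord x i|).
  by rewrite /tens /prod3 (bigD1 i)//= zJ// mul0r.
have {}H i : `|coord x i| <= L by rewrite leNgt; apply/negP => h; apply: H; exists i.
have := lt_le_trans Lx (enorm_le x); rewrite !big_ord_recl big_ord0 addr0.
by move=> /lt_le_trans /(_ (lerD (H _) (lerD (H _) (H _)))); rewrite addrA ltxx.
Qed.

Lemma weight_gauss (N : nat) (b : R) : 0 < b -> exists2 K : R, 0 <= K &
  forall t : R, (1 + `|t|) ^+ N * gauss b 0 t <= K.
Proof.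
move=> b0; have [K K0 HK] := poly_gauss ((1 + 'X) ^+ N) b0.
exists K => // t; have := HK `|t|.
rewrite horner_exp hornerD hornerC hornerX normrX (ger0_norm (addr_ge0 _ _))//.
rewrite real_normK ?num_real// /gauss subr0 => /le_trans; apply.
by rewrite ler_piMr// expR_le1 oppr_le0 mulr_ge0 ?sqr_ge0// divr_ge0// ltW.
Qed.

Lemma schwartz_tens J (b : R) : 0 < b -> (forall i, jet (J i)) ->
  (forall i, jbound (J i) (gauss b 0)) -> schwartz (tens J (fun=> 0%N)).
Proof.
move=> b0 jJ bJ; split; first exact: smooth_tens.
move=> N s; rewrite partials_tens//.
have [K K0 HK] := tens_bound (fun i => (count_mem i s + 0)%N) bJ.
have [W W0 HW] := weight_gauss N b0.
exists (K * W ^+ 3) => x.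
(* The weight is split into functions of one variable through [1 + |x| <= prod_i (1 + |x_i|)]. *)
have h : (1 + enorm x) ^+ N <= \prod_(i < 3) (1 + `|coord x i|) ^+ N.
  rewrite prodrXl lerXn2r ?nnegrE ?addr_ge0 ?enorm_ge0//.
    by apply: prodr_ge0 => i _; rewrite addr_ge0.
  rewrite (@le_trans _ _ (1 + \sum_(i < 3) `|coord x i|))// ?lerD2l ?enorm_le//.
  rewrite !big_ord_recl !big_ord0.
  have h (p q r : R) : 0 <= p -> 0 <= q -> 0 <= r ->
      1 + (p + (q + (r + 0))) <= (1 + p) * ((1 + q) * ((1 + r) * 1)).
    move=> p0 q0 r0; rewrite -subr_ge0.
    have -> : (1 + p) * ((1 + q) * ((1 + r) * 1)) - (1 + (p + (q + (r + 0)))) =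
      p * q + p * r + q * r + p * q * r by ring.
    by rewrite !addr_ge0// !mulr_ge0.
  exact: h.
apply: (@le_trans _ _ ((\prod_(i < 3) (1 + `|coord x i|) ^+ N) * (K * \prod_(i < 3) gauss b 0 (coord x i)))).
  by rewrite ler_pM ?cabs_ge0// exprn_ge0// addr_ge0// enorm_ge0.
rewrite mulrCA ler_wpM2l// -big_split /=.
rewrite -[X in _ ^+ X](card_ord 3) -prodr_const.
by apply: ler_prod => i _; rewrite HW mulr_ge0 ?gauss_ge0// exprn_ge0// addr_ge0.
Qed.

End Tensor.

(** * Uniqueness from integrals over boxes and against Gaussians *)

Section Density.
Context d (T : measurableType d) (R : realType) (mu : {measure set T -> \bar R}).
Variable f : T -> \bar R.
Hypotheses (mf : measurable_fun setT f) (f0 : forall x, (0 <= f x)%E).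

Definition density (A : set T) : \bar R := (\int[mu]_(x in A) f x)%E.

Let density0 : density set0 = 0%E. Proof. exact: integral_set0. Qed.
Let density_ge0 A : (0 <= density A)%E. Proof. exact: integral_ge0. Qed.
Let density_sigma_additive : semi_sigma_additive density.
Proof.
move=> /= A mA tA mUA.
rewrite /density ge0_integral_bigcup//=; last exact: measurable_funTS.
by apply: is_cvg_ereal_nneg_natsum_cond => n _ _; exact: integral_ge0.
Qed.
Definition density_measure : {measure set T -> \bar R} :=
  HB.pack density (isMeasure.Build _ _ _ density density0 density_ge0 density_sigma_additive).
End Density.

Section Boxes.
Variable R : realType.
Implicit Types (a b x : R3 R).

Definition box a b : set (R3 R) := [set x | forall i, coord a i < coord x i < coord b i].

Definition cst3 (t : R) : R3 R := (t, t, t).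

Lemma coord_cst3 t i : coord (cst3 t) i = t.
Proof. by move: i; apply: ord3P. Qed.

Definition boxes : set (set (R3 R)) := [set X | exists a b, X = box a b].

Lemma boxesI : setI_closed boxes.
Proof.
move=> _ _ [a [b ->]] [a' [b' ->]].
pose mx (p q : R3 R) : R3 R := (Num.max p.1.1 q.1.1, Num.max p.1.2 q.1.2, Num.max p.2 q.2).
pose mn (p q : R3 R) : R3 R := (Num.min p.1.1 q.1.1, Num.min p.1.2 q.1.2, Num.min p.2 q.2).
have Mx p q i : coord (mx p q) i = Num.max (coord p i) (coord q i) by move: i; apply: ord3P.
have Mn p q i : coord (mn p q) i = Num.min (coord p i) (coord q i) by move: i; apply: ord3P.
exists (mx a a'), (mn b b'); apply/seteqP; split => x.
  move=> [h1 h2] i; rewrite Mx Mn gt_max lt_min.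
  by have /andP[-> ->] := h1 i; have /andP[-> ->] := h2 i.
move=> h; split => i; have := h i; rewrite Mx Mn gt_max lt_min.
  by move=> /andP[/andP[-> _] /andP[-> _]].
by move=> /andP[/andP[_ ->] /andP[_ ->]].
Qed.

Lemma boxes_cover : \bigcup_n (box (cst3 (- n%:R)) (cst3 n%:R)) = setT.
Proof.
apply/seteqP; split => // x _.
have [n Hn] : exists n : nat, enorm x < n%:R.
  by exists (Num.bound (enorm x)); apply: archi_boundP; exact: enorm_ge0.
exists n => // i; rewrite !coord_cst3 -ltr_norml.
exact: le_lt_trans (coord_enorm _ _) Hn.
Qed.

Lemma measurable_boxes : @measurable _ (R3 R) = <<s boxes >>.
Proof.
have mbox a b : measurable (box a b).
  have -> : box a b = \bigcap_(i in [set: 'I_3]) ((fun x => coord x i) @^-1` `]coord a i, coord b i[%classic).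
    apply/seteqP; split => x h.
      by move=> i _ /=; rewrite in_itv/=; exact: h.
    by move=> i; have := h i I; rewrite /= in_itv/=.
  apply: fin_bigcap_measurable; [exact: finite_finset|].
  move=> i _; rewrite -[X in measurable X]setTI; apply: measurable_coord => //.
apply/seteqP; split; last first.
  apply: smallest_sub; first exact: sigma_algebra_measurable.
  by move=> _ [a [b ->]].
pose T := g_sigma_algebraType boxes.
have mc (i : 'I_3) : measurable_fun (setT : set T) ((fun x => coord x i) : T -> R).
  apply: (measurability _ (RGenOInfty.measurableE R)) => _ [_ [t ->] <-].
  rewrite setTI.
  (* The half-space [t < x_i] is the union of the boxes whose lower corner has [t] in place [i] and
     [- n] elsewhere. *)
  pose lo n : R3 R := if i == ord0 then (t, - n%:R, - n%:R) else
    if i == lift ord0 ord0 then (- n%:R, t, - n%:R) else (- n%:R, - n%:R, t).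
  have lo1 n : coord (lo n) i = t by rewrite /lo; move: i {lo}; apply: ord3P.
  have lo2 n j : j != i -> coord (lo n) j = - n%:R.
    by rewrite /lo; move: i {lo lo1} j; apply: ord3P; apply: ord3P.
  have -> : (fun x => coord x i) @^-1` `]t, +oo[%classic = \bigcup_n box (lo n) (cst3 n%:R).
    apply/seteqP; split => x.
      rewrite /= in_itv/= andbT => tx.
      have [n Hn] : exists n : nat, enorm x < n%:R.
        by exists (Num.bound (enorm x)); apply: archi_boundP; exact: enorm_ge0.
      exists n => // j; rewrite coord_cst3.
      have := le_lt_trans (coord_enorm x j) Hn; rewrite ltr_norml => /andP[h1 ->].
      rewrite andbT; have [->|ji] := eqVneq j i; first by rewrite lo1.
      by rewrite lo2.
    by move=> [n _ /(_ i)]; rewrite lo1 /= in_itv/= andbT => /andP[].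
  by apply: bigcupT_measurable => n; apply: sub_sigma_algebra; exists (lo n), (cst3 n%:R).
have mi : measurable_fun (setT : set T) ((fun x => x) : T -> R3 R).
  have -> : ((fun x => x) : T -> R3 R) = (fun x => ((coord x ord0, coord x (lift ord0 ord0)), coord x (lift ord0 (lift ord0 ord0)))).
    by apply/funext => -[[p q] r].
  apply/measurable_fun_pair; last exact: mc.
  by apply/measurable_fun_pair; exact: mc.
by move=> A mA; have := mi measurableT A mA; rewrite setTI.
Qed.

Lemma measurable_box a b : measurable (box a b).
Proof. by rewrite measurable_boxes; apply: sub_sigma_algebra; exists a, b. Qed.

(** The densities [h^+] and [h^-] define measures that agree on boxes, a generating family closed
    under intersection, and are finite on an exhausting sequence of boxes. Hence they agree
    everywhere, and their disjoint supports force both to vanish. *)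
Lemma rbox_unique (h : R3 R -> R) : measurable_fun setT h ->
  (forall a b, (leb3s R).-integrable setT (EFin \o (fun x => h x * \1_(box a b) x))) ->
  (forall a b, \int[leb3s R]_x (h x * \1_(box a b) x) = 0) ->
  {ae leb3s R, forall x, h x = 0}.
Proof.
move=> mh ih zh.
pose hp x := Num.max (h x) 0; pose hn x := Num.max (- h x) 0.
have hp0 x : (0 <= (hp x)%:E)%E by rewrite lee_fin le_max lexx orbT.
have hn0 x : (0 <= (hn x)%:E)%E by rewrite lee_fin le_max lexx orbT.
have mp : measurable_fun setT (EFin \o hp) by apply/measurable_EFinP; apply: measurable_maxr.
have mn : measurable_fun setT (EFin \o hn).
  by apply/measurable_EFinP; apply: measurable_maxr => //; exact: measurableT_comp.
have ip (k : R3 R -> R) a b : measurable_fun setT k -> (forall x, `|k x| <= `|h x|) ->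
    (leb3s R).-integrable setT (EFin \o (fun x => k x * \1_(box a b) x)).
  move=> mk kh; apply: (@rintegrable_le _ _ _ _ _ (fun x => `|h x * \1_(box a b) x|)).
  - apply: measurable_funM => //; apply: measurable_indic; exact: measurable_box.
  - exact: integrable_norm (ih a b).
  - by move=> x; rewrite !normrM ler_wpM2r.
have hpn x : h x = hp x - hn x.
  rewrite /hp /hn; case: (leP (h x) 0) => h0.
    by rewrite max_l ?oppr_ge0// sub0r opprK.
  by rewrite max_r ?subr0// oppr_le0 ltW.
have hph x : `|hp x| <= `|h x|.
  by rewrite /hp; case: (leP (h x) 0) => h0; rewrite ?normr0.
have hnh x : `|hn x| <= `|h x|.
  by rewrite /hn; case: (leP (- h x) 0) => h0; rewrite ?normr0 ?normrN.
have mp' : measurable_fun setT hp by exact/measurable_EFinP.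
have mn' : measurable_fun setT hn by exact/measurable_EFinP.
have dE (k : R3 R -> R) a b : measurable_fun setT k -> (forall x, `|k x| <= `|h x|) ->
    (\int[leb3s R]_(x in box a b) (k x)%:E = (\int[leb3s R]_x (k x * \1_(box a b) x))%:E)%E.
  move=> mk kh; rewrite integral_mkcond /Rintegral fineK; last first.
    by apply: integrable_fin_num => //; exact: ip.
  apply: eq_integral => x _; rewrite patchE /= indicE.
  by case: ifP => _; rewrite ?mulr1 ?mulr0.
have E A : measurable A -> (density_measure (leb3s R) mp hp0) A = (density_measure (leb3s R) mn hn0) A.
  apply: (@measure_unique _ _ (R3 R) boxes (fun n => box (cst3 (- n%:R)) (cst3 n%:R)) measurable_boxes boxesI).
  - by move=> n; exists (cst3 (- n%:R)), (cst3 n%:R).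
  - exact: boxes_cover.
  - move=> _ [a [b ->]]; rewrite /= /density dE// dE//; congr EFin.
    apply/eqP; rewrite -subr_eq0 -RintegralB//; try exact: ip.
    rewrite -(zh a b); apply/eqP; apply: eq_Rintegral => x _.
    by rewrite hpn mulrBl.
  - by move=> n; rewrite /= /density dE// ltry.
(* Integrating over the set [k != 0], where [l] vanishes, shows that [k] has integral 0. *)
have zero (k l : R3 R -> R) (k0 : forall x, (0 <= (k x)%:E)%E) :
    measurable_fun setT k -> measurable_fun setT l ->
    (forall x, k x != 0 -> l x = 0) -> (forall A, measurable A ->
      \int[leb3s R]_(x in A) (k x)%:E = \int[leb3s R]_(x in A) (l x)%:E)%E ->
    {ae leb3s R, forall x, k x = 0}.
  move=> mk ml kl EA.
  pose D := [set x | k x != 0].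
  have mD : measurable D.
    have -> : D = k @^-1` (~` [set 0]).
      by apply/seteqP; split => x /=; [move=> /eqP|move=> /eqP].
    by rewrite -[X in measurable X]setTI; apply: mk => //; exact: measurableC.
  have z : (\int[leb3s R]_x (k x)%:E = 0)%E.
    rewrite (_ : \int[leb3s R]_x (k x)%:E = \int[leb3s R]_(x in D) (k x)%:E)%E; last first.
      rewrite [RHS]integral_mkcond; apply: eq_integral => x _; rewrite patchE.
      by case: ifPn => //; rewrite notin_setE /= => /negP; rewrite negbK => /eqP ->.
    by rewrite EA//; apply: integral0_eq => x /= kx; rewrite kl.
  have /(ae_eq_integral_abs (leb3s R) measurableT) : measurable_fun setT (EFin \o k) by exact/measurable_EFinP.
  move=> [+ _]; rewrite (_ : \int[leb3s R]_x `|(EFin \o k) x| = \int[leb3s R]_x (k x)%:E)%E; last first.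
    by apply: eq_integral => x _; rewrite gee0_abs //; exact: k0.
  by move=> /(_ z); apply: filterS => x /(_ I) [].
have hz x : hp x != 0 -> hn x = 0.
  rewrite /hp /hn; case: (leP (h x) 0); rewrite ?eqxx// => h0 _.
  by rewrite max_r// oppr_le0 ltW.
have nz x : hn x != 0 -> hp x = 0 by move=> h1; apply/eqP; apply: contraNT h1 => /hz ->.
have z1 := zero hp hn hp0 mp' mn' hz E.
have z2 := zero hn hp hn0 mn' mp' nz (fun A mA => esym (E A mA)).
by apply: filterS2 z1 z2 => x e1 e2; rewrite hpn e1 e2 subr0.
Qed.

Lemma box_unique (f : R3 R -> R[i]) : cmeas f ->
  (forall a b, cintb (leb3s R) (fun x => f x * (\1_(box a b) x)%:C)) ->
  (forall a b, cint (leb3s R) (fun x => f x * (\1_(box a b) x)%:C) = 0) ->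
  {ae leb3s R, forall x, f x = 0}.
Proof.
move=> [mr mi] fi fz.
have rE a b x : Re (f x * (\1_(box a b) x)%:C) = Re (f x) * \1_(box a b) x.
  by rewrite ReM /= mulr0 subr0.
have iE a b x : Im (f x * (\1_(box a b) x)%:C) = Im (f x) * \1_(box a b) x.
  by rewrite ImM /= mulr0 add0r.
have h1 : {ae leb3s R, forall x, Re (f x) = 0}.
  apply: rbox_unique => // a b.
    by have [+ _] := fi a b; under eq_fun do rewrite rE.
  have := congr1 (@Re R) (fz a b) => /= <-.
  by apply: eq_Rintegral => x _; rewrite rE.
have h2 : {ae leb3s R, forall x, Im (f x) = 0}.
  apply: rbox_unique => // a b.
    by have [_] := fi a b; under eq_fun do rewrite iE.
  have := congr1 (@Im R) (fz a b) => /= <-.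
  by apply: eq_Rintegral => x _; rewrite iE.
by apply: filterS2 h1 h2 => x e1 e2; apply: cext.
Qed.

End Boxes.

(** * Mollification by Gaussians *)

Section Mollification.
Variable R : realType.
Implicit Types (a b c : R) (x y : R3 R) (f w : R3 R -> R[i]).

Definition gauss3 a (s x : R3 R) : R := \prod_(i < 3) gauss a (coord s i) (coord x i).

Lemma gauss3_ge0 a (s x : R3 R) : 0 <= gauss3 a s x.
Proof. by apply: prodr_ge0 => i _; exact: gauss_ge0. Qed.

Lemma gaussC a c t : gauss a c t = gauss a t c :> R.
Proof. by rewrite /gauss -sqrrN opprB. Qed.

Lemma gauss_le1 a c t : 0 <= a -> gauss a c t <= 1 :> R.
Proof. by move=> a0; rewrite expR_le1 oppr_le0 mulr_ge0 ?sqr_ge0. Qed.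

Lemma gauss3E a (s x : R3 R) : gauss3 a s x = expR (- (a * enorm (add3 x (opp3 s)) ^+ 2)).
Proof.
rewrite enorm2E mulr_sumr -sumrN expR_sum; apply: eq_bigr => i _.
by rewrite coord_add3 coord_opp3.
Qed.

Lemma coord0 i : coord (0 : R3 R) i = 0.
Proof. by move: i; apply: ord3P. Qed.

Lemma gauss3_0 a x : gauss3 a 0 x = expR (- (a * enorm x ^+ 2)).
Proof.
rewrite gauss3E; congr (expR (- (a * enorm _ ^+ 2))); apply: coord_ext => i.
by rewrite coord_add3 coord_opp3 coord0 subr0.
Qed.

Lemma measurable_prod3 d (T : measurableType d) (F : 'I_3 -> T -> R) :
  (forall i, measurable_fun setT (F i)) -> measurable_fun setT (fun z => \prod_(i < 3) F i z).
Proof.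
move=> mF; under eq_fun do rewrite !big_ord_recl big_ord0 mulr1.
by apply: measurable_funM => //; exact: measurable_funM.
Qed.

Lemma measurable_gauss3 d (T : measurableType d) a (h k : T -> R3 R) :
  measurable_fun setT h -> measurable_fun setT k ->
  measurable_fun setT (fun z => gauss3 a (h z) (k z)).
Proof.
move=> mh mk; apply: measurable_prod3 => i.
have m1 := measurableT_comp (measurable_coord i) mh.
have m2 := measurableT_comp (measurable_coord i) mk.
have mq : measurable_fun setT (fun z => a * (coord (k z) i - coord (h z) i) ^+ 2).
  by apply: measurable_funM => //; apply: measurable_funX; exact: measurable_funB.
exact: (measurableT_comp (@measurable_expR R) (measurable_funN mq)).
Qed.

(** What is kept of temperedness: integrability against Gaussians of every width. It allows pairing
    with any function of Gaussian decay ([gtemp_bound]), hence with indicators of boxes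
    ([gtemp_ind]). *)
Definition gtemp f := cmeas f /\
  forall b, 0 < b -> cintb (leb3s R) (fun x => f x * (gauss3 b 0 x)%:C).

Lemma gtemp_bound f w b (K : R) : gtemp f -> cmeas w -> 0 < b ->
  (forall x, cabs (w x) <= K * gauss3 b 0 x) -> cintb (leb3s R) (fun x => f x * w x).
Proof.
move=> [mf fi] mw b0 wb.
apply: (@cintb_le _ _ _ _ _ (fun x => K * cabs (f x * (gauss3 b 0 x)%:C))).
- exact: cmeasM.
- rewrite /comp; under eq_fun do rewrite EFinM; apply: integrableZl => //.
  exact: cintb_abs (fi b b0).
- move=> x; rewrite !cabsM cabsR ger0_norm ?gauss3_ge0// mulrCA.
  by rewrite ler_wpM2l ?cabs_ge0.
Qed.

Definition ival (p q t : R) : R := \1_(`]p, q[%classic) t.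
(** The indicator of []p, q[] convolved with a Gaussian of mass one. *)
Definition avg a p q t : R :=
  Num.sqrt (a / pi) * \int[@leb R]_s (ival p q s * gauss a t s).

Lemma ival_ge0 p q t : 0 <= ival p q t. Proof. by rewrite /ival indicE. Qed.
Lemma ival_le1 p q t : ival p q t <= 1. Proof. by rewrite /ival indicE; case: (_ \in _). Qed.
Lemma measurable_ival p q : measurable_fun setT (ival p q).
Proof. by apply: measurable_indic; exact: measurable_itv. Qed.

Lemma integrable_ival_gauss a p q t : 0 < a ->
  (@leb R).-integrable setT (EFin \o (fun s => ival p q s * gauss a t s)).
Proof.
move=> a0; apply: (@rintegrable_le _ _ _ _ _ (gauss a t)).
- by apply: measurable_funM; [exact: measurable_ival|exact: measurable_gauss].
- by have [] := integral_gauss t a0.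
- move=> s; rewrite normrM !ger0_norm ?ival_ge0 ?gauss_ge0//.
  by rewrite ler_piMl ?gauss_ge0 ?ival_le1.
Qed.

Lemma avg_ge0 a p q t : 0 <= avg a p q t.
Proof.
by rewrite mulr_ge0 ?sqrtr_ge0// Rintegral_ge0// => s _; rewrite mulr_ge0 ?ival_ge0 ?gauss_ge0.
Qed.

Lemma sqrt_half a : 0 < a -> Num.sqrt (a / pi) * Num.sqrt (pi / (a / 2)) = Num.sqrt 2 :> R.
Proof.
move=> a0; rewrite -sqrtrM; last by rewrite divr_ge0// ?pi_ge0// ltW.
congr Num.sqrt; have := pi_gt0 R; move: (pi : R) => P P0; field.
by rewrite (gt_eqF a0) (gt_eqF P0).
Qed.

(** Only points with [|s - t| >= d] contribute. Half of the exponent [a (s - t)^2] yields the decay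
    in [d], the other half is integrated; [sqrt 2] is the mass of [gauss (a / 2)] relative to that
    of [gauss a]. *)
Lemma avg_near a p q t (d : R) : 0 < a ->
  (forall s, ival p q s != ival p q t -> d <= `|s - t|) -> 0 <= d ->
  `|avg a p q t - ival p q t| <= Num.sqrt 2 * expR (- (a / 2 * d ^+ 2)).
Proof.
move=> a0 Hd d0.
have [ig eg] := integral_gauss t a0.
have a20 : 0 < a / 2 by rewrite divr_gt0.
have [ig2 eg2] := integral_gauss t a20.
have -> : avg a p q t - ival p q t =
    Num.sqrt (a / pi) * \int[@leb R]_s ((ival p q s - ival p q t) * gauss a t s).
  have -> : \int[@leb R]_s ((ival p q s - ival p q t) * gauss a t s) =
      \int[@leb R]_s (ival p q s * gauss a t s) - ival p q t * Num.sqrt (pi / a).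
    rewrite -eg -RintegralZl// -RintegralB//.
    - by apply: eq_Rintegral => s _; rewrite mulrBl.
    - exact: integrable_ival_gauss.
    - by rewrite /comp; under eq_fun do rewrite EFinM; exact: integrableZl.
  rewrite mulrBr mulrCA -sqrtrM; last by rewrite divr_ge0// ?pi_ge0// ltW.
  rewrite (_ : a / pi * (pi / a) = 1) ?sqrtr1 ?mulr1//.
  have := pi_gt0 R; move: (pi : R) => P P0; field.
  by rewrite (gt_eqF a0) (gt_eqF P0).
have im : (@leb R).-integrable setT (EFin \o (fun s => (ival p q s - ival p q t) * gauss a t s)).
  apply: (@rintegrable_le _ _ _ _ _ (gauss a t)) => //.
    apply: measurable_funM; last exact: measurable_gauss.
    by apply: measurable_funB => //; exact: measurable_ival.
  move=> s; rewrite normrM (ger0_norm (gauss_ge0 _ _ _)) ler_piMl ?gauss_ge0//.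
  rewrite ler_norml; have := ival_ge0 p q s; have := ival_ge0 p q t.
  by have := ival_le1 p q s; have := ival_le1 p q t; lra.
rewrite normrM (ger0_norm (sqrtr_ge0 _)) -(sqrt_half a0) -mulrA ler_wpM2l ?sqrtr_ge0//.
rewrite (le_trans (le_normr_Rintegral _ im))// -eg2 [leRHS]mulrC -RintegralZl//.
apply: le_Rintegral => //.
- exact: integrable_norm.
- by rewrite /comp; under eq_fun do rewrite EFinM; exact: integrableZl.
move=> s _; rewrite normrM (ger0_norm (gauss_ge0 _ _ _)).
have [->|h] := eqVneq (ival p q s) (ival p q t).
  by rewrite subrr normr0 mul0r mulr_ge0 ?expR_ge0.
apply: (@le_trans _ _ (1 * gauss a t s)).
  rewrite ler_wpM2r ?gauss_ge0// ler_norml.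
  have := ival_ge0 p q s; have := ival_ge0 p q t.
  by have := ival_le1 p q s; have := ival_le1 p q t; lra.
rewrite mul1r /gauss -expRD ler_expR -opprD lerN2.
have : d ^+ 2 <= (s - t) ^+ 2.
  by rewrite -[leRHS]real_normK ?num_real// ler_pXn2r ?nnegrE ?Hd.
by move=> h1; have := ler_wpM2l (ltW a20) h1; set u := (s - t) ^+ 2; set v := d ^+ 2; lra.
Qed.

(** Uniform in [a >= 1], as a dominating function must be. Half of the exponent keeps the mass
    bounded; the other half is at least [(s - t)^2 / 2 >= t^2 / 4 - s^2 / 2], by
    [(t - 2 s)^2 >= 0]. *)
Lemma avg_le a p q t (L : R) : 1 <= a -> `|p| <= L -> `|q| <= L ->
  avg a p q t <= Num.sqrt 2 * expR (L ^+ 2 / 2) * gauss (1 / 4) 0 t.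
Proof.
move=> a1 pL qL; have a0 : 0 < a by rewrite (lt_le_trans ltr01).
have a20 : 0 < a / 2 by rewrite divr_gt0.
have [ig2 eg2] := integral_gauss t a20.
have -> : Num.sqrt 2 * expR (L ^+ 2 / 2) * gauss (1 / 4) 0 t =
    Num.sqrt (a / pi) * (expR (L ^+ 2 / 2) * gauss (1 / 4) 0 t * Num.sqrt (pi / (a / 2))).
  by rewrite -(sqrt_half a0); ring.
rewrite /avg ler_wpM2l ?sqrtr_ge0// -eg2 -RintegralZl//.
apply: le_Rintegral => //.
- exact: integrable_ival_gauss.
- by rewrite /comp; under eq_fun do rewrite EFinM; exact: integrableZl.
move=> s _; rewrite /ival indicE.
have [|_] := boolP (s \in _); last by rewrite mul0r !mulr_ge0 ?expR_ge0.
rewrite mem_setE in_itv/= [leLHS]mul1r => /andP[ps sq].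
have sL : s ^+ 2 <= L ^+ 2.
  have sL : `|s| <= L.
    by move: pL qL; rewrite !ler_norml => /andP[h1 h2] /andP[h3 h4]; lra.
  by rewrite -real_normK ?num_real// ler_pXn2r ?nnegrE// (le_trans _ sL).
rewrite /gauss -!expRD ler_expR subr0.
have : (s - t) ^+ 2 / 2 <= a / 2 * (s - t) ^+ 2.
  by have := ler_wpM2r (sqr_ge0 (s - t)) a1; lra.
have : 0 <= (t - 2 * s) ^+ 2 by exact: sqr_ge0.
lra.
Qed.

(* Mollification widths decrease geometrically: the L^2 norms of consecutive
   differences are then summable, and convergence holds almost everywhere. *)
Definition aseq (n : nat) : R := 4 ^+ n.
Lemma aseq_ge1 n : 1 <= aseq n. Proof. by rewrite exprn_ege1// ler1n. Qed.
Lemma aseq_gt0 n : 0 < aseq n. Proof. exact: exprn_gt0. Qed.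
Lemma aseq_gen n : n%:R <= aseq n.
Proof. by rewrite /aseq -natrX ler_nat ltnW// ltn_expl. Qed.

(** Off the endpoints the indicator is constant within distance [d] of [t]; the bound of [avg_near]
    then decays geometrically in [n] because [n <= aseq n]. *)
Lemma avg_cvg p q t : t != p -> t != q -> avg (aseq n) p q t @[n --> \oo] --> ival p q t.
Proof.
move=> tp tq; pose d := Num.min `|t - p| `|t - q|.
have d0 : 0 < d by rewrite lt_min !normr_gt0 !subr_eq0 tp.
have Hd s : ival p q s != ival p q t -> d <= `|s - t|.
  rewrite /ival !indicE !mem_setE !in_itv/= => h; rewrite ge_min.
  apply/negP => /negP; rewrite negb_or -!ltNge => /andP[g1 g2].
  move: h; suff -> : (p < s < q) = (p < t < q) by rewrite eqxx.
  move: g1 g2; rewrite !ltr_norml => /andP[g1 g1'] /andP[g2 g2'].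
  have k1 : (p < s) = (p < t).
    case: (ltgtP t p) tp => // c _.
      by rewrite ltr0_norm ?subr_lt0// in g1 g1'; apply/negbTE; rewrite -leNgt; lra.
    by rewrite gtr0_norm ?subr_gt0// in g1 g1'; lra.
  have k2 : (s < q) = (t < q).
    case: (ltgtP t q) tq => // c _.
      by rewrite ltr0_norm ?subr_lt0// in g2 g2'; lra.
    by rewrite gtr0_norm ?subr_gt0// in g2 g2'; apply/negbTE; rewrite -leNgt; lra.
  by rewrite k1 k2.
have h0 : Num.sqrt 2 * (expR (- (d ^+ 2 / 2))) ^+ n @[n --> \oo] --> (0 : R).
  apply: cvg_Z0; apply: cvg_expr; rewrite ger0_norm ?expR_ge0// expR_lt1 oppr_lt0.
  by rewrite divr_gt0// exprn_gt0.
apply/subr_cvg0/norm_cvg0P; apply: (squeeze_cvgr _ (cvg_cst 0) h0); apply: nearW => n.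
rewrite normr_ge0/=; apply: (le_trans (avg_near (aseq_gt0 n) Hd (ltW d0))).
rewrite ler_wpM2l ?sqrtr_ge0// -expRM_natl ler_expR mulrN lerN2.
have := ler_wpM2r (sqr_ge0 d) (aseq_gen n); lra.
Qed.

End Mollification.

Section Convergence.
Variable R : realType.
Implicit Types (a b c : R) (p q x y : R3 R) (f w : R3 R -> R[i]).

Lemma ind_box p q x : \1_(box p q) x = \prod_(i < 3) ival (coord p i) (coord q i) (coord x i) :> R.
Proof.
rewrite indicE; have [xb|xb] := pselect (box p q x).
  rewrite mem_set// big1// => i _; rewrite /ival indicE mem_set// /= in_itv /=; exact: xb.
rewrite memNset//; have [i xi] : exists i, ~ (coord p i < coord x i < coord q i).
  by apply/existsNP.
rewrite (bigD1 i)//= /ival indicE memNset ?mul0r// /= in_itv /=; exact/negP/negP.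
Qed.

(** Used to discard the faces of boxes, and later the points where one divides by a coordinate or by
    [|x|]. *)
Lemma ae_coord c i : {ae leb3s R, forall x, coord x i != c}.
Proof.
exists [set x | coord x i = c]; split.
- rewrite (_ : [set _ | _] = (fun x => coord x i) @^-1` [set c])//.
  by rewrite -[X in measurable X]setTI; apply: measurable_coord.
- have l0 : @leb R [set c] = 0%E by exact: lebesgue_measure_set1.
  have m2 : measurable ([set c] : set R) by exact: measurable_set1.
  have h2 (A B : set R) : measurable A -> measurable B ->
      (@leb R A = 0 \/ @leb R B = 0)%E -> leb2s R (A `*` B) = 0%E.
    move=> mA mB h; transitivity (@leb R A * @leb R B)%E; first exact: product_measure1E.
    by case: h => ->; rewrite ?mul0e ?mule0.
  have h3 (A : set (R * R)) (B : set R) : measurable A -> measurable B ->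
      (leb2s R A = 0 \/ @leb R B = 0)%E -> leb3s R (A `*` B) = 0%E.
    move=> mA mB h; transitivity (leb2s R A * @leb R B)%E; first exact: product_measure1E.
    by case: h => ->; rewrite ?mul0e ?mule0.
  move: i; apply: ord3P.
  + rewrite (_ : [set _ | _] = ([set c] `*` setT) `*` setT); last first.
      by apply/seteqP; split => -[[u v] z] /=; [move=> e; split|move=> [[]]].
    by apply: h3 => //; [exact: measurableX|left; apply: h2 => //; left].
  + rewrite (_ : [set _ | _] = (setT `*` [set c]) `*` setT); last first.
      by apply/seteqP; split => -[[u v] z] /=; [move=> e; split|move=> [[]]].
    by apply: h3 => //; [exact: measurableX|left; apply: h2 => //; right].
  + rewrite (_ : [set _ | _] = setT `*` [set c]); last first.
      by apply/seteqP; split => -[[u v] z] /=; [move=> e; split|move=> []].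
    by apply: h3 => //; right.
- by move=> x /= /negP; rewrite negbK => /eqP.
Qed.

Lemma ae_forall3 (P : 'I_3 -> R3 R -> Prop) :
  (forall i, {ae leb3s R, forall x, P i x}) -> {ae leb3s R, forall x, forall i, P i x}.
Proof.
move=> h; apply: filterS3 (h ord0) (h (lift ord0 ord0)) (h (lift ord0 (lift ord0 ord0))) => x h0 h1 h2.
exact: ord3P.
Qed.

Definition avg3 a p q x : R := \prod_(i < 3) avg a (coord p i) (coord q i) (coord x i).

Lemma avg3_cvg p q : {ae leb3s R, forall x, avg3 (aseq R n) p q x @[n --> \oo] --> (\1_(box p q) x : R)}.
Proof.
have h1 := ae_forall3 (fun i => ae_coord (coord p i) i).
have h2 := ae_forall3 (fun i => ae_coord (coord q i) i).
apply: filterS2 h1 h2 => x hp hq; rewrite ind_box /avg3.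
under eq_fun do rewrite !big_ord_recl big_ord0 mulr1.
rewrite !big_ord_recl big_ord0 mulr1.
have c i := avg_cvg (hp i) (hq i).
by apply: cvgM; [exact: c|apply: cvgM; exact: c].
Qed.

Lemma avg3_bound p q : exists2 K : R, 0 <= K & forall a x, 1 <= a ->
  0 <= avg3 a p q x <= K * gauss3 (1 / 4) 0 x.
Proof.
pose L := enorm p + enorm q.
exists ((Num.sqrt 2 * expR (L ^+ 2 / 2)) ^+ 3).
  by rewrite exprn_ge0// mulr_ge0 ?sqrtr_ge0 ?expR_ge0.
move=> a x a1; apply/andP; split; first by apply: prodr_ge0 => i _; exact: avg_ge0.
rewrite -[X in _ ^+ X](card_ord 3) -prodr_const -big_split /=.
apply: ler_prod => i _; rewrite avg_ge0 /= coord0; apply: avg_le => //.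
  by rewrite (le_trans (coord_enorm _ _))// lerDl enorm_ge0.
by rewrite (le_trans (coord_enorm _ _))// lerDr enorm_ge0.
Qed.

Lemma gauss3C a x y : gauss3 a x y = gauss3 a y x.
Proof. by apply: eq_bigr => i _; exact: gaussC. Qed.

Lemma cint_ind_gauss3 a p q x : 0 < a ->
  cint (leb3s R) (fun s => (Num.sqrt (a / pi) ^+ 3 * gauss3 a s x * \1_(box p q) s)%:C) =
  (avg3 a p q x)%:C.
Proof.
move=> a0.
pose F (i : 'I_3) (s : R) : R := Num.sqrt (a / pi) * (ival (coord p i) (coord q i) s * gauss a (coord x i) s).
have iF i : (@leb R).-integrable setT (EFin \o F i).
  rewrite /comp /F; under eq_fun do rewrite EFinM; apply: integrableZl => //.
  exact: integrable_ival_gauss.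
transitivity (cint (leb3s R) (prod3 (fun i s => (F i s)%:C))).
  congr cint; apply/funext => s; rewrite /prod3 -rmorph_prod; congr (_%:C).
  rewrite ind_box gauss3C /gauss3 /F -[X in _ ^+ X](card_ord 3) -prodr_const -!big_split /=.
  by apply: eq_bigr => i _; ring.
rewrite cint_prod3; last by move=> i; exact: cintbR.
rewrite /avg3 rmorph_prod; apply: eq_bigr => i _; rewrite cintR; congr (_%:C).
by rewrite /F RintegralZl//; exact: integrable_ival_gauss.
Qed.

Lemma integrable_ind_box p q : (leb3s R).-integrable setT (EFin \o \1_(box p q)).
Proof.
pose F (i : 'I_3) (s : R) : R := ival (coord p i) (coord q i) s.
have iF i : cintb (@leb R) (fun s => (F i s)%:C).
  by apply: cintbR; exact: (leb_integralT (measurable_ival _ _) (integrable_indic_itv _ _ _ _)).1.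
have [] := cintb_prod3 iF.
rewrite (_ : (fun x => _) = EFin \o \1_(box p q))//; apply/funext => x.
by rewrite /prod3 -rmorph_prod /= ind_box.
Qed.

(** Convolution with the Gaussian [(a / pi)^(3/2) exp (- a |x|^2)] of mass one. *)
Definition mollify f a x : R[i] :=
  (Num.sqrt (a / pi) ^+ 3)%:C * cint (leb3s R) (fun y => f y * (gauss3 a x y)%:C).

Lemma mollify_joint f a p q : gtemp f -> 0 < a ->
  cintb (leb3s R \x leb3s R)%E (fun z => f z.1 * (Num.sqrt (a / pi) ^+ 3 * gauss3 a z.2 z.1 * \1_(box p q) z.2)%:C).
Proof.
move=> gf a0; have [mf fi] := gf.
pose L := enorm p + enorm q; have a20 : 0 < a / 2 by rewrite divr_gt0.
have K0 : 0 <= Num.sqrt (a / pi) ^+ 3 by rewrite exprn_ge0 ?sqrtr_ge0.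
move: K0; move: (Num.sqrt (a / pi) ^+ 3 : R) => N K0.
(* For [s] in the box [|s_i| <= L], so [gauss_recenter] bounds the kernel by a centred Gaussian with
   a constant independent of [s]. *)
apply: (@cintb_le _ _ _ _ _ (fun z => (N * expR (a * L ^+ 2) ^+ 3) * (cabs (f z.1 * (gauss3 (a / 2) 0 z.1)%:C) * \1_(box p q) z.2))).
- apply: cmeasM; first exact: (cmeas_comp mf measurable_fst).
  apply: cmeasR; apply: measurable_funM; last first.
    exact: (measurableT_comp (measurable_indic (measurable_box p q)) measurable_snd).
  apply: measurable_funM => //; exact: measurable_gauss3.
- rewrite /comp; under eq_fun do rewrite EFinM; apply: integrableZl => //.
  apply: (rintegrable_tensor (a := fun x => cabs (f x * (gauss3 (a / 2) 0 x)%:C)) (b := \1_(box p q))).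
    exact: cintb_abs (fi _ a20).
  exact: integrable_ind_box.
move=> [x s]; rewrite ![_.1]/= ![_.2]/= !cabsM !cabsR (ger0_norm (gauss3_ge0 _ _ _)) ger0_norm; last by rewrite !mulr_ge0 ?gauss3_ge0 ?indicE.
rewrite [leRHS](_ : _ = cabs (f x) * (N * (expR (a * L ^+ 2) ^+ 3 * gauss3 (a / 2) 0 x * \1_(box p q) s))); last by ring.
rewrite ler_wpM2l ?cabs_ge0// -mulrA ler_wpM2l//.
have [xb|xb] := pselect (box p q s); last by rewrite indicE memNset// !mulr0.
rewrite ler_wpM2r// -[X in _ ^+ X](card_ord 3) -prodr_const -big_split /=.
apply: ler_prod => i _; rewrite gauss_ge0 /= coord0 (le_trans (gauss_recenter _ _ a0))//.
rewrite ler_wpM2r ?gauss_ge0// ler_expR ler_wpM2l ?(ltW a0)//.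
rewrite -(real_normK (num_real (coord s i))) ler_pXn2r ?nnegrE ?addr_ge0 ?enorm_ge0//.
have /andP[h1 h2] := xb i; rewrite ler_norml.
have := coord_enorm p i; have := coord_enorm q i; rewrite !ler_norml => /andP[h3 h4] /andP[h5 h6].
have := enorm_ge0 p; have := enorm_ge0 q; rewrite /L; lra.
Qed.

(** By Fubini and the symmetry of the kernel, the mollification moves from [f] to the indicator of
    the box. *)
Lemma mollify_box f a p q : gtemp f -> 0 < a ->
  cintb (leb3s R) (fun s => mollify f a s * (\1_(box p q) s)%:C) /\
  cint (leb3s R) (fun s => mollify f a s * (\1_(box p q) s)%:C) =
  cint (leb3s R) (fun x => f x * (avg3 a p q x)%:C).
Proof.
move=> gf a0; have J := mollify_joint p q gf a0.
have gi s : cintb (leb3s R) (fun y => f y * (gauss3 a s y)%:C).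
  apply: (gtemp_bound (b := a / 2) (K := \prod_(i < 3) expR (a * coord s i ^+ 2)) gf).
  - by apply: cmeasR; exact: measurable_gauss3.
  - by rewrite divr_gt0.
  - move=> x; rewrite cabsR ger0_norm ?gauss3_ge0// -big_split /=.
    by apply: ler_prod => i _; rewrite gauss_ge0 /= coord0 gauss_recenter.
have E : (fun s => cint (leb3s R) (fun x => f x * (Num.sqrt (a / pi) ^+ 3 * gauss3 a s x * \1_(box p q) s)%:C)) =
    (fun s => mollify f a s * (\1_(box p q) s)%:C).
  apply/funext => s; rewrite /mollify mulrAC -rmorphM -cintZ//.
  by congr cint; apply/funext => x; rewrite !rmorphM; ring.
have [F1 F2] := cfubini2 J; rewrite /= E in F1 F2.
split => //; rewrite -F2 (cfubini1 J).2; congr cint; apply/funext => x /=.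
rewrite cintZ ?cint_ind_gauss3//.
apply: cintbR; apply: (@rintegrable_le _ _ _ _ _ (fun s => Num.sqrt (a / pi) ^+ 3 * \1_(box p q) s)).
- apply: measurable_funM; last exact: measurable_indic (measurable_box p q).
  by apply: measurable_funM => //; exact: measurable_gauss3.
- rewrite /comp; under eq_fun do rewrite EFinM; apply: integrableZl => //.
  exact: integrable_ind_box.
- move=> s; rewrite !normrM !ger0_norm ?gauss3_ge0 ?exprn_ge0 ?sqrtr_ge0//.
  rewrite ler_wpM2r// ler_piMr ?exprn_ge0 ?sqrtr_ge0// /gauss3.
  by apply: prodr_ile1 => i _; rewrite gauss_ge0 gauss_le1// ltW.
Qed.

Lemma measurable_avg a (c d : R) : measurable_fun setT (avg a c d).
Proof.
apply: measurable_funM => //.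
apply: (@measurableT_comp _ _ _ _ _ _ fine) => //.
apply: (measurable_fun_fubini_tonelli_F (m2 := @leb R) (fun z : R * R => (ival c d z.2 * gauss a z.1 z.2)%:E)).
  apply/measurable_EFinP; apply: measurable_funM.
    exact: (measurableT_comp (measurable_ival c d) measurable_snd).
  have mq : measurable_fun setT (fun z : R * R => a * (z.2 - z.1) ^+ 2).
    by apply: measurable_funM => //; apply: measurable_funX; exact: measurable_funB.
  exact: (measurableT_comp (@measurable_expR R) (measurable_funN mq)).
by move=> z; rewrite lee_fin mulr_ge0 ?ival_ge0 ?gauss_ge0.
Qed.

Lemma measurable_avg3 a p q : measurable_fun setT (avg3 a p q).
Proof.
apply: measurable_prod3 => i.
exact: (measurableT_comp (measurable_avg _ _ _) (measurable_coord i)).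
Qed.

Lemma gtemp_ind f p q : gtemp f -> cintb (leb3s R) (fun x => f x * (\1_(box p q) x)%:C).
Proof.
move=> gf; pose L := enorm p + enorm q.
apply: (gtemp_bound (b := 1) (K := expR (L ^+ 2) ^+ 3) gf) => //.
  by apply: cmeasR; exact: measurable_indic (measurable_box p q).
move=> x; rewrite cabsR ger0_norm//.
rewrite -[X in _ ^+ X](card_ord 3) -prodr_const -big_split /=.
have [xb|xb] := pselect (box p q x); last first.
  by rewrite indicE memNset//; apply: prodr_ge0 => i _; rewrite mulr_ge0 ?expR_ge0.
rewrite indicE mem_set// [leLHS](_ : _ = \prod_(i < 3) (1 : R)); last by rewrite big1.
apply: ler_prod => i _; rewrite ler01 /= coord0 /gauss -expRD mul1r subr0 -[leLHS]expR0 ler_expR subr_ge0.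
rewrite -(real_normK (num_real (coord x i))) ler_pXn2r ?nnegrE ?addr_ge0 ?enorm_ge0//.
have /andP[h1 h2] := xb i; rewrite ler_norml.
have := coord_enorm p i; have := coord_enorm q i; rewrite !ler_norml => /andP[h3 h4] /andP[h5 h6].
have := enorm_ge0 p; have := enorm_ge0 q; rewrite /L; lra.
Qed.

(** A weak convergence that asks nothing of [f] beyond [gtemp]: the smoothing acts on the indicator,
    and [avg3_bound] dominates uniformly in [n]. *)
Lemma cvg_mollify f p q : gtemp f ->
  ccvg (fun n => cint (leb3s R) (fun s => mollify f (aseq R n) s * (\1_(box p q) s)%:C))
    (cint (leb3s R) (fun x => f x * (\1_(box p q) x)%:C)).
Proof.
move=> gf; have [mf fi] := gf.
have [K K0 HK] := avg3_bound p q.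
have b4 : 0 < 1 / 4 :> R by rewrite divr_gt0.
have [||||//|] := @cint_dominated _ _ R (leb3s R) (fun n x => f x * (avg3 (aseq R n) p q x)%:C)
  (fun x => f x * (\1_(box p q) x)%:C) (fun x => K * cabs (f x * (gauss3 (1 / 4) 0 x)%:C)).
- by move=> n; apply: cmeasM => //; apply: cmeasR; exact: measurable_avg3.
- by apply: cmeasM => //; apply: cmeasR; exact: measurable_indic (measurable_box p q).
- apply: filterS (avg3_cvg p q) => x cx; apply: ccvgM; first exact: ccvg_cst.
  exact: ccvgR.
- rewrite /comp; under eq_fun do rewrite EFinM; apply: integrableZl => //.
  exact: cintb_abs (fi _ b4).
- move=> n x; rewrite !cabsM !cabsR; have /andP[h1 h2] := HK _ x (aseq_ge1 R n).
  by rewrite !ger0_norm ?gauss3_ge0// mulrCA ler_wpM2l ?cabs_ge0.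
move=> _ h; have -> : (fun n => cint (leb3s R) (fun s => mollify f (aseq R n) s * (\1_(box p q) s)%:C)) =
    (fun n => cint (leb3s R) (fun x => f x * (avg3 (aseq R n) p q x)%:C)).
  by apply/funext => n; rewrite (mollify_box p q gf (aseq_gt0 R n)).2.
exact: h.
Qed.

(** Up to a constant, the integrals against Gaussians are the mollifications of [f], so these
    vanish; [cvg_mollify] carries this over to the integrals over boxes. *)
Lemma gauss_unique f : gtemp f ->
  (forall a y, 0 < a -> cint (leb3s R) (fun x => f x * (gauss3 a y x)%:C) = 0) ->
  {ae leb3s R, forall x, f x = 0}.
Proof.
move=> gf fz; apply: (box_unique gf.1) => p q; first exact: gtemp_ind.
apply: (ccvg_unique (cvg_mollify p q gf)).
rewrite (_ : (fun n => _) = fun=> 0); first exact: ccvg_cst.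
apply/funext => n; rewrite -[RHS](@cint0 _ _ R (leb3s R)); congr cint; apply/funext => s.
by rewrite /mollify fz ?aseq_gt0// mulr0 mul0r.
Qed.

End Convergence.

Section ParametricMeasurability.
Context d1 d2 (T1 : measurableType d1) (T2 : measurableType d2) (R : realType).
Variables (m2 : {sigma_finite_measure set T2 -> \bar R}).

Lemma measurable_Rint (f : T1 * T2 -> R) : measurable_fun setT f ->
  measurable_fun setT (fun x => \int[m2]_y f (x, y)).
Proof.
move=> mf; have mf' : measurable_fun setT (EFin \o f) by exact/measurable_EFinP.
apply: (@measurableT_comp _ _ _ _ _ _ fine) => //.
have -> : (fun x => \int[m2]_y (f (x, y))%:E)%E =
    (fun x => \int[m2]_y (EFin \o f)^\+ (x, y) - \int[m2]_y (EFin \o f)^\- (x, y))%E.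
  apply/funext => x; rewrite [LHS]integralE; congr (_ - _)%E.
    by apply: eq_integral => y _; rewrite -[RHS]/(((EFin \o f)^\+ \o (pair x)) y)%E -funepos_comp.
  by apply: eq_integral => y _; rewrite -[RHS]/(((EFin \o f)^\- \o (pair x)) y)%E -funeneg_comp.
apply: emeasurable_funB.
  apply: (measurable_fun_fubini_tonelli_F (m2 := m2) ((EFin \o f)^\+)%E) => //.
  exact: measurable_funepos.
apply: (measurable_fun_fubini_tonelli_F (m2 := m2) ((EFin \o f)^\-)%E) => //.
exact: measurable_funeneg.
Qed.

Lemma cmeas_cint (f : T1 * T2 -> R[i]) : cmeas f ->
  cmeas (fun x => cint m2 (fun y => f (x, y))).
Proof. by move=> [/measurable_Rint mr /measurable_Rint mi]; split. Qed.

End ParametricMeasurability.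

(** * Convolution integrals by measure-preserving shears *)

Section Young.
Variable R : realType.
Local Notation L3 := (leb3s R).
Local Notation L6 := (leb3s R \x leb3s R)%E.
Implicit Types (a k : R3 R -> R).

Definition sub3 (x y : R3 R) : R3 R := add3 x (opp3 y).

Lemma measurable_add3 : measurable_fun setT (fun z : R3 R * R3 R => add3 z.1 z.2).
Proof.
have m i : measurable_fun setT (fun z : R3 R * R3 R => coord z.1 i + coord z.2 i).
  apply: measurable_funD.
    exact: (measurableT_comp (measurable_coord i) measurable_fst).
  exact: (measurableT_comp (measurable_coord i) measurable_snd).
apply/measurable_fun_pair; last exact: (m (lift ord0 (lift ord0 ord0))).
by apply/measurable_fun_pair; [exact: (m ord0)|exact: (m (lift ord0 ord0))].
Qed.

Lemma measurable_opp3 : measurable_fun setT (@opp3 R).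
Proof. by have [] := mpres_opp3 R. Qed.

Lemma measurable_sub3 : measurable_fun setT (fun z : R3 R * R3 R => sub3 z.1 z.2).
Proof.
apply: (measurableT_comp measurable_add3 (f := fun z : R3 R * R3 R => add3 z.1 z.2)
  (g := fun z : R3 R * R3 R => (z.1, opp3 z.2))).
apply/measurable_fun_pair => //.
exact: (measurableT_comp measurable_opp3 measurable_snd).
Qed.

Lemma mpres_sub3 (x : R3 R) : mpres L3 (sub3 x).
Proof. exact: mpres_comp (mpres_add3 x) (mpres_opp3 R). Qed.

Lemma mpres_shear_sub : mpres L6 (fun z : R3 R * R3 R => (z.1, sub3 z.1 z.2)).
Proof. exact: mpres_shear measurable_sub3 mpres_sub3. Qed.

Lemma integrable_tensor6 a k : L3.-integrable setT (EFin \o a) -> L3.-integrable setT (EFin \o k) ->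
  L6.-integrable setT (EFin \o (fun z => a z.1 * k z.2)).
Proof. exact: rintegrable_tensor. Qed.

Lemma young_sub1 a k : L3.-integrable setT (EFin \o a) -> L3.-integrable setT (EFin \o k) ->
  L6.-integrable setT (EFin \o (fun z => a z.1 * k (sub3 z.1 z.2))).
Proof.
by move=> ia ik; have := integrable_mpres mpres_shear_sub (integrable_tensor6 ia ik).
Qed.

Lemma add3C (x y : R3 R) : add3 x y = add3 y x.
Proof. by rewrite /add3 /=; congr (_, _, _); rewrite addrC. Qed.
Lemma opp3K (x : R3 R) : opp3 (opp3 x) = x.
Proof. by case: x => [[? ?] ?]; rewrite /opp3 /= !opprK. Qed.
Lemma opp3_sub (x y : R3 R) : opp3 (sub3 x y) = sub3 y x.
Proof. by apply: coord_ext => i; rewrite /sub3 !(coord_opp3, coord_add3) opprD opprK addrC. Qed.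

(** Exchanging the variables in [young_sub1] replaces [x - y] by its opposite, whence the reflected
    kernel. *)
Lemma young_sub2 a k : L3.-integrable setT (EFin \o a) -> L3.-integrable setT (EFin \o k) ->
  L6.-integrable setT (EFin \o (fun z => a z.2 * k (sub3 z.1 z.2))).
Proof.
move=> ia ik; have ik' := integrable_mpres (mpres_opp3 R) ik.
have := integrable_mpres (mpres_swap L3) (young_sub1 (k := fun x => k (opp3 x)) ia ik').
by apply: eq_integrable => // z _ /=; rewrite opp3_sub.
Qed.

Lemma rfine_int d (T : measurableType d) (mu : {measure set T -> \bar R}) (h : T -> R) :
  mu.-integrable setT (EFin \o h) -> (\int[mu]_x (h x)%:E = (\int[mu]_x h x)%:E)%E.
Proof. by move=> ih; rewrite /Rintegral fineK//; exact: integrable_fin_num. Qed.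

Lemma rint_tensor6 a k : L3.-integrable setT (EFin \o a) -> L3.-integrable setT (EFin \o k) ->
  \int[L6]_z (a z.1 * k z.2) = (\int[L3]_x a x) * (\int[L3]_x k x).
Proof.
move=> ia ik.
have := cint_tensor (m1 := L3) (m2 := L3) (cintbR ia) (cintbR ik).
rewrite !cintR -rmorphM => /(congr1 (@Re R)) /= <-.
by apply: eq_Rintegral => z _ /=; rewrite !mulr0 subr0.
Qed.

Lemma int_young_sub1 a k : L3.-integrable setT (EFin \o a) -> L3.-integrable setT (EFin \o k) ->
  \int[L6]_z (a z.1 * k (sub3 z.1 z.2)) = (\int[L3]_x a x) * (\int[L3]_x k x).
Proof.
move=> ia ik; rewrite -rint_tensor6//; congr fine.
exact: (integral_mpres mpres_shear_sub (integrable_tensor6 ia ik)).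
Qed.

Lemma int_young_sub2 a k : L3.-integrable setT (EFin \o a) -> L3.-integrable setT (EFin \o k) ->
  \int[L6]_z (a z.2 * k (sub3 z.1 z.2)) = (\int[L3]_x a x) * (\int[L3]_x k x).
Proof.
move=> ia ik; have ik' := integrable_mpres (mpres_opp3 R) ik.
have := int_young_sub1 (k := fun x => k (opp3 x)) ia ik'.
have -> : \int[L3]_x k (opp3 x) = \int[L3]_x k x.
  by congr fine; exact: (integral_mpres (mpres_opp3 R) ik).
move=> <-; congr fine.
rewrite -[RHS](integral_mpres (mpres_swap L3) (young_sub1 (k := fun x => k (opp3 x)) ia ik')).
by apply: eq_integral => z _ /=; rewrite opp3_sub.
Qed.

End Young.

(** * Bessel's inequality and almost everywhere convergence of mollifications *)

Section Bessel.
Variable R : realType.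
Local Notation L3 := (leb3s R).
Local Notation L6 := (leb3s R \x leb3s R)%E.
Implicit Types (h : R3 R -> R[i]).

(** The inverse Fourier transform without its constant, which appears separately as [kap]. *)
Definition ift h (x : R3 R) : R[i] := cint L3 (fun xi => h xi * expi (dot x xi)).

Lemma measurable_dot2 : measurable_fun setT (fun z : R3 R * R3 R => dot z.1 z.2).
Proof.
apply: measurable_sum => i; apply: measurable_funM.
  exact: (measurableT_comp (measurable_coord i) measurable_fst).
exact: (measurableT_comp (measurable_coord i) measurable_snd).
Qed.

Lemma cmeas_ift h : cmeas h -> cmeas (ift h).
Proof.
move=> mh; apply: (@cmeas_cint _ _ _ _ _ L3 (fun z : R3 R * R3 R => h z.2 * expi (dot z.1 z.2))).
apply: cmeasM; first exact: (cmeas_comp mh measurable_snd).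
exact: cmeas_expi measurable_dot2.
Qed.

Lemma cintb_expi h x : cintb L3 h -> cintb L3 (fun xi => h xi * expi (dot x xi)).
Proof.
move=> ih; apply: (cintb_le _ (cintb_abs ih)).
  by apply: cmeasM; [exact: cintb_meas ih|apply: cmeas_expi; exact: measurable_dot].
by move=> xi; rewrite cabsM cabs_expi mulr1.
Qed.

Lemma integral_gauss3 (a : R) (c : R3 R) : 0 < a ->
  L3.-integrable setT (EFin \o gauss3 a c) /\ \int[L3]_x gauss3 a c x = Num.sqrt (pi / a) ^+ 3.
Proof.
move=> a0; have ig i := (integral_gauss (coord c i) a0).1.
have E : prod3 (fun i t => (gauss a (coord c i) t)%:C) = (fun x => (gauss3 a c x)%:C).
  by apply/funext => x; rewrite /prod3 -rmorph_prod.
have i3 := cintb_prod3 (fun i => cintbR (ig i)); rewrite E in i3.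
have e3 := cint_prod3 (fun i => cintbR (ig i)); rewrite E cintR in e3.
split; first by have [] := i3.
have := congr1 (@Re R) e3 => /= ->.
rewrite (eq_bigr (fun=> (Num.sqrt (pi / a))%:C)); last first.
  by move=> i _; rewrite cintR (integral_gauss (coord c i) a0).2.
by rewrite -rmorph_prod /= prodr_const card_ord.
Qed.

Lemma fourier_gauss3 (a : R) (c x : R3 R) : 0 < a ->
  ift (fun xi => (gauss3 a c xi)%:C) x =
  expi (dot x c) * (Num.sqrt (pi / a) ^+ 3 * gauss3 (4 * a)^-1 0 x)%:C.
Proof.
move=> a0; rewrite /ift.
transitivity (cint L3 (prod3 (fun i t => expi (coord x i * t) * (gauss a (coord c i) t)%:C))).
  congr cint; apply/funext => xi; rewrite prod3M mulrC expi_dot; congr (_ * _).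
  by rewrite /prod3 -rmorph_prod.
rewrite cint_prod3; last by move=> i; exact: cintb_gauss.
under eq_bigr do rewrite fourier_gauss//.
rewrite big_split /= -expi_sum; congr (_ * _).
rewrite -rmorph_prod; congr (_%:C); rewrite big_split /= prodr_const card_ord; congr (_ * _).
by apply: eq_bigr => i _; rewrite /gauss coord0 subr0 [in RHS]mulrC.
Qed.

(** Write [|ift h|^2] as a double integral of [h(xi) conj(h(eta))] and integrate in [x] first: the
    Gaussian weight becomes an explicit Gaussian in [xi - eta]. Bounding [|h(xi) h(eta)|] by half
    the sum of the squares leaves only the mass of that Gaussian. *)
Lemma bessel_gauss h (d : R) : 0 < d -> cintb L3 h ->
  L3.-integrable setT (EFin \o (fun x => cabs (h x) ^+ 2)) ->
  L3.-integrable setT (EFin \o (fun x => cabs (ift h x) ^+ 2 * gauss3 d 0 x)) /\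
  \int[L3]_x (cabs (ift h x) ^+ 2 * gauss3 d 0 x) <= (2 * pi) ^+ 3 * \int[L3]_x cabs (h x) ^+ 2.
Proof.
move=> d0 ih ih2; have mh := cintb_meas ih.
have [igd egd] := integral_gauss3 0 d0.
pose H (z : R3 R * R3 R) := h z.1 * (h z.2)^*.
have iH : cintb L6 H by exact: (@cintb_tensor _ _ _ _ _ L3 L3 h (fun y => (h y)^*) ih (cintbJ ih)).
have mH := cintb_meas iH.
pose k (z : (R3 R * R3 R) * R3 R) := H z.1 * (gauss3 d 0 z.2)%:C * expi (dot z.2 (sub3 z.1.1 z.1.2)).
have mk : cmeas k.
  apply: cmeasM; first apply: cmeasM.
  - exact: (cmeas_comp mH measurable_fst).
  - by apply: cmeasR; exact: (@measurable_gauss3 R _ _ d (fun=> 0) snd (measurable_cst _) measurable_snd).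
  - apply: cmeas_expi.
    apply: (measurableT_comp (f := fun z : R3 R * R3 R => dot z.1 z.2) measurable_dot2
      (g := fun z : (R3 R * R3 R) * R3 R => (z.2, sub3 z.1.1 z.1.2))).
    apply/measurable_fun_pair; first exact: measurable_snd.
    exact: (measurableT_comp (@measurable_sub3 R) measurable_fst).
pose m6 := prod_measure L3 L3.
have ik : cintb (m6 \x L3)%E k.
  apply: (cintb_le mk (k := fun z => cabs (H z.1) * gauss3 d 0 z.2)).
    apply: (rintegrable_tensor (m1 := m6) (m2 := L3) (a := fun z => cabs (H z)) (b := gauss3 d 0)) => //.
    exact: cintb_abs iH.
  move=> z; rewrite !cabsM cabs_expi mulr1 cabsR ger0_norm ?gauss3_ge0//.
have E2 x : cint m6 (fun z => k (z, x)) = ((cabs (ift h x) ^+ 2 * gauss3 d 0 x))%:C.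
  transitivity ((cabs (ift h x) ^+ 2)%:C * (gauss3 d 0 x)%:C); last by rewrite -rmorphM.
  have ix := cintb_expi x ih.
  have it := @cintb_tensor _ _ _ _ _ L3 L3 _ _ ix (cintbJ ix).
  rewrite cabs2E /ift -cintJ// -(@cint_tensor _ _ _ _ _ L3 L3 _ _ ix (cintbJ ix)).
  rewrite mulrC -cintZ//.
  congr cint; apply/funext => z; rewrite /k /H /= /sub3 dotDr dotNr expiD expiN conjcM.
  ring.
have E1 z : cint L3 (fun x => k (z, x)) = H z * (Num.sqrt (pi / d) ^+ 3 * gauss3 (4 * d)^-1 0 (sub3 z.1 z.2))%:C.
  rewrite /k /=; under eq_fun do rewrite -mulrA.
  rewrite cintZ; last first.
    apply: (cintb_le (k := gauss3 d 0)) => //.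
      apply: cmeasM; first by apply: cmeasR; exact: measurable_gauss3.
      by apply: cmeas_expi; under eq_fun do rewrite dotC; exact: measurable_dot.
    by move=> x; rewrite cabsM cabs_expi mulr1 cabsR ger0_norm ?gauss3_ge0.
  congr (_ * _); have := fourier_gauss3 0 (sub3 z.1 z.2) d0.
  rewrite (_ : dot _ 0 = 0) ?expi0 ?mul1r; last first.
    by rewrite /dot big1// => i _; rewrite coord0 mulr0.
  by move=> <-; rewrite /ift; congr cint; apply/funext => x; rewrite dotC.
have [F1 e1] := @cfubini1 _ _ _ _ _ m6 L3 _ ik.
have [F2 e2] := @cfubini2 _ _ _ _ _ m6 L3 _ ik.
have {}F2 : cintb L3 (fun x => ((cabs (ift h x) ^+ 2 * gauss3 d 0 x))%:C).
  by move: F2; rewrite (funext E2).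
split; first by have [] := F2.
have e3 : (\int[L3]_x (cabs (ift h x) ^+ 2 * gauss3 d 0 x))%:C =
    cint m6 (fun z => H z * (Num.sqrt (pi / d) ^+ 3 * gauss3 (4 * d)^-1 0 (sub3 z.1 z.2))%:C).
  by rewrite -cintR -(funext E2) -e2 e1 (funext E1).
have {}F1 : cintb m6 (fun z => H z * (Num.sqrt (pi / d) ^+ 3 * gauss3 (4 * d)^-1 0 (sub3 z.1 z.2))%:C).
  by move: F1; rewrite (funext E1).
set S := Num.sqrt (pi / d) ^+ 3 in e3 F1.
have S0 : 0 <= S by rewrite exprn_ge0 ?sqrtr_ge0.
have d4 : 0 < (4 * d)^-1 by rewrite invr_gt0 mulr_gt0.
have [ig4 eg4] := integral_gauss3 0 d4.
have y1 := young_sub1 ih2 ig4; have y2 := young_sub2 ih2 ig4.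
have iy : L6.-integrable setT (EFin \o (fun z => S / 2 * (cabs (h z.1) ^+ 2 * gauss3 (4 * d)^-1 0 (sub3 z.1 z.2) +
    cabs (h z.2) ^+ 2 * gauss3 (4 * d)^-1 0 (sub3 z.1 z.2)))).
  rewrite /comp; under eq_fun do rewrite EFinM EFinD; apply: integrableZl => //.
  exact: integrableD.
have -> : \int[L3]_x (cabs (ift h x) ^+ 2 * gauss3 d 0 x) =
    Re (cint m6 (fun z => H z * (S * gauss3 (4 * d)^-1 0 (sub3 z.1 z.2))%:C)) by rewrite -e3.
rewrite /cint /=; apply: le_trans.
  apply: (le_Rintegral _ F1.1 iy) => // z _.
  rewrite (le_trans (ler_norm _))// (le_trans (cabs_Re _))//.
  rewrite /H !cabsM cabsJ cabsR ger0_norm ?mulr_ge0 ?gauss3_ge0//.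
  rewrite -mulrDl mulrA [leRHS]mulrA ler_wpM2r ?gauss3_ge0// mulrC -mulrA ler_wpM2l//.
  by have := sqr_ge0 (cabs (h z.1) - cabs (h z.2)); rewrite sqrrB; lra.
rewrite RintegralZl//; last by rewrite /comp; under eq_fun do rewrite EFinD; exact: integrableD.
rewrite RintegralD// [X in _ * (X + _)](int_young_sub1 ih2 ig4) [X in _ * (_ + X)](int_young_sub2 ih2 ig4) eg4.
set I2 := \int[L3]_x cabs (h x) ^+ 2.
(* The masses multiply to [((pi / d) (4 pi d))^(3/2) = (2 pi)^3], in which [d] has disappeared. *)
rewrite [leLHS](_ : _ = (S * Num.sqrt (pi / (4 * d)^-1) ^+ 3) * I2); last by field.
rewrite /S -exprMn -sqrtrM; last by rewrite divr_ge0 ?pi_ge0// ltW.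
rewrite (_ : pi / d * _ = (2 * pi) ^+ 2); last first.
  by move: (pi : R) => P; field; rewrite (gt_eqF d0).
by rewrite sqrtr_sqr ger0_norm// mulr_ge0// pi_ge0.
Qed.

End Bessel.

(** * Almost everywhere convergence from geometric decay in [L^2] *)

Section FastConvergence.
Context d (T : measurableType d) (R : realType) (mu : {measure set T -> \bar R}).

Lemma fatou_bound (g_ : nat -> T -> R) (g : T -> R) (C : R) :
  (forall n, measurable_fun setT (g_ n)) -> (forall n x, 0 <= g_ n x) ->
  measurable_fun setT g -> {ae mu, forall x, g_ n x @[n --> \oo] --> g x} ->
  (forall n, \int[mu]_x (g_ n x)%:E <= C%:E)%E -> (forall x, 0 <= g x) ->
  mu.-integrable setT (EFin \o g) /\ \int[mu]_x g x <= C.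
Proof.
move=> mg_ g_0 mg cg gC g0.
have me n : measurable_fun setT (fun x => (g_ n x)%:E) by exact/measurable_EFinP.
have h : (\int[mu]_x (g x)%:E <= C%:E)%E.
  apply: (@le_trans _ _ (\int[mu]_x limn_einf (fun n => (g_ n x)%:E))%E).
    rewrite le_eqVlt; apply/orP; left; apply/eqP; apply: ae_eq_integral => //.
    - exact/measurable_EFinP.
    - rewrite (_ : (fun x => _) = (fun x => - limn_esup (fun n => - (g_ n x)%:E))%E).
        by apply: measurableT_comp => //; apply: measurable_fun_limn_esup => n; exact: measurableT_comp.
      by apply/funext => x; rewrite -limn_einfN; congr limn_einf; apply/funext => n /=; rewrite ?oppeK ?opprK.
    - apply: filterS cg => x cx _.
      have ce : (g_ n x)%:E @[n --> \oo] --> (g x)%:E by apply: cvg_EFin => //; exact: nearW.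
      by have [-> _] := cvg_limn_einf_sup ce.
  have f0e n x : setT x -> (0 <= (g_ n x)%:E)%E by move=> _; rewrite lee_fin.
  apply: (le_trans (fatou mu measurableT me f0e)).
  rewrite limn_einf_lim; apply: lime_le.
    exact: is_cvg_einfs.
  apply: nearW => n; apply: (le_trans _ (gC n)).
  by apply: ereal_inf_lbound; exists n => /=.
have ig : mu.-integrable setT (EFin \o g).
  apply/integrableP; split; first exact/measurable_EFinP.
  rewrite (eq_integral (EFin \o g)); last by move=> x _; rewrite gee0_abs// lee_fin.
  exact: (le_lt_trans h (ltry _)).
by split => //; rewrite -lee_fin -rfine_int.
Qed.

(** Cauchy-Schwarz with the weights [2^-n], whose sum is at most 2. *)
Lemma sqr_sum_le (a : nat -> R) N : (forall n, 0 <= a n) ->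
  (\sum_(n < N) a n) ^+ 2 <= 2 * \sum_(n < N) (2 ^+ n * a n ^+ 2).
Proof.
move=> a0.
have s0 M : 0 <= \sum_(n < M) a n by exact: sumr_ge0.
have t0 M : 0 <= \sum_(n < M) (2 ^+ n * a n ^+ 2).
  by apply: sumr_ge0 => i _; rewrite mulr_ge0 ?sqr_ge0// exprn_ge0.
(* The exact sum [2 - 2 / 2^N] of the weights, multiplied out; with the constant 2 the induction
   would not close. *)
suff : 2 ^+ N * (\sum_(n < N) a n) ^+ 2 <= (2 * 2 ^+ N - 2) * \sum_(n < N) (2 ^+ n * a n ^+ 2).
  move=> h; rewrite -(@ler_pM2l _ (2 ^+ N)) ?exprn_gt0//; apply: (le_trans h).
  rewrite mulrA ler_wpM2r//; lra.
elim: N => [|N IH]; first by rewrite !big_ord0 expr0n /= !mulr0.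
rewrite !big_ord_recr /= exprS.
have q1 : 1 <= 2 ^+ N :> R by rewrite exprn_ege1// ler1n.
move: IH (s0 N) (t0 N) (a0 N) q1.
move: (\sum_(i < N) a i) (\sum_(i < N) (2 ^+ i * a i ^+ 2)) (a N) (2 ^+ N : R) => s t b q IH s0' t0' b0 q1.
(* For [q = 1] nothing has been summed and the hypothesis reads [s^2 <= 0]. Otherwise the inequality
   may be multiplied by [q - 1 > 0], and its defect beyond the induction hypothesis is a square. *)
have [q1'|q1'] := eqVneq q 1.
  have s20 : s ^+ 2 <= 0.
    by move: IH; rewrite q1'; lra.
  have {}s0' : s = 0 by apply/eqP; rewrite -sqrf_eq0 eq_le s20 sqr_ge0.
  by rewrite s0' q1'; have := sqr_ge0 b; lra.
have q2 : 0 < q - 1 by rewrite subr_gt0 lt_neqAle eq_sym q1'.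
have k1 : 0 <= q * (s - 2 * (q - 1) * b) ^+ 2 by rewrite mulr_ge0 ?sqr_ge0//; lra.
rewrite -subr_ge0 -(pmulr_lge0 _ q2).
have -> : ((2 * (2 * q) - 2) * (t + q * b ^+ 2) - 2 * q * (s + b) ^+ 2) * (q - 1) =
  (2 * q - 1) * ((2 * q - 2) * t - q * s ^+ 2) + q * (s - 2 * (q - 1) * b) ^+ 2 by ring.
by rewrite addr_ge0// mulr_ge0//; lra.
Qed.

Lemma cvg_of_bounded_series (u : nat -> R) (K : R) :
  (forall N, \sum_(n < N) `|u n - u n.+1| <= K) -> cvgn u.
Proof.
move=> hK.
have c1 : cvgn (series (fun n => `|u n.+1 - u n|)).
  apply: nondecreasing_is_cvgn.
    by apply/nondecreasing_seqP => n; rewrite !seriesEord /= big_ord_recr /= lerDl.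
  exists K => _ [n _ <-] /=; rewrite seriesEord /=.
  by rewrite (le_trans _ (hK n))// ler_sum// => i _; rewrite distrC.
have c : cvgn (series (fun n => u n.+1 - u n)) by exact: normed_cvg.
have -> : u = (fun n => u 0%N + series (fun n => u n.+1 - u n) n).
  apply/funext => n; rewrite /series /= telescope_sumr//.
  by rewrite addrC subrK.
by apply: is_cvgD => //; exact: is_cvg_cst.
Qed.

(** Against the decay [4^-n], a factor [2^n] is affordable: [sum_n 2^n |f_n - f_(n+1)|^2] is
    integrable, hence finite almost everywhere. Where it is finite the increments are summable, and
    the same sum controls [|f_n|^2] for all [n]. *)
Lemma fast_cvg (f_ : nat -> T -> R[i]) (C : R) :
  (forall n, cmeas (f_ n)) ->
  (forall n, mu.-integrable setT (EFin \o (fun x => cabs (f_ n x - f_ n.+1 x) ^+ 2))) ->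
  (forall n, \int[mu]_x cabs (f_ n x - f_ n.+1 x) ^+ 2 <= C * (4 ^+ n)^-1) ->
  mu.-integrable setT (EFin \o (fun x => cabs (f_ 0%N x) ^+ 2)) ->
  exists v : T -> R[i], exists Psi : T -> R,
  [/\ cmeas v, mu.-integrable setT (EFin \o Psi),
    {ae mu, forall x, ccvg (f_ ^~ x) (v x)} &
    {ae mu, forall x, forall n, cabs (f_ n x) ^+ 2 <= Psi x}].
Proof.
move=> mf_ idf dfC if0.
pose w n x := 2 ^+ n * cabs (f_ n x - f_ n.+1 x) ^+ 2.
have w0 n x : 0 <= w n x by rewrite mulr_ge0 ?sqr_ge0// exprn_ge0.
have mw n : measurable_fun setT (fun x => (w n x)%:E).
  apply/measurable_EFinP; apply: measurable_funM => //; apply: measurable_funX.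
  exact: cmeas_cabs (cmeasB (mf_ n) (mf_ n.+1)).
pose t x := (\sum_(n <oo) (w n x)%:E)%E.
have mt : measurable_fun setT t.
  apply: ge0_emeasurable_sum => // n x _ _; first by rewrite lee_fin.
have it : mu.-integrable setT t.
  apply/integrableP; split => //.
  rewrite (eq_integral t); last first.
    by move=> x _; rewrite gee0_abs// nneseries_ge0// => n _ _; rewrite lee_fin.
  rewrite /t integral_nneseries//; last by move=> n x _; rewrite lee_fin.
  have C0 : 0 <= C.
    have := dfC 0%N; rewrite expr0 invr1 mulr1; apply: le_trans.
    by apply: Rintegral_ge0 => x _; rewrite sqr_ge0.
  have iw n : (\int[mu]_x (w n x)%:E <= (C * (2 ^+ n)^-1)%:E)%E.
    have -> : (\int[mu]_x (w n x)%:E = (2 ^+ n * \int[mu]_x cabs (f_ n x - f_ n.+1 x) ^+ 2)%:E)%E.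
      rewrite -RintegralZl// rfine_int// /comp; under eq_fun do rewrite EFinM.
      by apply: integrableZl => //; exact: idf.
    rewrite lee_fin (le_trans (ler_wpM2l _ (dfC n)))// ?exprn_ge0//.
    rewrite mulrCA ler_wpM2l// (_ : 4 = 2 * 2); last by ring.
    by rewrite exprMn invfM mulVKf// expf_neq0.
  apply: (@le_lt_trans _ _ (2 * C)%:E); last exact: ltry.
  apply: lime_le; first by apply: is_cvg_nneseries => n _ _; apply: integral_ge0 => x _; rewrite lee_fin.
  apply: nearW => n; apply: (@le_trans _ _ (\sum_(0 <= i < n) (C * (2 ^+ i)^-1)%:E)%E).
    by apply: lee_sum => i _; exact: iw.
  rewrite sumEFin lee_fin -mulr_sumr mulrC ler_wpM2r//.
  rewrite big_mkord.
  have : \sum_(i < n) (2 ^+ i)^-1 <= 2 - (2 ^+ n)^-1 * 2 :> R.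
    elim: n => [|n IH]; first by rewrite big_ord0 expr0 invr1 mul1r subrr.
    rewrite big_ord_recr /= (le_trans (lerD IH (lexx _)))// exprS invfM; lra.
  by move=> h; rewrite (le_trans h)// gerBl mulr_ge0// invr_ge0 exprn_ge0.
have aet := integrable_ae measurableT it.
pose D := [set x | (t x < +oo)%E].
have mD : measurable D.
  by rewrite -[X in measurable X]setTI; exact: emeasurable_fun_infty_o.
have t0 x : (0 <= t x)%E by apply: nneseries_ge0 => n _ _; rewrite lee_fin.
have bnd x : D x -> forall N, \sum_(n < N) w n x <= fine (t x).
  move=> Dx N; rewrite -lee_fin fineK; last by rewrite ge0_fin_numE.
  rewrite -sumEFin -(big_mkord xpredT (fun n => (w n x)%:E)).
  by apply: nneseries_lim_ge => n _ _; rewrite lee_fin.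
have bnd1 x : D x -> forall N, \sum_(n < N) cabs (f_ n x - f_ n.+1 x) <= 1 + fine (t x).
  move=> Dx N.
  (* The bound [y <= 2^-n / 2 + 2^n y^2] comes from completing the square; its first terms sum to at
     most 1. *)
  have h n : cabs (f_ n x - f_ n.+1 x) <= (2 ^+ n)^-1 / 2 + w n x.
    rewrite /w; have q0 : 0 < 2 ^+ n :> R by rewrite exprn_gt0.
    move: (2 ^+ n : R) q0 (cabs (f_ n x - _)) => q q0 y.
    rewrite -subr_ge0 -(pmulr_lge0 _ q0).
    have -> : (q^-1 / 2 + q * y ^+ 2 - y) * q = (q * y - 1 / 2) ^+ 2 + 1 / 4.
      by field; rewrite gt_eqF.
    by rewrite addr_ge0 ?sqr_ge0.
  apply: (@le_trans _ _ (\sum_(n < N) ((2 ^+ n)^-1 / 2 + w n x))); first by apply: ler_sum.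
  rewrite big_split /= lerD ?bnd// -mulr_suml.
  have : \sum_(i < N) (2 ^+ i)^-1 <= 2 - (2 ^+ N)^-1 * 2 :> R.
    elim: N => [|n IH]; first by rewrite big_ord0 expr0 invr1 mul1r subrr.
    rewrite big_ord_recr /= (le_trans (lerD IH (lexx _)))// exprS invfM; lra.
  have : 0 <= (2 ^+ N)^-1 :> R by rewrite invr_ge0 exprn_ge0.
  lra.
(* Set to 0 outside [D], the sequence converges everywhere, so its limit is measurable. *)
pose f' n x := f_ n x * (\1_D x)%:C.
have mf' n : cmeas (f' n) by apply: cmeasM => //; apply: cmeasR; exact: measurable_indic.
have cR x : cvgn (fun n => Re (f' n x)) /\ cvgn (fun n => Im (f' n x)).
  have [Dx|Dx] := pselect (D x).
    rewrite /f' indicE mem_set//.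
    split; apply: (@cvg_of_bounded_series _ (1 + fine (t x))) => N;
      rewrite (le_trans _ (bnd1 _ Dx N))// ler_sum// => i _; rewrite !mulr1 -?ReN -?ImN -?ReD -?ImD.
      exact: cabs_Re.
    exact: cabs_Im.
  by rewrite /f' indicE memNset//; split; under eq_fun do rewrite mulr0; exact: is_cvg_cst.
pose v x : R[i] := (limn (fun n => Re (f' n x))) +i* (limn (fun n => Im (f' n x))).
(* From [(a + s)^2 <= 2 a^2 + 2 s^2], with [s] the sum of the increments and [s^2] at most twice the
   weighted sum by [sqr_sum_le]. *)
exists v, (fun x => 2 * cabs (f_ 0%N x) ^+ 2 + 4 * fine (t x)); split.
- split.
    apply: (@measurable_fun_cvg _ _ _ _ (fun n x => Re (f' n x))) => [n|x _].
      exact: (mf' n).1.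
    exact: (cR x).1.
  apply: (@measurable_fun_cvg _ _ _ _ (fun n x => Im (f' n x))) => [n|x _].
    exact: (mf' n).2.
  exact: (cR x).2.
- rewrite /comp; under eq_fun do rewrite EFinD !EFinM.
  apply: integrableD => //; first by apply: integrableZl => //; exact: if0.
  apply: integrableZl => //; apply: (le_integrable measurableT _ _ it).
    by apply/measurable_EFinP; exact: measurableT_comp.
  by move=> x _ /=; case: (t x) => //=; rewrite normr0 leey.
- apply: filterS aet => x /(_ I) tx.
  have Dx : D x by rewrite /D /= -ge0_fin_numE.
  have E n : f_ n x = f' n x by rewrite /f' indicE mem_set// mulr1.
  split; under eq_fun do rewrite E; [exact: (cR x).1|exact: (cR x).2].
- apply: filterS aet => x /(_ I) tx n.
  have Dx : D x by rewrite /D /= -ge0_fin_numE.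
  have h : cabs (f_ n x) <= cabs (f_ 0%N x) + \sum_(k < n) cabs (f_ k x - f_ k.+1 x).
    elim: n => [|n IH]; first by rewrite big_ord0 addr0.
    rewrite big_ord_recr /= addrA (le_trans _ (lerD IH (lexx _)))//.
    apply: le_trans (cabsB _ _).
    by rewrite opprB addrC subrK.
  have h2 := sqr_sum_le n (fun k => cabs_ge0 (f_ k x - f_ k.+1 x)).
  have h3 := bnd _ Dx n.
  have : cabs (f_ n x) ^+ 2 <= (cabs (f_ 0%N x) + \sum_(k < n) cabs (f_ k x - f_ k.+1 x)) ^+ 2.
    rewrite ler_pXn2r ?nnegrE ?cabs_ge0// addr_ge0 ?cabs_ge0//.
    by apply: sumr_ge0 => i _; exact: cabs_ge0.
  move: h2 h3; rewrite /w.
  move: (\sum_(k < n) cabs (f_ k x - f_ k.+1 x)) (\sum_(k < n) (2 ^+ k * cabs (f_ k x - f_ k.+1 x) ^+ 2)) => s u h2 h3 /le_trans; apply.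
  by have := sqr_ge0 (cabs (f_ 0%N x) - s); rewrite sqrrB sqrrD; lra.
Qed.

End FastConvergence.

(** * Functions paired with a transform of finite [H^1] norm *)

Section Pairs.
Variable R : realType.
Local Notation L3 := (leb3s R).
Local Notation L6 := (leb3s R \x leb3s R)%E.
Implicit Types (f g h F G W : R3 R -> R[i]).

Lemma cvg_gauss3_1 (x : R3 R) (e : nat -> R) : e n @[n --> \oo] --> (0 : R) ->
  gauss3 (e n) 0 x @[n --> \oo] --> (1 : R).
Proof.
move=> he; under eq_fun do rewrite gauss3_0.
have -> : (1 : R) = expR (- (0 * enorm x ^+ 2)) by rewrite mul0r oppr0 expR0.
apply: continuous_cvg; first exact: continuous_expR.
by apply: cvgN; apply: cvgM => //; exact: cvg_cst.
Qed.

Lemma gauss3_le1 (a : R) (s x : R3 R) : 0 <= a -> gauss3 a s x <= 1.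
Proof. by move=> a0; apply: prodr_ile1 => i _; rewrite gauss_ge0 gauss_le1. Qed.

(** The bound of [bessel_gauss] does not depend on [d], so Fatou removes the weight as [d] tends to
    0. *)
Lemma bessel h : cintb L3 h ->
  L3.-integrable setT (EFin \o (fun x => cabs (h x) ^+ 2)) ->
  L3.-integrable setT (EFin \o (fun x => cabs (ift h x) ^+ 2)) /\
  \int[L3]_x (cabs (ift h x) ^+ 2) <= (2 * pi) ^+ 3 * \int[L3]_x cabs (h x) ^+ 2.
Proof.
move=> ih ih2.
have mi : measurable_fun setT (fun x => cabs (ift h x) ^+ 2).
  by apply: measurable_funX; apply: cmeas_cabs; apply: cmeas_ift; exact: cintb_meas ih.
apply: (@fatou_bound _ _ _ _ (fun n x => cabs (ift h x) ^+ 2 * gauss3 n.+1%:R^-1 0 x)) => //.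
- by move=> n; apply: measurable_funM => //; exact: measurable_gauss3.
- by move=> n x; rewrite mulr_ge0 ?sqr_ge0 ?gauss3_ge0.
- apply: aeW => x; rewrite -[X in _ --> X]mulr1; apply: cvgM; first exact: cvg_cst.
  exact: (cvg_gauss3_1 _ (@cvg_harmonic R)).
- move=> n; have n0 : 0 < n.+1%:R^-1 :> R by rewrite invr_gt0.
  by have [i1 i2] := bessel_gauss n0 ih ih2; rewrite rfine_int// lee_fin.
- by move=> x; rewrite sqr_ge0.
Qed.

Definition kap : R := ((2 * pi)^-1) ^+ 3.
Definition weight (x : R3 R) : R := 1 + enorm x ^+ 2.

(* [f] is in H^1 with Fourier transform [F]. The transform is only recorded through
   its action on modulated Gaussians, which suffices for all that follows. *)
Definition pair f F := [/\ gtemp f, cmeas F,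
  L3.-integrable setT (EFin \o (fun x => weight x * cabs (F x) ^+ 2)) &
  forall e x, 0 < e -> mollify f (4 * e)^-1 x =
    kap%:C * ift (fun xi => F xi * (gauss3 e 0 xi)%:C) x].

Lemma weight_ge1 x : 1 <= weight x. Proof. by rewrite lerDl sqr_ge0. Qed.
Lemma measurable_weight : measurable_fun setT weight.
Proof. by apply: measurable_funD => //; apply: measurable_funX; exact: measurable_enorm. Qed.

Definition sqint F := L3.-integrable setT (EFin \o (fun x => cabs (F x) ^+ 2)).

Definition wint F := cmeas F /\
  L3.-integrable setT (EFin \o (fun x => weight x * cabs (F x) ^+ 2)).

Lemma wint_sqint F : wint F -> sqint F.
Proof.
move=> [mF iF]; apply: (rintegrable_le _ iF).
  by apply: measurable_funX; exact: cmeas_cabs.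
move=> x; rewrite ger0_norm ?sqr_ge0// ler_peMl ?sqr_ge0//; exact: weight_ge1.
Qed.

Lemma pair_L2 f F : pair f F -> sqint F.
Proof. by move=> [_ mF iF _]; exact: wint_sqint. Qed.

Lemma integrable_gauss3_sqr (e : R) : 0 < e ->
  L3.-integrable setT (EFin \o (fun x => gauss3 e 0 x ^+ 2)).
Proof.
move=> e0; apply: (rintegrable_le _ (integral_gauss3 0 e0).1).
  by apply: measurable_funX; exact: measurable_gauss3.
move=> x; rewrite ger0_norm ?sqr_ge0// expr2 ler_piMl ?gauss3_ge0 ?gauss3_le1//; exact: ltW.
Qed.

Lemma cintb_mul2 (a b : R3 R -> R[i]) : cmeas a -> cmeas b ->
  L3.-integrable setT (EFin \o (fun x => cabs (a x) ^+ 2)) ->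
  L3.-integrable setT (EFin \o (fun x => cabs (b x) ^+ 2)) ->
  cintb L3 (fun x => a x * b x).
Proof.
move=> ma mb ia ib; apply: (cintb_le (k := fun x => cabs (a x) ^+ 2 + cabs (b x) ^+ 2)).
- exact: cmeasM.
- by rewrite /comp; under eq_fun do rewrite EFinD; exact: integrableD.
- move=> x; rewrite cabsM; have := sqr_ge0 (cabs (a x) - cabs (b x)).
  have := sqr_ge0 (cabs (a x)); have := sqr_ge0 (cabs (b x)); rewrite sqrrB; lra.
Qed.

Lemma pair_h f F (e : R) : pair f F -> 0 < e ->
  let h := fun xi => F xi * (gauss3 e 0 xi)%:C in
  cintb L3 h /\ L3.-integrable setT (EFin \o (fun x => cabs (h x) ^+ 2)).
Proof.
move=> pF e0 h; have iF := pair_L2 pF; have [_ mF _ _] := pF.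
have mg : cmeas (fun xi : R3 R => (gauss3 e 0 xi)%:C) by apply: cmeasR; exact: measurable_gauss3.
split.
  apply: cintb_mul2 => //.
  apply: (rintegrable_le _ (integrable_gauss3_sqr e0)).
    by apply: measurable_funX; exact: cmeas_cabs.
  by move=> x; rewrite ger0_norm ?sqr_ge0// cabsR ger0_norm ?gauss3_ge0.
apply: (rintegrable_le _ iF).
  by apply: measurable_funX; apply: cmeas_cabs; exact: cmeasM.
move=> x; rewrite ger0_norm ?sqr_ge0// /h cabsM cabsR ger0_norm ?gauss3_ge0//.
rewrite exprMn ler_piMr ?sqr_ge0// exprn_ile1// ?gauss3_ge0// gauss3_le1//; exact: ltW.
Qed.

(** The frequency parameter for which the relation in [pair] describes the mollification at scale
    [aseq R n], see [epsnE]. *)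
Definition epsn n : R := (4 * aseq R n)^-1.
Lemma epsn_gt0 n : 0 < epsn n.
Proof. by rewrite invr_gt0 mulr_gt0// aseq_gt0. Qed.
Lemma epsnE n : (4 * epsn n)^-1 = aseq R n.
Proof. by rewrite /epsn; field; rewrite gt_eqF// aseq_gt0. Qed.
Lemma cvg_epsn : epsn n @[n --> \oo] --> (0 : R).
Proof.
apply: (squeeze_cvgr _ (cvg_cst 0) (@cvg_harmonic R)); apply: nearW => n.
rewrite ltW ?epsn_gt0//= /epsn lef_pV2 ?posrE ?mulr_gt0 ?aseq_gt0 ?ltr0n//.
have := aseq_gen R n; have := aseq_ge1 R n; rewrite -natr1; lra.
Qed.

(** Both values lie between 0 and 1, so the square is at most their distance, which is at most
    [1 - exp (- y) <= y] with [y = e |x|^2]. The bound is linear in [|x|^2]: exactly what the [H^1]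
    weight absorbs. *)
Lemma gauss3_diff (e e' : R) (x : R3 R) : 0 <= e' <= e ->
  (gauss3 e 0 x - gauss3 e' 0 x) ^+ 2 <= e * enorm x ^+ 2.
Proof.
move=> /andP[e0 ee]; rewrite !gauss3_0; set q := enorm x ^+ 2.
have q0 : 0 <= q by exact: sqr_ge0.
have h1 : expR (- (e * q)) <= expR (- (e' * q)) by rewrite ler_expR lerN2 ler_wpM2r.
have h2 : expR (- (e' * q)) <= 1 by rewrite expR_le1 oppr_le0 mulr_ge0.
have h3 : 1 - e * q <= expR (- (e * q)) by exact: expR_ge1Dx.
have h4 : 0 < expR (- (e * q)) by exact: expR_gt0.
move: h1 h2 h3 h4.
move: (expR (- (e * q))) (expR (- (e' * q))) => a b h1 h2 h3 h4; move: (e * q) h3 => c h3.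
have h5 : (b - a) * (b - a) <= (b - a) * 1 by rewrite ler_wpM2l; lra.
have -> : (a - b) ^+ 2 = (b - a) * (b - a) by ring.
lra.
Qed.

(** Consecutive mollifications differ by the inverse transform of [F] times a difference of
    Gaussians; by [gauss3_diff] and [bessel] its [L^2] norm squared is of order [epsn n], that is
    [4^-n], and [fast_cvg] applies. *)
Lemma pair_cvg f F : pair f F -> exists2 Psi : R3 R -> R,
  L3.-integrable setT (EFin \o Psi) &
  {ae L3, forall x, ccvg (fun n => mollify f (aseq R n) x) (f x)} /\
  {ae L3, forall x, forall n, cabs (mollify f (aseq R n) x) ^+ 2 <= Psi x}.
Proof.
move=> pF; have [gf mF iF Hm] := pF.
pose h n xi := F xi * (gauss3 (epsn n) 0 xi)%:C.
have ih n : cintb L3 (h n) by have [] := pair_h pF (epsn_gt0 n).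
have ih2 n : L3.-integrable setT (EFin \o (fun x => cabs (h n x) ^+ 2)).
  by have [] := pair_h pF (epsn_gt0 n).
have fE n x : mollify f (aseq R n) x = kap%:C * ift (h n) x by rewrite -epsnE Hm// epsn_gt0.
have kap0 : 0 <= kap by rewrite exprn_ge0// invr_ge0 mulr_ge0// pi_ge0.
have mf n : cmeas (fun x => mollify f (aseq R n) x).
  rewrite (funext (fE n)); apply: cmeasM; first exact: cmeas_cst.
  by apply: cmeas_ift; exact: cintb_meas (ih n).
pose dh n xi := h n xi - h n.+1 xi.
have idh n : cintb L3 (dh n) by have := cintbD (ih n) (cintbN (ih n.+1)).
have dhb n x : cabs (dh n x) ^+ 2 <= epsn n * (weight x * cabs (F x) ^+ 2).
  rewrite /dh /h -mulrBr -rmorphB cabsM cabsR exprMn real_normK ?num_real//.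
  rewrite mulrA mulrC ler_wpM2r ?sqr_ge0//.
  apply: (@le_trans _ _ (epsn n * enorm x ^+ 2)); last first.
    by rewrite ler_wpM2l ?(ltW (epsn_gt0 n))// /weight lerDr.
  apply: gauss3_diff; rewrite (ltW (epsn_gt0 _))/= /epsn lef_pV2 ?posrE ?mulr_gt0 ?aseq_gt0//.
  by rewrite ler_pM2l// /aseq ler_eXn2l// ltr1n.
have idh2 n : L3.-integrable setT (EFin \o (fun x => cabs (dh n x) ^+ 2)).
  apply: (rintegrable_le (k := fun x => epsn n * (weight x * cabs (F x) ^+ 2))).
  - by apply: measurable_funX; apply: cmeas_cabs; exact: cintb_meas (idh n).
  - by rewrite /comp; under eq_fun do rewrite EFinM; apply: integrableZl.
  - by move=> x; rewrite ger0_norm ?sqr_ge0.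
have dE n x : mollify f (aseq R n) x - mollify f (aseq R n.+1) x = kap%:C * ift (dh n) x.
  rewrite !fE -mulrBr /ift -cintB; [|exact: cintb_expi..].
  by congr (_ * cint _ _); apply/funext => xi; rewrite /dh mulrBl.
have zE (z : R[i]) : cabs (kap%:C * z) ^+ 2 = kap ^+ 2 * cabs z ^+ 2.
  by rewrite cabsM cabsR exprMn real_normK ?num_real.
set I := \int[L3]_x (weight x * cabs (F x) ^+ 2).
have [|n|n||v [Psi [mv iPsi cv bPsi]]] := @fast_cvg _ _ R L3 (fun n x => mollify f (aseq R n) x) (kap ^+ 2 * (2 * pi) ^+ 3 * I / 4).
- exact: mf.
- rewrite /comp; under eq_fun do rewrite dE zE EFinM; apply: integrableZl => //.
  by have [] := bessel (idh n) (idh2 n).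
- have [i1 i2] := bessel (idh n) (idh2 n).
  under eq_Rintegral do rewrite dE zE.
  rewrite RintegralZl//.
  have -> : kap ^+ 2 * (2 * pi) ^+ 3 * I / 4 * (4 ^+ n)^-1 = kap ^+ 2 * ((2 * pi) ^+ 3 * (epsn n * I)).
    rewrite /epsn invfM /aseq; field; rewrite gt_eqF// exprn_gt0//.
  apply: ler_wpM2l; first exact: sqr_ge0.
  apply: (le_trans i2); apply: ler_wpM2l; first by rewrite exprn_ge0// mulr_ge0// pi_ge0.
  rewrite -RintegralZl//; apply: le_Rintegral => //.
    by rewrite /comp; under eq_fun do rewrite EFinM; apply: integrableZl.
- rewrite /comp; under eq_fun do rewrite fE zE EFinM; apply: integrableZl => //.
  by have [] := bessel (ih 0%N) (ih2 0%N).
exists Psi => //; split => //.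
(* The pointwise limit [v] is identified with [f] by comparing integrals over boxes, where the
   mollifications also converge weakly to [f]. *)
suff fv : {ae L3, forall x, f x - v x = 0}.
  by apply: filterS2 fv cv => x /eqP; rewrite subr_eq0 => /eqP ->.
have mf0 : cmeas f by case: gf.
have key p q : cintb L3 (fun x => v x * (\1_(box p q) x)%:C) /\
    ccvg (fun n => cint L3 (fun x => mollify f (aseq R n) x * (\1_(box p q) x)%:C)) (cint L3 (fun x => v x * (\1_(box p q) x)%:C)).
  have mB : cmeas (fun x : R3 R => (\1_(box p q) x : R)%:C).
    by apply: cmeasR; exact: measurable_indic (measurable_box p q).
  (* Only the squares are dominated by [Psi]; on a box of finite measure [b <= 1 + b^2] is
     enough. *)
  apply: (@cint_dominated_ae _ _ _ L3 (fun n x => mollify f (aseq R n) x * (\1_(box p q) x)%:C) _ (fun x => \1_(box p q) x + `|Psi x|)).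
  - by move=> n; apply: cmeasM.
  - exact: cmeasM.
  - by apply: filterS cv => x cx; apply: ccvgM => //; exact: ccvg_cst.
  - rewrite /comp; under eq_fun do rewrite EFinD; apply: integrableD => //.
      exact: integrable_ind_box.
    exact: integrable_norm.
  - apply: filterS bPsi => x bx n; rewrite cabsM cabsR indicE.
    have h1 := bx n; have h2 := ler_norm (Psi x); move: (normr_ge0 (Psi x)) h1 h2.
    move: (cabs (mollify f (aseq R n) x)) `|Psi x| => b P hP h1 h2.
    have := sqr_ge0 (b - 1); have -> : (b - 1) ^+ 2 = b ^+ 2 - 2 * b + 1 by ring.
    by case: (x \in _) => /=; rewrite ?mulr1n ?mulr0n ?normr1 ?normr0 ?mulr1 ?mulr0; lra.
apply: box_unique; first exact: cmeasB.
  move=> p q; under eq_fun do rewrite mulrBl.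
  by have := cintbD (gtemp_ind p q gf) (cintbN (key p q).1).
move=> p q; under eq_fun do rewrite mulrBl.
rewrite cintB//; [|exact: gtemp_ind|exact: (key p q).1].
by rewrite (ccvg_unique (cvg_mollify p q gf) (key p q).2) subrr.
Qed.

End Pairs.

(** * Plancherel's formula for products *)

Section Plancherel.
Variable R : realType.
Local Notation L3 := (leb3s R).
Local Notation L6 := (leb3s R \x leb3s R)%E.
Implicit Types (f g h F G W psi : R3 R -> R[i]).

(** Gaussian decay gives integrability, boundedness and square integrability at once; the formulas
    below ask it of both [psi] and [ift psi]. *)
Definition gdom psi := cmeas psi /\
  exists K b : R, [/\ 0 < b, 0 <= K & forall x, cabs (psi x) <= K * gauss3 b 0 x].

Lemma integrable_scale (c : R) (k : R3 R -> R) : L3.-integrable setT (EFin \o k) ->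
  L3.-integrable setT (EFin \o (fun x => c * k x)).
Proof. by move=> ik; rewrite /comp; under eq_fun do rewrite EFinM; exact: integrableZl. Qed.

Lemma gdom_cintb psi : gdom psi -> cintb L3 psi.
Proof.
move=> [mp [K [b [b0 K0 bp]]]]; apply: cintb_le bp => //.
by apply: integrable_scale; have [] := integral_gauss3 0 b0.
Qed.

Lemma gdom_bounded psi : gdom psi -> exists2 K : R, 0 <= K & forall x, cabs (psi x) <= K.
Proof.
move=> [mp [K [b [b0 K0 bp]]]]; exists K => // x; apply: (le_trans (bp x)).
by rewrite ler_piMr// gauss3_le1// ltW.
Qed.

Lemma gdom_sqint psi : gdom psi -> sqint psi.
Proof.
move=> gp; have [K K0 bK] := gdom_bounded gp.
apply: (rintegrable_le _ (integrable_scale K (cintb_abs (gdom_cintb gp)))).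
  by apply: measurable_funX; apply: cmeas_cabs; case: gp.
by move=> x; rewrite ger0_norm ?sqr_ge0// expr2 ler_wpM2r ?cabs_ge0.
Qed.

(** Fubini and the symmetry of the kernel [expi (dot x y)]. *)
Lemma ift_dual (a b : R3 R -> R[i]) : cintb L3 a -> cintb L3 b ->
  [/\ cintb L3 (fun x => ift a x * b x), cintb L3 (fun y => a y * ift b y) &
   cint L3 (fun x => ift a x * b x) = cint L3 (fun y => a y * ift b y)].
Proof.
move=> ia ib.
have J : cintb L6 (fun z => b z.1 * a z.2 * expi (dot z.1 z.2)).
  have i6 := @cintb_tensor _ _ _ _ _ L3 L3 _ _ ib ia.
  apply: (cintb_le _ (cintb_abs i6)).
    apply: cmeasM; [exact: cintb_meas i6|apply: cmeas_expi; exact: measurable_dot2].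
  by move=> z; rewrite cabsM cabs_expi mulr1.
have E1 : (fun x => cint L3 (fun y => b x * a y * expi (dot x y))) = (fun x => ift a x * b x).
  apply/funext => x; rewrite /ift mulrC -cintZ; last exact: cintb_expi.
  by congr cint; apply/funext => y; rewrite mulrA.
have E2 : (fun y => cint L3 (fun x => b x * a y * expi (dot x y))) = (fun y => a y * ift b y).
  apply/funext => y; rewrite /ift -cintZ; last exact: cintb_expi.
  by congr cint; apply/funext => x; rewrite dotC mulrCA mulrA.
have [i1 _] := cfubini1 J; have [i2 _] := cfubini2 J; have := cfubini J.
by move: i1 i2; rewrite /= E1 E2.
Qed.

(** For the mollifications this is [ift_dual]. In the limit, [Psi] dominates on the side of [f], and
    [|F * ift psi|] on the side of [F]. *)
Lemma pair_linear f F psi : pair f F -> gdom psi -> gdom (ift psi) ->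
  cintb L3 (fun x => F x * ift psi x) /\
  cint L3 (fun x => f x * psi x) = (kap R)%:C * cint L3 (fun x => F x * ift psi x).
Proof.
move=> pF gp gW; have [gf mF _ Hm] := pF.
have [Psi iPsi [cv bd]] := pair_cvg pF.
pose h n xi := F xi * (gauss3 (epsn R n) 0 xi)%:C.
have ih n : cintb L3 (h n) by have [] := pair_h pF (epsn_gt0 R n).
have fE n x : mollify f (aseq R n) x = (kap R)%:C * ift (h n) x.
  by rewrite -epsnE Hm// epsn_gt0.
have mp : cmeas psi by case: gp.
have mW : cmeas (ift psi) by case: gW.
have mg n : cmeas (fun x : R3 R => (gauss3 (epsn R n) 0 x)%:C).
  by apply: cmeasR; exact: measurable_gauss3.
have [_ c1] : cintb L3 (fun x => f x * psi x) /\
    ccvg (fun n => cint L3 (fun x => mollify f (aseq R n) x * psi x)) (cint L3 (fun x => f x * psi x)).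
  apply: (@cint_dominated_ae _ _ _ L3 (fun n x => mollify f (aseq R n) x * psi x) _
    (fun x => Psi x + cabs (psi x) ^+ 2)).
  - move=> n; under eq_fun do rewrite fE; apply: cmeasM => //; apply: cmeasM.
      exact: cmeas_cst.
    by apply: cmeas_ift; exact: cintb_meas (ih n).
  - by apply: cmeasM => //; case: gf.
  - by apply: filterS cv => x cx; apply: ccvgM => //; exact: ccvg_cst.
  - by rewrite /comp; under eq_fun do rewrite EFinD; apply: integrableD => //; exact: gdom_sqint.
  - apply: filterS bd => x bx n; rewrite cabsM; apply: le_trans (lerD (bx n) (lexx _)).
    set a := cabs _; set b := cabs _; have := sqr_ge0 (a - b).
    have := sqr_ge0 a; have := sqr_ge0 b; rewrite sqrrB; lra.
have [i2 c2] : cintb L3 (fun x => F x * ift psi x) /\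
    ccvg (fun n => cint L3 (fun x => h n x * ift psi x)) (cint L3 (fun x => F x * ift psi x)).
  apply: (@cint_dominated _ _ _ L3 (fun n x => h n x * ift psi x) _
    (fun x => cabs (F x * ift psi x))).
  - by move=> n; apply: cmeasM => //; exact: cmeasM.
  - exact: cmeasM.
  - apply: aeW => x; apply: ccvgM; last exact: ccvg_cst.
    rewrite -[X in ccvg _ X]mulr1; apply: ccvgM; first exact: ccvg_cst.
    by apply: ccvgR; apply: cvg_gauss3_1; exact: cvg_epsn.
  - apply: cintb_abs; apply: cintb_mul2 => //; first exact: pair_L2 pF.
    exact: gdom_sqint.
  - move=> n x; rewrite /h !cabsM cabsR ler_wpM2r ?cabs_ge0// ler_piMr ?cabs_ge0//.
    by rewrite ger0_norm ?gauss3_ge0// gauss3_le1// ltW// epsn_gt0.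
split => //; apply: (ccvg_unique c1).
have -> : (fun n => cint L3 (fun x => mollify f (aseq R n) x * psi x)) =
    (fun n => (kap R)%:C * cint L3 (fun x => h n x * ift psi x)).
  apply/funext => n; have [i3 _ <-] := ift_dual (ih n) (gdom_cintb gp).
  by under eq_fun do rewrite fE -mulrA; rewrite cintZ.
by apply: ccvgM => //; exact: ccvg_cst.
Qed.

Definition conv F G (x : R3 R) : R[i] := cint L3 (fun y => F (sub3 x y) * G y).

Lemma cintb_conv F G x : cmeas F -> cmeas G -> sqint F -> sqint G ->
  cintb L3 (fun y => F (sub3 x y) * G y).
Proof.
move=> mF mG iF iG; apply: cintb_mul2 => //.
  exact: (cmeas_comp mF (mpres_sub3 x).1).
exact: (integrable_mpres (mpres_sub3 x) iF).
Qed.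

Lemma conv_joint F G W : cmeas F -> cmeas G -> cintb L3 W -> sqint F -> sqint G ->
  cintb L6 (fun z => F (sub3 z.1 z.2) * G z.2 * W z.1).
Proof.
move=> mF mG iW iF iG; have iW' := cintb_abs iW.
apply: (cintb_le (k := fun z => cabs (W z.1) * cabs (F (sub3 z.1 z.2)) ^+ 2 + cabs (W z.1) * cabs (G z.2) ^+ 2)).
- apply: cmeasM; last exact: (cmeas_comp (cintb_meas iW) measurable_fst).
  apply: cmeasM; first exact: (cmeas_comp mF (@measurable_sub3 R)).
  exact: (cmeas_comp mG measurable_snd).
- rewrite /comp; under eq_fun do rewrite EFinD; apply: integrableD => //.
    exact: (young_sub1 iW' iF).
  exact: (integrable_tensor6 iW' iG).
- move=> z; rewrite !cabsM -mulrDr mulrC ler_wpM2l ?cabs_ge0//.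
  set a := cabs _; set b := cabs _; have := sqr_ge0 (a - b).
  have := sqr_ge0 a; have := sqr_ge0 b; rewrite sqrrB; lra.
Qed.

(** For fixed [y], substitute [x - y] for [x]; the double integral on the right is the convolution
    of [h] and [k] paired with [W]. *)
Lemma conv_dual h k W : cintb L3 h -> cintb L3 k -> cmeas W ->
  (exists K : R, forall x, cabs (W x) <= K) -> sqint h -> sqint k -> cintb L3 W ->
  cint L3 (fun y => k y * cint L3 (fun x => h x * W (add3 y x))) =
  cint L6 (fun z => h (sub3 z.1 z.2) * k z.2 * W z.1).
Proof.
move=> ih ik mW [K bK] h2 k2 iW.
have J := conv_joint (cintb_meas ih) (cintb_meas ik) iW h2 k2.
rewrite (cfubini2 J).2 /=; congr cint; apply/funext => y.
have iy : cintb L3 (fun x => h x * W (add3 y x)).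
  apply: (cintb_le _ (integrable_scale K (cintb_abs ih))).
    apply: cmeasM; first exact: cintb_meas ih.
    exact: (cmeas_comp mW (mpres_add3 y).1).
  by move=> x; rewrite cabsM mulrC ler_wpM2r ?cabs_ge0.
rewrite -(cint_mpres (mpres_add3 (opp3 y)) iy) -cintZ; last exact: (cintb_mpres (mpres_add3 (opp3 y)) iy).
congr cint; apply/funext => x.
have -> : add3 (opp3 y) x = sub3 x y by rewrite add3C.
have -> : add3 y (sub3 x y) = x.
  by clear iy; case: x y => [[? ?] ?] [[? ?] ?]; rewrite /sub3 /add3 /opp3 /= !(addrC _ (- _)) !addNKr.
by rewrite mulrA [k y * _]mulrC.
Qed.

(** The convolution theorem, first for mollifications and then in the limit: the product is
    dominated by [Psi + Phi], the majorants of the two squares, and the double integral by its own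
    limit in modulus. Each factor contributes one [kap]. *)
Lemma pair_product f g F G psi : pair f F -> pair g G -> gdom psi -> gdom (ift psi) ->
  [/\ cintb L3 (fun x => f x * g x * psi x), cintb L3 (fun x => conv F G x * ift psi x) &
  cint L3 (fun x => f x * g x * psi x) =
    ((kap R) ^+ 2)%:C * cint L3 (fun x => conv F G x * ift psi x)].
Proof.
move=> pF pG gp gW; set W := ift psi.
have iF := pair_L2 pF; have iG := pair_L2 pG.
have [gf mF _ Hf] := pF; have [gg mG _ Hg] := pG.
have [Psi iPsi [cf bf]] := pair_cvg pF; have [Phi iPhi [cg bg]] := pair_cvg pG.
pose h n xi := F xi * (gauss3 (epsn R n) 0 xi)%:C.
pose k n xi := G xi * (gauss3 (epsn R n) 0 xi)%:C.
have hP n : cintb L3 (h n) /\ sqint (h n) by have [] := pair_h pF (epsn_gt0 R n).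
have kP n : cintb L3 (k n) /\ sqint (k n) by have [] := pair_h pG (epsn_gt0 R n).
have fE n x : mollify f (aseq R n) x = (kap R)%:C * ift (h n) x.
  by rewrite -epsnE Hf// epsn_gt0.
have gE n x : mollify g (aseq R n) x = (kap R)%:C * ift (k n) x.
  by rewrite -epsnE Hg// epsn_gt0.
have mp : cmeas psi by case: gp.
have mW : cmeas W by case: gW.
have iW := gdom_cintb gW.
have [Kp Kp0 bp] := gdom_bounded gp; have [KW KW0 bW] := gdom_bounded gW.
have mmf n : cmeas (fun x => mollify f (aseq R n) x).
  under eq_fun do rewrite fE; apply: cmeasM; first exact: cmeas_cst.
  by apply: cmeas_ift; exact: cintb_meas (hP n).1.
have mmg n : cmeas (fun x => mollify g (aseq R n) x).
  under eq_fun do rewrite gE; apply: cmeasM; first exact: cmeas_cst.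
  by apply: cmeas_ift; exact: cintb_meas (kP n).1.
have mg n : cmeas (fun x : R3 R => (gauss3 (epsn R n) 0 x)%:C).
  by apply: cmeasR; exact: measurable_gauss3.
have J := conv_joint mF mG iW iF iG.
have [i1 c1] : cintb L3 (fun x => f x * g x * psi x) /\
    ccvg (fun n => cint L3 (fun x => mollify f (aseq R n) x * mollify g (aseq R n) x * psi x))
     (cint L3 (fun x => f x * g x * psi x)).
  apply: (@cint_dominated_ae _ _ _ L3 (fun n x => mollify f (aseq R n) x * mollify g (aseq R n) x * psi x) _
    (fun x => Kp * (Psi x + Phi x))).
  - by move=> n; apply: cmeasM => //; apply: cmeasM.
  - by apply: cmeasM => //; apply: cmeasM => //; [case: gf|case: gg].
  - by apply: filterS2 cf cg => x cx dx; apply: ccvgM; [exact: ccvgM|exact: ccvg_cst].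
  - apply: integrable_scale; rewrite /comp; under eq_fun do rewrite EFinD.
    exact: integrableD.
  - apply: filterS2 bf bg => x bx b'x n; rewrite cabsM mulrC.
    apply: ler_pM; rewrite ?cabs_ge0// cabsM; apply: le_trans (lerD (bx n) (b'x n)).
    set a := cabs _; set b := cabs _; have := sqr_ge0 (a - b).
    have := sqr_ge0 a; have := sqr_ge0 b; rewrite sqrrB; lra.
have [i2 c2] : cintb L6 (fun z => F (sub3 z.1 z.2) * G z.2 * W z.1) /\
    ccvg (fun n => cint L6 (fun z => h n (sub3 z.1 z.2) * k n z.2 * W z.1))
      (cint L6 (fun z => F (sub3 z.1 z.2) * G z.2 * W z.1)).
  apply: (@cint_dominated _ _ _ L6 (fun n z => h n (sub3 z.1 z.2) * k n z.2 * W z.1) _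
    (fun z => cabs (F (sub3 z.1 z.2) * G z.2 * W z.1))).
  - by move=> n; apply: cintb_meas (conv_joint (cintb_meas (hP n).1) (cintb_meas (kP n).1) iW (hP n).2 (kP n).2).
  - exact: cintb_meas J.
  - apply: aeW => z; apply: ccvgM; last exact: ccvg_cst.
    rewrite /h /k; apply: ccvgM.
      rewrite -[X in ccvg _ X]mulr1; apply: ccvgM; first exact: ccvg_cst.
      by apply: ccvgR; apply: cvg_gauss3_1; exact: cvg_epsn.
    rewrite -[X in ccvg _ X]mulr1; apply: ccvgM; first exact: ccvg_cst.
    by apply: ccvgR; apply: cvg_gauss3_1; exact: cvg_epsn.
  - exact: cintb_abs.
  - move=> n z; rewrite !cabsM ler_wpM2r ?cabs_ge0// !cabsR.
    have e0 := ltW (epsn_gt0 R n).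
    by rewrite ler_pM ?mulr_ge0 ?cabs_ge0// ler_piMr ?cabs_ge0// ger0_norm ?gauss3_ge0 ?gauss3_le1.
have E0 : (fun x => cint L3 (fun y => F (sub3 x y) * G y * W x)) = (fun x => conv F G x * W x).
  apply/funext => x; under eq_fun do rewrite mulrC; rewrite cintZ 1?mulrC//.
  exact: cintb_conv.
have [i3 E2] := cfubini1 J; rewrite /= E0 in i3 E2.
split => //; rewrite -E2; apply: (ccvg_unique c1).
have -> : (fun n => cint L3 (fun x => mollify f (aseq R n) x * mollify g (aseq R n) x * psi x)) =
    (fun n => (kap R ^+ 2)%:C * cint L6 (fun z => h n (sub3 z.1 z.2) * k n z.2 * W z.1)).
  apply/funext => n.
  have [i4 i5 _] := ift_dual (hP n).1 (gdom_cintb gp).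
  have [i6 i7 E7] := ift_dual (kP n).1 i4.
  rewrite -(conv_dual (hP n).1 (kP n).1)//; [|by exists KW|exact: (hP n).2|exact: (kP n).2].
  (* Duality is applied twice: it moves the transform of [k n] onto [ift (h n) * psi], then that of
     [h n] onto the modulated [psi], whose transform is a translate of [W]. *)
  transitivity ((kap R ^+ 2)%:C * cint L3 (fun x => ift (k n) x * (ift (h n) x * psi x))).
    rewrite -cintZ//; congr cint; apply/funext => x; rewrite fE gE.
    move: (kap R) => kp; rewrite rmorphXn.
    have H (c a b p : R[i]) : c * a * (c * b) * p = c ^+ 2 * (b * (a * p)) by ring.
    exact: H.
  rewrite E7; congr (_ * cint _ _); apply/funext => y; congr (_ * _).
  have ie : cintb L3 (fun x => psi x * expi (dot y x)) by apply: cintb_expi; exact: gdom_cintb.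
  have [_ _ E8] := ift_dual (hP n).1 ie.
  transitivity (cint L3 (fun x => ift (h n) x * (psi x * expi (dot y x)))).
    by rewrite {1}/ift; congr cint; apply/funext => x; rewrite mulrA.
  rewrite E8.
  congr cint; apply/funext => x; congr (_ * _); rewrite /W /ift.
  by congr cint; apply/funext => t; rewrite dotDl expiD mulrA.
by apply: ccvgM => //; exact: ccvg_cst.
Qed.

End Plancherel.

(** * From the tested system to symbols *)

Section Symbols.
Variable R : realType.
Local Notation L3 := (leb3s R).
Implicit Types (J : 'I_3 -> nat -> R -> R[i]) (x z c : R3 R) (s : seq 'I_3).

Lemma fourier_jet (J : nat -> R -> R[i]) (b x : R) n : 0 < b -> jet J ->
  jbound J (gauss b 0) -> cint (@leb R) (fun t => expi (x * t) * J n t) =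
  (- ('i * x%:C)) ^+ n * cint (@leb R) (fun t => expi (x * t) * J 0%N t).
Proof.
move=> b0 jJ bJ; elim: n => [|n IH]; first by rewrite expr0 mul1r.
have [C C0 HC] := bJ n; have [D D0 HD] := bJ n.+1.
rewrite (@fourier_der _ b x (J n) (J n.+1) (J n.+2) (C + D))//.
- by rewrite IH exprS mulrA.
- by move=> t; apply: (le_trans (HC t)); rewrite ler_wpM2r ?gauss_ge0// lerDl.
- by move=> t; apply: (le_trans (HD t)); rewrite ler_wpM2r ?gauss_ge0// lerDr.
Qed.

(** The kernel of [ift] is [exp (+ i x.z)], so integration by parts gives a factor [- i z_j] for
    each derivative. *)
Definition symbol s z : R[i] := \prod_(j <- s) - ('i * (coord z j)%:C).

Lemma symbol_count s z :
  symbol s z = \prod_(i < 3) (- ('i * (coord z i)%:C)) ^+ (count_mem i s + 0).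
Proof.
rewrite /symbol; elim: s => [|j s IH].
  by rewrite big_nil big1.
rewrite big_cons IH [in RHS](bigD1 j)//= [in LHS](bigD1 j)//= eqxx mulrA -exprS.
congr (_ * _); apply: eq_bigr => i ij.
by rewrite eq_sym (negbTE ij).
Qed.

Lemma ift_tens J (b : R) s z : 0 < b -> (forall i, jet (J i)) ->
  (forall i, jbound (J i) (gauss b 0)) ->
  ift (tens J (fun i => count_mem i s + 0)%N) z = symbol s z * ift (tens J (fun=> 0%N)) z.
Proof.
move=> b0 jJ bJ.
have E m : ift (tens J m) z = \prod_(i < 3) cint (@leb R) (fun t => expi (coord z i * t) * J i (m i) t).
  rewrite -cint_prod3.
    rewrite /ift; congr cint; apply/funext => x.
    by rewrite prod3M mulrC expi_dot.
  move=> i; have [C C0 HC] := bJ i (m i).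
  apply: (cintb_le (k := fun t => C * gauss b 0 t)).
  - apply: cmeasM; last exact: cder_cmeas (jJ i (m i)).
    by apply: cmeas_expi; apply: measurable_funM.
  - rewrite /comp; under eq_fun do rewrite EFinM; apply: integrableZl => //.
    by have [] := integral_gauss 0 b0.
  - by move=> t; rewrite cabsM cabs_expi mul1r.
rewrite !E symbol_count -big_split /=; apply: eq_bigr => i _.
exact: (fourier_jet _ _ b0).
Qed.

(* Derivatives of [exp (- d |x|^2) exp (- i c.x)], whose Fourier transforms are,
   as [c] and [d] vary, all the Gaussians. *)
Definition base (d : R) c (i : 'I_3) n : R -> R[i] :=
  jmul n (gauss_jet d 0) (mod_jet (- coord c i)).

Lemma jet_base d c i : jet (base d c i).
Proof. by apply: jet_mul; [exact: jet_gauss|exact: jet_mod]. Qed.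

Lemma jbound_base d c i : 0 < d -> jbound (base d c i) (gauss (d / 2) 0).
Proof.
move=> d0 n; have [] := @jbound_mul _ (gauss_jet d 0) (mod_jet (- coord c i)) (gauss (d / 2) 0) (fun=> 1) _ _ _ _ n.
- by move=> t; exact: gauss_ge0.
- by move=> t; exact: ler01.
- exact: jbound_gauss.
- exact: jbound_mod.
- by move=> C C0 HC; exists C => // t; have := HC t; rewrite mulr1.
Qed.

Lemma prod_gauss0 (b : R) x : \prod_(i < 3) gauss b 0 (coord x i) = gauss3 b 0 x.
Proof. by apply: eq_bigr => i _; rewrite coord0. Qed.

Lemma gdom_tens_base d c m : 0 < d -> gdom (tens (base d c) m).
Proof.
move=> d0; split.
  by apply: cmeas_prod3 => i; exact: cder_cmeas (jet_base d c i (m i)).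
have [K K0 HK] := tens_bound m (fun i => jbound_base c i d0).
exists K, (d / 2); split => //; first by rewrite divr_gt0.
by move=> x; rewrite -prod_gauss0.
Qed.

Lemma tens_base0 d c x :
  tens (base d c) (fun=> 0%N) x = (gauss3 d 0 x)%:C * expi (dot (opp3 c) x).
Proof.
rewrite expi_dot /gauss3 rmorph_prod -big_split /=; apply: eq_bigr => i _.
by rewrite /base /= gauss_jet0 /mod_jet expr0 mul1r coord_opp3 coord0.
Qed.

Lemma ift_base d c z : 0 < d -> ift (tens (base d c) (fun=> 0%N)) z =
  (Num.sqrt (pi / d) ^+ 3 * gauss3 (4 * d)^-1 c z)%:C.
Proof.
move=> d0; have := fourier_gauss3 0 (sub3 z c) d0.
have -> : dot (sub3 z c) 0 = 0 by rewrite /dot big1// => i _; rewrite coord0 mulr0.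
rewrite expi0 mul1r gauss3_0 -gauss3E => <-.
rewrite /ift; congr cint; apply/funext => x.
by rewrite tens_base0 -mulrA -expiD -dotDl add3C.
Qed.

Lemma gdom_symbol d c s : 0 < d ->
  gdom (ift (tens (base d c) (fun i => count_mem i s + 0)%N)).
Proof.
move=> d0; split; first by apply: cmeas_ift; case: (gdom_tens_base c (fun i => count_mem i s + 0)%N d0).
have b0 : 0 < (4 * d)^-1 by rewrite invr_gt0 mulr_gt0.
set b := (4 * d)^-1 in b0.
(* The exponent drops from [b] to [b / 2] by recentring, and to [b / 4] by absorbing the power of
   [t]. *)
have H (i : 'I_3) : exists K : R, 0 <= K /\ forall t, `|t| ^+ (count_mem i s + 0) * gauss b (coord c i) t <= K * gauss (b / 4) 0 t.
  have [K K0 HK] := pow_gauss (count_mem i s + 0) (divr_gt0 b0 (ltr0Sn R 1)).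
  exists (expR (b * coord c i ^+ 2) * K); split; first by rewrite mulr_ge0// expR_ge0.
  move=> t; have g := gauss_recenter (coord c i) t b0.
  apply: (@le_trans _ _ (`|t| ^+ (count_mem i s + 0) * (expR (b * coord c i ^+ 2) * gauss (b / 2) 0 t))).
    by rewrite ler_wpM2l// exprn_ge0.
  rewrite mulrCA -mulrA ler_wpM2l ?expR_ge0//; have := HK t.
  by rewrite /gauss subr0; have -> : b / 2 / 2 = b / 4 by field.
have /choice[K HK] := H.
pose A := Num.sqrt (pi / d) ^+ 3.
exists (A * \prod_i K i), (b / 4); split; first by rewrite divr_gt0.
  rewrite mulr_ge0 ?exprn_ge0 ?sqrtr_ge0//; apply: prodr_ge0 => i _; by case: (HK i).
have A0 : 0 <= A by rewrite exprn_ge0// sqrtr_ge0.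
move=> z; rewrite (@ift_tens _ (d / 2)) ?divr_gt0//; [|by move=> i; exact: jet_base|by move=> i; exact: jbound_base].
rewrite ift_base// cabsM cabsR ger0_norm ?mulr_ge0 ?gauss3_ge0// -/A mulrCA -[leRHS]mulrA.
apply: ler_wpM2l => //.
rewrite symbol_count cabs_prod -prod_gauss0 /gauss3 -!big_split /=.
apply: ler_prod => i _; rewrite mulr_ge0 ?cabs_ge0 ?gauss_ge0//=.
rewrite cabsX cabsN cabsM cabsR; have -> : cabs ('i : R[i]) = 1.
  by rewrite /cabs /=; rewrite expr0n expr1n add0r sqrtr1.
by rewrite mul1r; case: (HK i).
Qed.

End Symbols.

(** * Compactly supported test functions and the removal of cutoffs *)

Section Cutoff.
Variable R : realType.
Local Notation L3 := (leb3s R).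
Implicit Types (x z c : R3 R) (s : seq 'I_3) (f g F G : R3 R -> R[i]).

(** Compactly supported tensor products form a class closed under [partial], on which partial
    derivatives commute by arithmetic on multi-indices. *)
Definition tens_test (phi : R3 R -> R[i]) := exists J : 'I_3 -> nat -> R -> R[i],
  exists L : R, [/\ forall i, jet (J i), forall i n t, L < `|t| -> J i n t = 0 &
  phi = tens J (fun=> 0%N)].

Lemma tens_test_test phi : tens_test phi -> test_function phi.
Proof. by move=> [J [L [jJ zJ ->]]]; exact: test_tens zJ. Qed.

Lemma tens_test_partial phi i : tens_test phi -> tens_test (partial i phi).
Proof.
move=> [J [L [jJ zJ ->]]].
exists (fun k n => J k ((k == i) + n)%N), L; split.
- by move=> k n; rewrite addnS; exact: jJ.
- by move=> k n t; exact: zJ.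
- by rewrite partial_tens.
Qed.

Lemma partialC phi i j : tens_test phi ->
  partial i (partial j phi) = partial j (partial i phi).
Proof.
move=> [J [L [jJ zJ ->]]]; rewrite !partial_tens//; congr tens.
by apply/funext => k; rewrite addnCA.
Qed.

Lemma jmul_zero n (J K : nat -> R -> R[i]) t : (forall k, J k t = 0) -> jmul n J K t = 0.
Proof.
elim: n J K => [|n IH] J K J0 /=; first by rewrite J0 mul0r.
by rewrite !IH ?addr0// => k; exact: J0.
Qed.

(** [fun k _ => (k == 0%N)%:R] is the jet of the constant 1, to which the dilated cutoffs
    converge. *)
Lemma jmul_one n (K : nat -> R -> R[i]) t : jmul n (fun k _ => (k == 0%N)%:R) K t = K n t.
Proof.
elim: n K => [|n IH] K /=; first by rewrite mul1r.
by rewrite IH jmul_zero// add0r.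
Qed.

Lemma jmul_cvg n (J : nat -> nat -> R -> R[i]) (J' K : nat -> R -> R[i]) t :
  (forall k, ccvg (fun N => J N k t) (J' k t)) ->
  ccvg (fun N => jmul n (J N) K t) (jmul n J' K t).
Proof.
elim: n J J' K => [|n IH] J J' K cJ /=; first by apply: ccvgM => //; exact: ccvg_cst.
by apply: ccvgD; apply: IH => // k; exact: cJ.
Qed.

Definition dil N := aff_jet (@cutoff_jet R) N.+1%:R^-1 0.

Lemma dil_bound k : exists2 C : R, 0 <= C & forall N t, cabs (dil N k t) <= C.
Proof.
have [C C0 HC] := @cutoff_bounded R k; exists C => // N t.
rewrite /dil /aff_jet cabsM cabsR ger0_norm ?exprn_ge0 ?invr_ge0//.
rewrite -[X in _ <= X]mul1r ler_pM ?exprn_ge0 ?invr_ge0 ?cabs_ge0//.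
  by rewrite exprn_ile1 ?invr_ge0// invf_le1// ler1n.
apply: (le_trans (HC _)); rewrite ler_piMr// indicE; by case: (_ \in _).
Qed.

Lemma cutoff_zero k (t : R) : 1 <= `|t| -> cutoff_jet k t = 0.
Proof.
move=> t1; have [C C0 HC] := @cutoff_bounded R k; apply: cabs_eq0; apply/eqP.
rewrite eq_le cabs_ge0 andbT; apply: (le_trans (HC t)).
rewrite indicE memNset ?mulr0//= in_itv/= => /andP[h1 h2].
by move: t1; rewrite leNgt => /negP; apply; rewrite ltr_norml h1.
Qed.

Lemma dil_zero N k t : N.+1%:R < `|t| -> dil N k t = 0.
Proof.
move=> h; rewrite /dil /aff_jet cutoff_zero ?mulr0//.
by rewrite addr0 normrM ger0_norm ?invr_ge0// mulrC ler_pdivlMr// mul1r ltW.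
Qed.

(** At order 0 the value tends to that of the cutoff at 0, which is 1; each derivative brings a
    factor [1 / (N + 1)]. *)
Lemma dil_cvg k t : ccvg (fun N => dil N k t) (k == 0%N)%:R.
Proof.
have h0 := @cvg_harmonic R.
case: k => [|k] /=.
  have -> : (fun N => dil N 0 t) = fun N => cutoff_jet 0 (N.+1%:R^-1 * t).
    by apply/funext => N; rewrite /dil /aff_jet expr0 mul1r addr0.
  rewrite -[true%:R](@cutoff0 R) -(mul0r t).
  have [d1 d2] := @jet_cutoff R 0.
  have c1 : N.+1%:R^-1 * t @[N --> \oo] --> 0 * t by apply: cvgM => //; exact: cvg_cst.
  split; first exact: (cvg_comp _ _ c1 (@rder_continuous _ _ _ d1 (0 * t))).
  exact: (cvg_comp _ _ c1 (@rder_continuous _ _ _ d2 (0 * t))).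
have [C C0 HC] := @cutoff_bounded R k.+1.
apply/ccvgP; apply: (squeeze_cvgr (f := cst 0) (h := fun N => C * N.+1%:R^-1)).
- apply: nearW => N; rewrite cabs_ge0 subr0 /dil /aff_jet cabsM cabsR mulrC.
  apply: ler_pM; rewrite ?cabs_ge0//.
    by apply: (le_trans (HC _)); rewrite ler_piMr// indicE; case: (_ \in _).
  rewrite ger0_norm ?exprn_ge0 ?invr_ge0// exprS ler_piMr ?invr_ge0//.
  by rewrite exprn_ile1 ?invr_ge0// invf_le1// ler1n.
- exact: cvg_cst.
- by rewrite -[X in _ --> X](mulr0 C); apply: cvgM => //; exact: cvg_cst.
Qed.

Definition cut (d : R) c N (i : 'I_3) n : R -> R[i] := jmul n (dil N) (base d c i).

Lemma jet_cut d c N i : jet (cut d c N i).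
Proof. by apply: jet_mul; [exact/jet_aff/jet_cutoff|exact: jet_base]. Qed.

Lemma tens_test_cut d c N : tens_test (tens (cut d c N) (fun=> 0%N)).
Proof.
exists (cut d c N), N.+1%:R; split => //; first by move=> i; exact: jet_cut.
by move=> i n t Nt; apply: jmul_zero => k; exact: dil_zero.
Qed.

Lemma cut_cvg d c m x : ccvg (fun N => tens (cut d c N) m x) (tens (base d c) m x).
Proof.
rewrite /tens prod3E; under eq_fun do rewrite prod3E.
have h i t : ccvg (fun N => cut d c N i (m i) t) (base d c i (m i) t).
  rewrite -[X in ccvg _ X]jmul_one; apply: jmul_cvg => k; exact: dil_cvg.
by apply: ccvgM => //; apply: ccvgM.
Qed.

Lemma cut_bound d c m : 0 < d -> exists2 K : R, 0 <= K &
  forall N x, cabs (tens (cut d c N) m x) <= K * gauss3 (d / 2) 0 x.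
Proof.
move=> d0; have /choice[K HK] : forall i : 'I_3, exists K : R, 0 <= K /\
    forall N t, cabs (cut d c N i (m i) t) <= K * gauss (d / 2) 0 t.
  move=> i; have [t|t|k||K K0 HK] := @jmul_bound _ nat (m i) dil (base d c i) (fun=> 1) (gauss (d / 2) 0).
  - exact: ler01.
  - exact: gauss_ge0.
  - by have [C C0 HC] := dil_bound k; exists C => // N t; rewrite mulr1.
  - exact: jbound_base.
  by exists K; split => // N t; have := HK N t; rewrite mul1r.
exists (\prod_(i < 3) K i); first by apply: prodr_ge0 => i _; have [] := HK i.
move=> N x; rewrite /tens /prod3 cabs_prod -prod_gauss0 -big_split /=.
by apply: ler_prod => i _; rewrite cabs_ge0 /=; have [_] := HK i; exact.
Qed.

Lemma test_limit f s d c : gtemp f -> 0 < d ->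
  ccvg (fun N => cint L3 (fun x => f x * partials s (tens (cut d c N) (fun=> 0%N)) x))
    (cint L3 (fun x => f x * tens (base d c) (fun i => count_mem i s + 0)%N x)).
Proof.
move=> gf d0; set m := (fun i : 'I_3 => _ + _)%N.
have -> : (fun N => cint L3 (fun x => f x * partials s (tens (cut d c N) (fun=> 0%N)) x)) =
    (fun N => cint L3 (fun x => f x * tens (cut d c N) m x)).
  by apply/funext => N; rewrite partials_tens// => i; exact: jet_cut.
have [K K0 HK] := cut_bound c m d0; have [mf fi] := gf.
have d20 : 0 < d / 2 by rewrite divr_gt0.
have mc N : cmeas (tens (cut d c N) m).
  by apply: cmeas_prod3 => i; exact: cder_cmeas (jet_cut d c N i (m i)).
have [mb _] := gdom_tens_base c m d0.
have [|||||_ //] := @cint_dominated _ _ _ L3 (fun N x => f x * tens (cut d c N) m x)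
  (fun x => f x * tens (base d c) m x) (fun x => K * cabs (f x * (gauss3 (d / 2) 0 x)%:C)).
- by move=> N; exact: cmeasM.
- exact: cmeasM.
- by apply: aeW => x; apply: ccvgM; [exact: ccvg_cst|exact: cut_cvg].
- by apply: integrable_scale; apply: cintb_abs; exact: fi.
- move=> N x; rewrite !cabsM cabsR ger0_norm ?gauss3_ge0// mulrCA.
  by rewrite ler_wpM2l ?cabs_ge0.
Qed.

Lemma ccvg_sum (I : Type) (r : seq I) (z : I -> nat -> R[i]) (l : I -> R[i]) :
  (forall i, ccvg (z i) (l i)) ->
  ccvg (fun n => \sum_(i <- r) z i n) (\sum_(i <- r) l i).
Proof.
move=> zl; elim: r => [|i r IH].
  by rewrite big_nil; under eq_fun do rewrite big_nil; exact: ccvg_cst.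
by rewrite big_cons; under eq_fun do rewrite big_cons; exact: ccvgD.
Qed.

Lemma ift_gauss3_dom (a : R) y : 0 < a -> gdom (ift (fun x => (gauss3 a y x)%:C)).
Proof.
move=> a0; split; first by apply: cmeas_ift; apply: cmeasR; exact: measurable_gauss3.
exists (Num.sqrt (pi / a) ^+ 3), (4 * a)^-1; split.
- by rewrite invr_gt0 mulr_gt0.
- by rewrite exprn_ge0// sqrtr_ge0.
- move=> x; rewrite fourier_gauss3// cabsM cabs_expi mul1r cabsR ger0_norm//.
  by rewrite mulr_ge0 ?gauss3_ge0// exprn_ge0// sqrtr_ge0.
Qed.

Lemma gdom_gauss3 b : 0 < b -> gdom (fun x : R3 R => (gauss3 b 0 x)%:C).
Proof.
move=> b0; split; first by apply: cmeasR; exact: measurable_gauss3.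
by exists 1, b; split => // x; rewrite cabsR mul1r ger0_norm// gauss3_ge0.
Qed.

(** The required integrability is the first conclusion of [pair_product], with a Gaussian for
    [psi]. *)
Lemma gtemp_mul f g F G : pair f F -> pair g G -> gtemp (fun x => f x * g x).
Proof.
move=> pF pG; split; first by apply: cmeasM; [case: pF => [[]]|case: pG => [[]]].
by move=> b b0; have [] := pair_product pF pG (gdom_gauss3 b0) (ift_gauss3_dom 0 b0).
Qed.

Lemma cmeas_symbol s : cmeas (symbol s : R3 R -> R[i]).
Proof.
elim: s => [|j s IH].
  have -> : symbol [::] = (fun=> 1) :> (R3 R -> R[i]) by apply/funext => z; rewrite /symbol big_nil.
  exact: cmeas_cst.
have -> : symbol (j :: s) = (fun z => - ('i * (coord z j)%:C) * symbol s z) :> (R3 R -> R[i]).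
  by apply/funext => z; rewrite /symbol big_cons.
apply: cmeasM IH; apply: cmeasN; apply: cmeasM; first exact: cmeas_cst.
by apply: cmeasR; exact: measurable_coord.
Qed.

Lemma cmeas_conv F G : cmeas F -> cmeas G -> cmeas (conv F G).
Proof.
move=> mF mG; apply: (@cmeas_cint _ _ _ _ _ L3 (fun z : R3 R * R3 R => F (sub3 z.1 z.2) * G z.2)).
apply: cmeasM; first exact: (cmeas_comp mF (@measurable_sub3 R)).
exact: (cmeas_comp mG measurable_snd).
Qed.

(* Testing against cut-off modulated Gaussians, then removing the cutoff, turns a
   system tested against compactly supported functions into an a.e. identity for
   the symbols. *)
Lemma fourier_identity (I K : finType) (a : I -> R[i]) (f F : I -> R3 R -> R[i])
  (s : I -> seq 'I_3) (b : K -> R[i]) (g h G H : K -> R3 R -> R[i]) (t : K -> seq 'I_3) :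
  (forall i, pair (f i) (F i)) -> (forall k, pair (g k) (G k)) -> (forall k, pair (h k) (H k)) ->
  (forall phi, tens_test phi ->
    \sum_i a i * cint L3 (fun x => f i x * partials (s i) phi x) +
    \sum_k b k * cint L3 (fun x => g k x * h k x * partials (t k) phi x) = 0) ->
  {ae L3, forall z, \sum_i a i * (F i z * symbol (s i) z) +
    (kap R)%:C * \sum_k b k * (conv (G k) (H k) z * symbol (t k) z) = 0}.
Proof.
move=> pF pG pH eq0.
have kap0 : kap R != 0 by rewrite expf_neq0// invr_neq0// mulf_neq0// gt_eqF// pi_gt0.
pose M z := \sum_i a i * (F i z * symbol (s i) z) +
    (kap R)%:C * \sum_k b k * (conv (G k) (H k) z * symbol (t k) z).
pose w (d : R) c z : R[i] := (Num.sqrt (pi / d) ^+ 3 * gauss3 (4 * d)^-1 c z)%:C.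
have base0 d c : 0 < d -> \sum_i a i * cint L3 (fun x => f i x * tens (base d c) (fun j => count_mem j (s i) + 0)%N x) +
    \sum_k b k * cint L3 (fun x => g k x * h k x * tens (base d c) (fun j => count_mem j (t k) + 0)%N x) = 0.
  move=> d0; have h0 : ccvg (fun=> 0 : R[i]) 0 by exact: ccvg_cst.
  apply: ccvg_unique h0.
  rewrite -[X in ccvg X](funext (fun N => eq0 _ (tens_test_cut d c N))).
  apply: ccvgD; apply: ccvg_sum => i; apply: ccvgM; first exact: ccvg_cst.
  - by apply: test_limit => //; case: (pF i).
  - exact: ccvg_cst.
  - by apply: test_limit => //; exact: gtemp_mul.
have bs d c r z : 0 < d -> ift (tens (base d c) (fun j => count_mem j r + 0)%N) z =
    symbol r z * w d c z.
  move=> d0; rewrite (@ift_tens _ _ (d / 2)) ?ift_base ?divr_gt0//.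
    by move=> i; exact: jet_base.
  by move=> i; exact: jbound_base.
have lin i d c (d0 : 0 < d) := pair_linear (pF i) (gdom_tens_base c _ d0) (gdom_symbol c (s i) d0).
have pro k d c (d0 : 0 < d) := pair_product (pG k) (pH k) (gdom_tens_base c _ d0) (gdom_symbol c (t k) d0).
have key d c : 0 < d -> cintb L3 (fun z => M z * w d c z) /\ cint L3 (fun z => M z * w d c z) = 0.
  move=> d0.
  have l1 i : cintb L3 (fun z => F i z * symbol (s i) z * w d c z).
    by have [] := lin i d c d0; under eq_fun do rewrite bs// mulrA.
  have l2 k : cintb L3 (fun z => conv (G k) (H k) z * symbol (t k) z * w d c z).
    by have [_] := pro k d c d0; under eq_fun do rewrite bs// mulrA.
  have i1 i : cintb L3 (fun z => a i * (F i z * symbol (s i) z * w d c z)) by exact: cintbZ.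
  have i2 k : cintb L3 (fun z => b k * (conv (G k) (H k) z * symbol (t k) z * w d c z)).
    exact: cintbZ.
  have E : (fun z => M z * w d c z) = (fun z => \sum_i a i * (F i z * symbol (s i) z * w d c z) +
     (kap R)%:C * \sum_k b k * (conv (G k) (H k) z * symbol (t k) z * w d c z)).
    apply/funext => z; rewrite /M mulrDl -mulrA !mulr_suml.
    by congr (_ + _ * _); apply: eq_bigr => i _; rewrite -!mulrA.
  rewrite E; split.
    apply: cintbD; first exact: cintb_sum.
    by apply: cintbZ; exact: cintb_sum.
  rewrite cintD; [|exact: cintb_sum|by apply: cintbZ; exact: cintb_sum].
  rewrite cintZ; last exact: cintb_sum.
  have kapC : (kap R)%:C != 0 by rewrite fmorph_eq0.
  (* Linear terms carry one factor [kap] and bilinear ones two; [M] is the symbol with one factor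
     divided out, which is restored here. *)
  rewrite !cint_sum//; apply: (mulfI kapC).
  rewrite mulr0 -[RHS](base0 d c d0) mulrDr !mulr_sumr; congr (_ + _).
    apply: eq_bigr => i _; have [_ ->] := lin i d c d0.
    rewrite cintZ// mulrCA; congr (_ * (_ * cint _ _)); apply/funext => z.
    by rewrite bs// mulrA.
  apply: eq_bigr => k _; have [_ _ ->] := pro k d c d0.
  have -> : (fun x => conv (G k) (H k) x * ift (tens (base d c) (fun j => count_mem j (t k) + 0)%N) x) =
      (fun z => conv (G k) (H k) z * symbol (t k) z * w d c z).
    by apply/funext => z; rewrite bs// mulrA.
  rewrite cintZ//; move: (kap R) => p; rewrite expr2 rmorphM.
  have alg (q l c' : R[i]) : q * (q * (l * c')) = l * (q * q * c') by ring.
  exact: alg.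
have mM : cmeas M.
  apply: cmeasD.
    apply: cmeas_sum => i; apply: cmeasM; first exact: cmeas_cst.
    by apply: cmeasM; [case: (pF i)|exact: cmeas_symbol].
  apply: cmeasM; first exact: cmeas_cst.
  apply: cmeas_sum => k; apply: cmeasM; first exact: cmeas_cst.
  apply: cmeasM; last exact: cmeas_symbol.
  by apply: cmeas_conv; [case: (pG k)|case: (pH k)].
have key2 e y : 0 < e -> cintb L3 (fun z => M z * (gauss3 e y z)%:C) /\
    cint L3 (fun z => M z * (gauss3 e y z)%:C) = 0.
  (* The map [d |-> (4 d)^-1] is an involution, so every width [e] is reached, by the choice
     [d = (4 e)^-1]. *)
  move=> e0; have e0' : 0 < (4 * e)^-1 by rewrite invr_gt0 mulr_gt0.
  have := key _ y e0'; rewrite /w; set A := Num.sqrt _ ^+ 3.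
  have A0 : A != 0 by rewrite expf_neq0// sqrtr_eq0 -ltNge divr_gt0// pi_gt0.
  have -> : (4 * (4 * e)^-1)^-1 = e by field; rewrite gt_eqF.
  have -> : (fun z => M z * (A * gauss3 e y z)%:C) = (fun z => A%:C * (M z * (gauss3 e y z)%:C)).
    by apply/funext => z; rewrite rmorphM mulrCA.
  move=> [/(cintbZ (A^-1)%:C) i1].
  have E : (fun x => (A^-1)%:C * (A%:C * (M x * (gauss3 e y x)%:C))) = (fun z => M z * (gauss3 e y z)%:C).
    by apply/funext => z; rewrite mulrA -rmorphM mulVf// mul1r.
  rewrite E in i1; rewrite cintZ// => /eqP; rewrite mulf_eq0 fmorph_eq0 (negbTE A0)/= => /eqP //.
apply: gauss_unique; first by split => // e e0; case: (key2 e 0 e0).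
by move=> e y e0; case: (key2 e y e0).
Qed.

End Cutoff.

(** * Square integrability of the Fourier transforms *)

Section Dyadic.
Variable R : realType.
Local Notation L3 := (leb3s R).

Lemma sum_half n : \sum_(k < n) (2 ^- k : R) <= 2.
Proof.
have -> : \sum_(k < n) (2 ^- k : R) = 2 - 2 * 2 ^- n.
  elim: n => [|n IH]; first by rewrite big_ord0 expr0 invr1 mulr1 subrr.
  by rewrite big_ord_recr/= IH exprS; field; rewrite expf_neq0.
by rewrite gerBl mulr_ge0// invr_ge0 exprn_ge0.
Qed.

(* Gaussians stand for the indicators of dyadic balls. *)
Lemma dyadic_integrable (h : R3 R -> R) (c a : nat -> R) (S : R) :
  measurable_fun setT h -> (forall x, 0 <= h x) -> (forall k, 0 <= c k) -> (forall k, 0 < a k) ->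
  (forall k, c k * Num.sqrt (pi / a k) ^+ 3 <= S * 2 ^- k) ->
  {ae L3, forall x, exists k, h x <= c k * gauss3 (a k) 0 x} ->
  L3.-integrable setT (EFin \o h).
Proof.
move=> mh h0 c0 a0 cS hk.
pose s n x := \sum_(k < n) c k * gauss3 (a k) 0 x.
have s0 n x : 0 <= s n x by apply: sumr_ge0 => k _; rewrite mulr_ge0 ?gauss3_ge0.
have is_ n : L3.-integrable setT (EFin \o s n).
  rewrite /s; elim: n => [|n IH].
    rewrite (_ : EFin \o _ = cst 0%E); first exact: integrable0.
    by apply/funext => x /=; rewrite big_ord0.
  rewrite (_ : EFin \o _ = (fun x => (s n x)%:E + (c n * gauss3 (a n) 0 x)%R%:E)%E).
    apply: integrableD => //; apply: integrable_scale; exact: (integral_gauss3 0 (a0 n)).1.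
  by apply/funext => x /=; rewrite big_ord_recr.
have es n : \int[L3]_x s n x = \sum_(k < n) c k * Num.sqrt (pi / a k) ^+ 3.
  elim: n => [|n IH].
    by rewrite big_ord0 /Rintegral integral0_eq// => x _; rewrite /s big_ord0.
  rewrite big_ord_recr/= -IH -(integral_gauss3 0 (a0 n)).2 -RintegralZl//; last exact: (integral_gauss3 0 (a0 n)).1.
  rewrite -RintegralD//; last by apply: integrable_scale; exact: (integral_gauss3 0 (a0 n)).1.
  by apply: eq_Rintegral => x _; rewrite /s big_ord_recr.
have ms n : measurable_fun setT (s n).
  by have /measurable_int/measurable_EFinP := is_ n.
(* Truncating [h] by the partial sums keeps the integrals below [S * 2], while at almost every point
   the truncation equals [h] once the index [k] of its bound has been summed. *)
apply: (@fatou_bound _ _ _ _ (fun n x => Num.min (h x) (s n x)) h (S * 2) _ _ mh _ _ h0).1.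
- by move=> n; exact: measurable_minr.
- by move=> n x; rewrite le_min h0 s0.
- apply: filterS hk => x [k hx]; apply: cvg_near_cst; near=> n.
  apply/min_idPl; apply: (le_trans hx); have kn : (k < n)%N by near: n; exact: nbhs_infty_gt.
  rewrite /s (bigD1 (Ordinal kn))//= lerDl; apply: sumr_ge0 => i _.
  by rewrite mulr_ge0 ?gauss3_ge0.
- move=> n; apply: (@le_trans _ _ (\int[L3]_x (s n x)%:E)%E).
    apply: ge0_le_integral => //.
    + by move=> x _; rewrite lee_fin le_min h0 s0.
    + by apply/measurable_EFinP; exact: measurable_minr.
    + by apply/measurable_EFinP.
    + by move=> x _; rewrite lee_fin ge_min lexx orbT.
  rewrite rfine_int// lee_fin es; apply: (@le_trans _ _ (\sum_(k < n) S * 2 ^- k)).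
    by apply: ler_sum => k _; exact: cS.
  rewrite -mulr_sumr ler_wpM2l ?sum_half//.
  have := cS 0%N; rewrite expr0 invr1 mulr1; apply: le_trans.
  by rewrite mulr_ge0// exprn_ge0// sqrtr_ge0.
Unshelve. all: by end_near.
Qed.

Lemma pow_2X (b m k : nat) : b = (2 ^ m)%N -> b%:R ^+ k = (2 ^+ k) ^+ m :> R.
Proof. by move=> ->; rewrite natrX -!exprM mulnC. Qed.

Lemma sqrt_pi4 k : Num.sqrt (pi * 4 ^+ k) = Num.sqrt pi * 2 ^+ k :> R.
Proof. by rewrite sqrtrM ?pi_ge0// (@pow_2X 4 2)// sqrtr_sqr ger0_norm. Qed.

Lemma gauss3_near (a : R) (x : R3 R) : a * enorm x ^+ 2 <= 1 -> 1 <= expR 1 * gauss3 a 0 x.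
Proof.
move=> h; rewrite gauss3_0 -expRD -[X in X <= _]expR0 ler_expR subr_ge0//.
Qed.

(** A Gaussian adapted to the ball of radius [2^k] has mass of order [8^k], against [16^-k] for the
    function, leaving [2^-k]. The factor 16 pays for one dyadic step: minimality of [k] only gives
    [|x| >= 2^(k-1)]. *)
Lemma integrable_weight_inv2 : L3.-integrable setT (EFin \o (fun x => (weight x ^+ 2)^-1)).
Proof.
pose c k : R := 16 * expR 1 * (16 ^+ k)^-1.
pose a k : R := (4 ^+ k)^-1.
have w0 (x : R3 R) : 0 < weight x by exact: lt_le_trans ltr01 (weight_ge1 x).
apply: (@dyadic_integrable _ c a (16 * expR 1 * Num.sqrt pi ^+ 3)).
- under eq_fun do rewrite -powR_inv1 ?sqr_ge0//.
  apply: (measurableT_comp (@measurable_powR R (-1))).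
  by apply: measurable_funX; exact: measurable_weight.
- by move=> x; rewrite invr_ge0 exprn_ge0// ltW.
- by move=> k; rewrite !mulr_ge0 ?expR_ge0// invr_ge0 exprn_ge0.
- by move=> k; rewrite invr_gt0 exprn_gt0.
- move=> k; rewrite le_eqVlt; apply/orP; left; apply/eqP.
  rewrite /a invrK sqrt_pi4 /c (@pow_2X 16 4)//.
  have := exprn_gt0 k (ltr0Sn R 1); move: (2 ^+ k : R) => t t0; field; lra.
- apply: aeW => x.
  have ex : exists k, enorm x <= 2 ^+ k by exists (Num.bound (enorm x)); apply/ltW/upper_nthrootP.
  case: (ex_minnP ex) => k xk mk; exists k.
  have g1 : 1 <= expR 1 * gauss3 (a k) 0 x.
    apply: gauss3_near; rewrite /a ler_pdivrMl ?exprn_gt0// mulr1.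
    by rewrite (@pow_2X 4 2)// lerXn2r ?nnegrE ?enorm_ge0 ?exprn_ge0.
  suff h : (weight x ^+ 2)^-1 <= 16 * (16 ^+ k)^-1.
    have -> : c k * gauss3 (a k) 0 x = 16 * (16 ^+ k)^-1 * (expR 1 * gauss3 (a k) 0 x).
      by rewrite /c; ring.
    rewrite -[leLHS]mulr1; apply: ler_pM => //; first by rewrite invr_ge0 sqr_ge0.
  rewrite ler_pdivlMr ?exprn_gt0// mulrC ler_pdivrMr ?exprn_gt0//.
  have wx : enorm x ^+ 2 <= weight x by rewrite lerDr.
  case: k xk mk {g1} => [|k] xk mk.
    by rewrite expr0; have := weight_ge1 x; rewrite expr2 => w1; nra.
  have kx : 2 ^+ k <= enorm x.
    by rewrite leNgt; apply/negP => /ltW /mk; rewrite ltnn.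
  rewrite exprS ler_wpM2l// (@pow_2X 16 4)//.
  apply: (@le_trans _ _ (enorm x ^+ 4)).
    by rewrite lerXn2r ?nnegrE ?enorm_ge0 ?exprn_ge0.
  by rewrite (exprM _ 2 2) lerXn2r ?nnegrE ?sqr_ge0// ltW.
Qed.

End Dyadic.

(** * From distributional transforms to pairs *)

Section FourierPairs.
Variable R : realType.
Local Notation L3 := (leb3s R).
Implicit Types (f F : R3 R -> R[i]) (T : (R3 R -> R[i]) -> R[i]) (x y z : R3 R).

Lemma schwartz_base d c : 0 < d -> schwartz (tens (base d c : 'I_3 -> nat -> R -> R[i]) (fun=> 0%N)).
Proof.
move=> d0; apply: (@schwartz_tens _ _ (d / 2)); first by rewrite divr_gt0.
  by move=> i; exact: jet_base.
by move=> i; exact: jbound_base.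
Qed.

Lemma schwartz_gauss3 a y : 0 < a -> schwartz (fun x : R3 R => (gauss3 a y x)%:C).
Proof.
move=> a0.
have -> : (fun x : R3 R => (gauss3 a y x)%:C) = tens (fun i => gauss_jet a (coord y i)) (fun=> 0%N).
  apply/funext => x; rewrite /gauss3 rmorph_prod; apply: eq_bigr => i _.
  by rewrite gauss_jet0.
apply: (@schwartz_tens _ _ (a / 2 / 2)) => [|i|i n]; first by rewrite !divr_gt0.
  exact: jet_gauss.
have [C C0 HC] := jbound_gauss (coord y i) a0 n.
exists (C * expR (a / 2 * coord y i ^+ 2)); first by rewrite mulr_ge0// expR_ge0.
move=> t; apply: (le_trans (HC t)); rewrite -mulrA ler_wpM2l//.
by apply: gauss_recenter; rewrite divr_gt0.
Qed.

Lemma tempered_gtemp f : tempered_function f -> gtemp f.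
Proof. by move=> [mf fi]; split => // b b0; exact: (fi _ (schwartz_gauss3 0 b0)). Qed.

Lemma gtemp_gauss3 f a y : gtemp f -> 0 < a -> cintb L3 (fun x => f x * (gauss3 a y x)%:C).
Proof.
move=> gf a0.
apply: (@gtemp_bound _ _ _ (a / 2) (\prod_(i < 3) expR (a * coord y i ^+ 2)) gf).
- by apply: cmeasR; exact: measurable_gauss3.
- by rewrite divr_gt0.
- move=> x; rewrite cabsR ger0_norm ?gauss3_ge0// -prod_gauss0 -big_split /=.
  by apply: ler_prod => i _; rewrite gauss_ge0 gauss_recenter.
Qed.

Lemma has_fourier_unique T F G : has_fourier T F -> has_fourier T G ->
  {ae L3, forall x, F x = G x}.
Proof.
move=> [_ tF eF] [_ tG eG].
have [mF _] := tempered_gtemp tF; have [mG _] := tempered_gtemp tG.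
have key a y : 0 < a -> cintb L3 (fun x => (F x - G x) * (gauss3 a y x)%:C) /\
    cint L3 (fun x => (F x - G x) * (gauss3 a y x)%:C) = 0.
  move=> a0; have sg := schwartz_gauss3 y a0.
  have iF : cintb L3 (fun x => F x * (gauss3 a y x)%:C) by exact: (tF.2 _ sg).
  have iG : cintb L3 (fun x => G x * (gauss3 a y x)%:C) by exact: (tG.2 _ sg).
  under eq_fun do rewrite mulrBl; split; first exact: cintbD iF (cintbN iG).
  rewrite cintB//; apply/eqP; rewrite subr_eq0; apply/eqP.
  by have := eG _ sg; rewrite eF.
have : {ae L3, forall x, F x - G x = 0}.
  apply: gauss_unique; last by move=> a y /(key _ y)[].
  by split; [exact: cmeasB|move=> b /(key _ 0)[]].
by apply: filterS => x /eqP; rewrite subr_eq0 => /eqP.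
Qed.

Lemma fourier_schwartz_ift phi y : fourier_schwartz phi y = ift phi (opp3 y) :> R[i].
Proof.
rewrite /fourier_schwartz cintegralE; congr cint; apply/funext => x.
by rewrite mulrC dotNl dotC.
Qed.

(** Test the distributional identity against [expi (x.xi) exp (- e |xi|^2)], whose transform is a
    Gaussian centred at [x] with parameter [(4 e)^-1]. *)
Lemma mollify_fourier f F (e : R) x : gtemp f -> has_fourier (distr f) F -> 0 < e ->
  mollify f (4 * e)^-1 x = (kap R)%:C * ift (fun xi => F xi * (gauss3 e 0 xi)%:C) x.
Proof.
move=> gf [_ _ eF] e0.
have := eF _ (schwartz_base (opp3 x) e0); rewrite /dfourier /distr !cintegralE => E.
have -> : ift (fun xi => F xi * (gauss3 e 0 xi)%:C) x =
    cint L3 (fun xi => F xi * tens (base e (opp3 x)) (fun=> 0%N) xi).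
  by congr cint; apply/funext => xi; rewrite tens_base0 opp3K mulrA.
rewrite -E.
have E1 y : fourier_schwartz (tens (base e (opp3 x)) (fun=> 0%N)) y =
    (Num.sqrt (pi / e) ^+ 3 * gauss3 (4 * e)^-1 x y)%:C.
  rewrite fourier_schwartz_ift ift_base//; congr (_ * _)%:C.
  by apply: eq_bigr => i _; rewrite /gauss !coord_opp3 -opprD sqrrN.
under [in RHS]eq_fun do rewrite E1.
have ig : cintb L3 (fun y => f y * (gauss3 (4 * e)^-1 x y)%:C).
  by apply: gtemp_gauss3 => //; rewrite invr_gt0 mulr_gt0.
have -> : (fun y => f y * (Num.sqrt (pi / e) ^+ 3 * gauss3 (4 * e)^-1 x y)%:C) =
    (fun y => (Num.sqrt (pi / e) ^+ 3)%:C * (f y * (gauss3 (4 * e)^-1 x y)%:C)).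
  by apply/funext => y; rewrite rmorphM mulrCA.
rewrite cintZ// mulrA -rmorphM /mollify; congr (_%:C * _).
rewrite -exprMn; congr (_ ^+ 3); rewrite -invfM.
have p0 := pi_gt0 R.
(* Per coordinate, the normalisation [sqrt (1 / (4 e pi))] of the mollifier is [(2 pi)^-1] times the
   mass [sqrt (pi / e)]: this is the origin of [kap]. *)
have -> : (4 * e * pi)^-1 = ((2 * pi)^-1) ^+ 2 * (pi / e) :> R.
  by move: (pi : R) p0 => P P0; field; rewrite !gt_eqF.
by rewrite sqrtrM ?sqr_ge0// sqrtr_sqr ger0_norm// invr_ge0 mulr_ge0// ltW.
Qed.

(** On the [k]-th annulus [|F|^2 <= C^2 4^k], against a volume of order [8^-k], and [2^-k] is
    summable. Outside the unit ball the weight is at most [2 |x|^2]. *)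
Lemma low_frequency F (C : R) : cmeas F -> 0 <= C ->
  L3.-integrable setT (EFin \o (fun x => enorm x ^+ 2 * cabs (F x) ^+ 2)) ->
  (forall k, {ae L3, forall x, annulus R k x -> cabs (F x) <= C * 2 ^+ k}) ->
  L3.-integrable setT (EFin \o (fun x => weight x * cabs (F x) ^+ 2)).
Proof.
move=> mF C0 iF HC.
have mn : measurable_fun setT (fun x : R3 R => enorm x ^+ 2).
  by apply: measurable_funX; exact: measurable_enorm.
have mF2 : measurable_fun setT (fun x => cabs (F x) ^+ 2).
  by apply: measurable_funX; exact: cmeas_cabs.
pose D : set (R3 R) := [set x | enorm x <= 1].
have mD : measurable D.
  have := @measurable_enorm R measurableT _ (measurable_itv `]-oo, 1]).
  by rewrite setTI; congr measurable; apply/seteqP; split => x; rewrite /= in_itv.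
pose h x := cabs (F x) ^+ 2 * \1_D x.
have ih : L3.-integrable setT (EFin \o h).
  apply: (@dyadic_integrable _ h (fun k => C ^+ 2 * expR 1 * 4 ^+ k) (fun k => 4 ^+ k)
    (C ^+ 2 * expR 1 * Num.sqrt pi ^+ 3)).
  - by apply: measurable_funM => //; exact: measurable_indic.
  - by move=> x; rewrite mulr_ge0 ?sqr_ge0// indicE.
  - by move=> k; rewrite !mulr_ge0 ?sqr_ge0 ?expR_ge0 ?exprn_ge0.
  - by move=> k; rewrite exprn_gt0.
  - move=> k; rewrite le_eqVlt; apply/orP; left; apply/eqP.
    have -> : Num.sqrt (pi / 4 ^+ k) = Num.sqrt pi / 2 ^+ k :> R.
      by rewrite sqrtrM ?pi_ge0// sqrtrV ?exprn_ge0// (@pow_2X _ 4 2)// sqrtr_sqr ger0_norm.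
    rewrite (@pow_2X _ 4 2)//.
    by have := exprn_gt0 k (ltr0Sn R 1); move: (2 ^+ k : R) => t t0; field; lra.
  - have ax0 := ae_coord (0 : R) ord0.
    have /ae_foralln HC' := HC.
    apply: filterS2 ax0 HC' => x x0 hx.
    have [x1|x1] := leP (enorm x) 1; last first.
      exists 0%N; rewrite /h indicE memNset ?mulr0 ?mulr_ge0 ?sqr_ge0 ?expR_ge0 ?gauss3_ge0//.
      by rewrite /D /= leNgt x1.
    have xp : 0 < enorm x.
      by apply: (lt_le_trans _ (coord_enorm x ord0)); rewrite normr_gt0.
    (* The least such [k] is positive because [|x| <= 1], and [x] lies in the annulus of index one
       less. *)
    have ex : exists k, (2 ^+ k)^-1 < enorm x.
      exists (Num.bound (enorm x)^-1); rewrite invf_plt ?posrE ?exprn_gt0//.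
      exact: upper_nthrootP.
    case: (ex_minnP ex) => [[|k]] xk mk.
      by move: xk; rewrite expr0 invr1 ltNge x1.
    have xk' : enorm x <= (2 ^+ k)^-1.
      by rewrite leNgt; apply/negP => /mk; rewrite ltnn.
    exists k; have Fx : cabs (F x) <= C * 2 ^+ k.
      by apply: hx; rewrite /annulus /= xk' ltW.
    have g1 : 1 <= expR 1 * gauss3 (4 ^+ k) 0 x.
      apply: gauss3_near; rewrite (@pow_2X _ 4 2)// -exprMn exprn_ile1 ?mulr_ge0 ?enorm_ge0//.
      by rewrite -ler_pdivlMl ?exprn_gt0// mulr1.
    have -> : C ^+ 2 * expR 1 * 4 ^+ k * gauss3 (4 ^+ k) 0 x =
        (C * 2 ^+ k) ^+ 2 * (expR 1 * gauss3 (4 ^+ k) 0 x).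
      by rewrite exprMn -(@pow_2X _ 4 2)//; ring.
    rewrite /h indicE mem_set// mulr1 -[leLHS]mulr1; apply: ler_pM; rewrite ?sqr_ge0//.
    by rewrite lerXn2r ?nnegrE ?cabs_ge0// mulr_ge0// exprn_ge0.
apply: (rintegrable_le (k := fun x => h x + 2 * (enorm x ^+ 2 * cabs (F x) ^+ 2))).
- by apply: measurable_funM => //; exact: measurable_weight.
- rewrite /comp; under eq_fun do rewrite EFinD; apply: integrableD => //.
  exact: integrable_scale.
- move=> x; rewrite ger0_norm; last first.
    by apply: mulr_ge0 (sqr_ge0 _); exact: le_trans ler01 (weight_ge1 x).
  rewrite /weight /h indicE; have := sqr_ge0 (cabs (F x)); move: (cabs (F x) ^+ 2) => p p0.
  have [xD|xD] := pselect (D x).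
    rewrite mem_set// mulrDl mul1r mulr1; have := sqr_ge0 (enorm x); move: (enorm x ^+ 2) => q q0; nra.
  rewrite memNset// mulr0 add0r; have x1 : 1 <= enorm x ^+ 2.
    by rewrite exprn_ege1// leNgt; apply/negP => /ltW.
  by move: (enorm x ^+ 2) x1 => q q1; nra.
Qed.

Lemma Linfty_annulus (k : nat) (h : R3 R -> R) (C : R) :
  (Linfty_norm (annulus R k) h <= C%:E)%E -> {ae L3, forall x, annulus R k x -> h x <= C}.
Proof.
(* The norm takes a default value when the whole space is null; any property then holds almost
   everywhere. *)
rewrite /Linfty_norm unlock; case: ifP => [m0|m0]; last first.
  move=> _; exists setT; split => //; apply/eqP; rewrite eq_le measure_ge0 andbT leNgt.
  by apply/negP; rewrite -/(is_true _) m0.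
move=> /ess_supP; apply: filterS => x /= hx xA.
move: hx; rewrite lee_fin; apply: le_trans; rewrite patchE mem_set//; exact: ler_norm.
Qed.

Lemma Hdot1_integrable F : cmeas F ->
  ('N[leb3 R]_2%:E [(fun xi => (enorm xi `^ 1 * cabs (F xi))%:E)] < +oo)%E ->
  L3.-integrable setT (EFin \o (fun x => enorm x ^+ 2 * cabs (F x) ^+ 2)).
Proof.
move=> mF; rewrite unlock => /lty_poweRy; rewrite invr_eq0 => /(_ (lt0r_neq0 (ltr0Sn _ _))) H.
apply/integrableP; split.
  apply/measurable_EFinP; apply: measurable_funM; apply: measurable_funX.
    exact: measurable_enorm.
  exact: cmeas_cabs.
apply: le_lt_trans H; rewrite le_eqVlt; apply/orP; left; apply/eqP.
apply: eq_integral => x _ /=; rewrite powRr1 ?enorm_ge0//.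
by rewrite -exprMn normrX; congr EFin; rewrite (powR_mulrn 2).
Qed.

Lemma fourier_pair (f : R3 R -> R) F (C : R) : 0 <= C -> Hdot_fun 1 f ->
  has_fourier (distr (cfun f)) F ->
  (forall k, {ae L3, forall x, annulus R k x -> cabs (F x) <= C * 2 ^+ k}) ->
  pair (cfun f) F.
Proof.
move=> C0 [tf [G [hG nG]]] hF HC; have [_ tF _] := hF.
have [mF _] := tempered_gtemp tF; have gf := tempered_gtemp tf.
have [mG _] : gtemp G by apply: tempered_gtemp; case: hG.
have iG := Hdot1_integrable mG nG.
have FG := has_fourier_unique hF hG.
split => //; last by move=> e x; exact: mollify_fourier.
have mh : measurable_fun setT (fun x => enorm x ^+ 2 * cabs (F x) ^+ 2).
  apply: measurable_funM; apply: measurable_funX; first exact: measurable_enorm.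
  exact: cmeas_cabs.
apply: (@low_frequency _ C) => //.
(* [F] is only almost everywhere equal to the transform [G] that witnesses the [H^1] norm; dominated
   convergence along a constant sequence transfers the integrability. *)
apply: (@Rint_dominated_ae _ _ _ L3 (fun=> (fun x => enorm x ^+ 2 * cabs (F x) ^+ 2)) _ _ _ mh _ iG _).1 => //.
  by apply: aeW => x; exact: cvg_cst.
by apply: filterS FG => x -> _; rewrite ger0_norm// mulr_ge0 ?sqr_ge0.
Qed.

End FourierPairs.

(** * The energy identity *)

Section Energy.
Variable R : realType.
Local Notation L3 := (leb3s R).
Local Notation L6 := (leb3s R \x leb3s R)%E.
Implicit Types (F G : R3 R -> R[i]) (x y : R3 R).

Lemma conjJ (z : R[i]) : (z^*)^* = z.
Proof. by case: z => a b; apply: cext => //=; rewrite opprK. Qed.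

Lemma conjc_sum (I : Type) (r : seq I) (z : I -> R[i]) :
  (\sum_(i <- r) z i)^* = \sum_(i <- r) (z i)^*.
Proof. exact: (big_morph _ (@conjcD R) (conjcR 0)). Qed.

(** The exceptional set is the preimage of [R^3 x N], with [N] null, under the measure-preserving
    shear [(x, y) |-> (x, x - y)]. *)
Lemma ae_sub6 (P : R3 R -> Prop) : {ae L3, forall x, P x} ->
  {ae L6, forall z : R3 R * R3 R, P (sub3 z.1 z.2)}.
Proof.
move=> [N [mN N0 sN]]; exists [set z | N (sub3 z.1 z.2)]; split.
- by have := @measurable_sub3 R measurableT _ mN; rewrite setTI.
- have mTN : measurable ([set: R3 R] `*` N) by exact: measurableX.
  have := (mpres_shear_sub R).2 _ mTN; rewrite product_measure1E//.
  rewrite (_ : leb3s R N = 0%E)// mule0 => <-; congr (L6 _).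
  by apply/seteqP; split => z /=; [move=> ?; split|move=> []].
- by move=> z /= h; exact: sN.
Qed.

(** Complete the square with weight [t = u v], then use [1 / (u v) <= u^-2 + v^-2]. For factors
    taken at [x], [y] and [x - y], each resulting term involves only two of the three points. *)
Lemma weighted_amgm (al be ga u v : R) : 0 < u -> 0 < v ->
  al * be * ga <= al ^+ 2 * ((u ^+ 2)^-1 + (v ^+ 2)^-1) + (u * be ^+ 2) * (v * ga ^+ 2).
Proof.
move=> u0 v0; pose m := be * ga; pose t := u * v.
have t0 : 0 < t by exact: mulr_gt0.
have -> : (u * be ^+ 2) * (v * ga ^+ 2) = t * m ^+ 2 by rewrite /t /m; ring.
have h1 : al * be * ga <= al ^+ 2 / t + t * m ^+ 2.
  have -> : al * be * ga = al * m by rewrite /m mulrA.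
  have : 0 <= (al / t - m / 2) ^+ 2 * t by rewrite mulr_ge0 ?sqr_ge0// ltW.
  have -> : (al / t - m / 2) ^+ 2 * t = al ^+ 2 / t - al * m + t * m ^+ 2 / 4.
    by field; rewrite gt_eqF.
  have := mulr_ge0 (ltW t0) (sqr_ge0 m); lra.
apply: (le_trans h1); rewrite lerD2r ler_wpM2l ?sqr_ge0//.
rewrite /t invfM -!exprVn; have := sqr_ge0 (u^-1 - v^-1); have := sqr_ge0 (u^-1); have := sqr_ge0 v^-1.
rewrite sqrrB; lra.
Qed.

(* By [weighted_amgm]; [weight ^- 2] is integrable in dimension 3. *)
Lemma energy_joint F G H (j : 'I_3) : wint F -> wint G -> wint H ->
  cintb L6 (fun z => (coord z.1 j)%:C * (F (sub3 z.1 z.2) * G z.2) * (H z.1)^*).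
Proof.
move=> [mF iF] [mG iG] [mH iH]; have iw := @integrable_weight_inv2 R.
have w0 x : 0 < weight x by exact: lt_le_trans ltr01 (weight_ge1 x).
pose p x := weight x * cabs (H x) ^+ 2.
apply: (cintb_le (k := fun z => p z.1 * (weight z.2 ^+ 2)^-1 + p z.1 * (weight (sub3 z.1 z.2) ^+ 2)^-1 +
   (weight z.2 * cabs (G z.2) ^+ 2) * (weight (sub3 z.1 z.2) * cabs (F (sub3 z.1 z.2)) ^+ 2))).
- apply: cmeasM; last by apply: cmeasJ; exact: (cmeas_comp mH measurable_fst).
  apply: cmeasM.
    by apply: cmeasR; exact: (measurableT_comp (measurable_coord j) measurable_fst).
  apply: cmeasM; first exact: (cmeas_comp mF (@measurable_sub3 R)).
  exact: (cmeas_comp mG measurable_snd).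
- rewrite /comp; under eq_fun do rewrite EFinD; apply: integrableD => //.
    under eq_fun do rewrite EFinD; apply: integrableD => //.
      exact: (integrable_tensor6 iH iw).
    exact: (young_sub1 iH iw).
  exact: (young_sub2 iG iF).
- move=> z; rewrite !cabsM cabsJ cabsR.
  have -> : `|coord z.1 j| * (cabs (F (sub3 z.1 z.2)) * cabs (G z.2)) * cabs (H z.1) =
    (`|coord z.1 j| * cabs (H z.1)) * cabs (G z.2) * cabs (F (sub3 z.1 z.2)) by ring.
  apply: (le_trans (weighted_amgm _ _ _ (w0 z.2) (w0 (sub3 z.1 z.2)))).
  rewrite lerD2r -mulrDr ler_wpM2r ?addr_ge0 ?invr_ge0 ?sqr_ge0// exprMn.
  rewrite ler_wpM2r ?sqr_ge0// real_normK ?num_real//.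
  apply: (@le_trans _ _ (enorm z.1 ^+ 2)); last by rewrite lerDr.
  by rewrite -real_normK ?num_real// lerXn2r ?nnegrE ?enorm_ge0// coord_enorm.
Qed.

Section Trilinear.
Variables (F : 'I_3 -> R3 R -> R[i]) (G : R3 R -> R[i]).
Hypothesis wF : forall j, wint (F j).
Hypothesis wG : wint G.
Hypothesis real_F : forall j, {ae L3, forall x, F j (opp3 x) = (F j x)^*}.
Hypothesis div_F : {ae L3, forall x, \sum_j (coord x j)%:C * F j x = 0}.

Definition tri x := \sum_j (coord x j)%:C * conv (F j) G x * (G x)^*.

Let H6 (z : R3 R * R3 R) := \sum_j (coord z.1 j)%:C * (F j (sub3 z.1 z.2) * G z.2) * (G z.1)^*.

Let iH6 : cintb L6 H6.
Proof. by apply: cintb_sum => j; exact: energy_joint. Qed.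

Let tri_H6 : (fun x => cint L3 (fun y => H6 (x, y))) = tri.
Proof.
apply/funext => x; rewrite /H6 /tri /=.
have ic j : cintb L3 (fun y => F j (sub3 x y) * G y).
  by apply: cintb_conv; [case: (wF j)|case: wG|exact: wint_sqint|exact: wint_sqint].
have e j : (fun y => (coord x j)%:C * (F j (sub3 x y) * G y) * (G x)^*) =
    (fun y => ((coord x j)%:C * (G x)^*) * (F j (sub3 x y) * G y)).
  by apply/funext => y; ring.
rewrite cint_sum; last by move=> j; rewrite e; exact: cintbZ.
by apply: eq_bigr => j _; rewrite e cintZ// mulrAC.
Qed.

Lemma cintb_tri : cintb L3 tri.
Proof. by have [+ _] := cfubini1 iH6; rewrite /= tri_H6. Qed.

(* Exchanging the two integration variables conjugates the integrand, up to a
   term containing the divergence of [F]. *)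
Lemma tri_real : (cint L3 tri)^* = cint L3 tri.
Proof.
have E : cint L6 H6 = cint L3 tri by have [_ ->] := cfubini1 iH6; rewrite /= tri_H6.
rewrite -E -cintJ// -(cint_mpres (mpres_swap L3) iH6).
apply: cint_ae; first by apply: cmeasJ; exact: cintb_meas iH6.
  exact: cintb_meas (cintb_mpres (mpres_swap L3) iH6).
have r6 : {ae L6, forall z : R3 R * R3 R, forall j, F j (opp3 (sub3 z.1 z.2)) = (F j (sub3 z.1 z.2))^*}.
  exact: (ae_sub6 (ae_forall3 real_F)).
have d6 := ae_sub6 div_F.
apply: filterS2 r6 d6 => -[x y] /= r d; rewrite /H6 /=.
rewrite conjc_sum.
apply/eqP; rewrite -subr_eq0 -sumrB; apply/eqP.
rewrite (eq_bigr (fun j => ((coord (sub3 x y) j)%:C * F j (sub3 x y))^* * ((G y)^* * G x))); last first.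
  move=> j _; rewrite -(opp3_sub x y) r !conjcM conjJ !conjcR /sub3 coord_add3 coord_opp3 rmorphD rmorphN /=.
  by ring.
by rewrite -mulr_suml -conjc_sum d (conjcR 0) mul0r.
Qed.

End Trilinear.

End Energy.

(** * Hermitian symmetry of the transforms and the vanishing argument *)

Section Vanishing.
Variable R : realType.
Local Notation L3 := (leb3s R).
Implicit Types (F : R3 R -> R[i]) (x y : R3 R).

Lemma gauss3N (a : R) x y : gauss3 a y (opp3 x) = gauss3 a (opp3 y) x.
Proof. by apply: eq_bigr => i _; rewrite /gauss !coord_opp3 opprK -opprD sqrrN. Qed.

Lemma opp30 : opp3 (0 : R3 R) = 0.
Proof. by apply: coord_ext => i; rewrite coord_opp3 coord0 oppr0. Qed.

(** Gaussians centred at [y] and [- y] have conjugate transforms and [f] is real, so [F x] and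
    [conj F(- x)] have the same integrals against all Gaussians. *)
Lemma fourier_real (f : R3 R -> R) F : tempered_function (cfun f) ->
  has_fourier (distr (cfun f)) F -> {ae L3, forall x, F (opp3 x) = (F x)^*}.
Proof.
move=> tf [_ tF eF]; have gf := tempered_gtemp tf; have gF := tempered_gtemp tF.
have mF := gF.1.
have mG : cmeas (fun x => F (opp3 x)) := cmeas_comp mF (mpres_opp3 R).1.
have fh a y x : 0 < a -> fourier_schwartz (fun x => (gauss3 a y x)%:C) x =
    expi (- dot x y) * (Num.sqrt (pi / a) ^+ 3 * gauss3 (4 * a)^-1 0 x)%:C.
  move=> a0; rewrite fourier_schwartz_ift fourier_gauss3// dotNl; congr (_ * (_ * _)%:C).
  by rewrite gauss3N opp30.
have key a y : 0 < a -> cintb L3 (fun x => (F x - (F (opp3 x))^*) * (gauss3 a y x)%:C) /\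
    cint L3 (fun x => (F x - (F (opp3 x))^*) * (gauss3 a y x)%:C) = 0.
  move=> a0; have i1 := gtemp_gauss3 y gF a0; have i2 := gtemp_gauss3 (opp3 y) gF a0.
  have e1 : (fun x => (F (opp3 x))^* * (gauss3 a y x)%:C) =
      (fun x => (F (opp3 x) * (gauss3 a (opp3 y) (opp3 x))%:C)^*).
    by apply/funext => x; rewrite conjcM conjcR gauss3N; rewrite opp3K.
  have i3 := cintb_mpres (mpres_opp3 R) i2; have i4 := cintbJ i3.
  have c0 : cint L3 (fun x => F x * (gauss3 a y x)%:C) = cint L3 (fun x => (F (opp3 x))^* * (gauss3 a y x)%:C).
    rewrite e1 (cintJ i3) (cint_mpres (mpres_opp3 R) i2).
    have h b : cint L3 (fun x => cfun f x * fourier_schwartz (fun x => (gauss3 a b x)%:C) x) =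
      cint L3 (fun x => F x * (gauss3 a b x)%:C) by exact: (eF _ (schwartz_gauss3 b a0)).
    rewrite -(h y) -(h (opp3 y)) -cintJ.
      congr cint; apply/funext => x; rewrite conjcM (conjcR (f x)) !fh// conjcM conjcR.
      by rewrite dotNr opprK expiN.
    have [_ [K [b [b0 K0 bK]]]] := ift_gauss3_dom (opp3 y) a0.
    pose w := fourier_schwartz (fun x => (gauss3 a (opp3 y) x)%:C).
    have wE x : w x = ift (fun x => (gauss3 a (opp3 y) x)%:C) (opp3 x) by exact: fourier_schwartz_ift.
    apply: (gtemp_bound (w := w) (K := K) gf _ b0).
      rewrite (funext wE); apply: (cmeas_comp _ (mpres_opp3 R).1); apply: cmeas_ift.
      by apply: cmeasR; exact: measurable_gauss3.
    by move=> x; rewrite wE; apply: (le_trans (bK _)); rewrite gauss3N opp30.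
  rewrite -e1 in i4; under eq_fun do rewrite mulrBl; split; first exact: cintbD i1 (cintbN i4).
  by rewrite cintB// c0 subrr.
have : {ae L3, forall x, F x - (F (opp3 x))^* = 0}.
  apply: gauss_unique; last by move=> a y /(key _ y)[].
  by split; [apply: cmeasB => //; exact: cmeasJ|move=> b /(key _ 0)[]].
by apply: filterS => x /eqP; rewrite subr_eq0 => /eqP ->; rewrite conjJ.
Qed.

(** Every mollification of [f] is an inverse transform of [F] times a Gaussian, hence zero, and they
    converge to [f] almost everywhere. *)
Lemma zero_pair (f F : R3 R -> R[i]) : pair f F -> {ae L3, forall x, F x = 0} ->
  {ae L3, forall x, f x = 0}.
Proof.
move=> pF F0; have [_ mF _ Hm] := pF; have [_ _ [cf _]] := pair_cvg pF.
apply: filterS cf => x cx; apply: (ccvg_unique cx).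
rewrite (_ : (fun n => _) = fun=> 0); first exact: ccvg_cst.
apply/funext => n; rewrite -epsnE Hm ?epsn_gt0// /ift.
rewrite (@cint_ae _ _ _ L3 _ (fun=> 0)); first by rewrite cint0 mulr0.
- apply: cmeasM; last by apply: cmeas_expi; exact: measurable_dot.
  by apply: cmeasM => //; apply: cmeasR; exact: measurable_gauss3.
- exact: cmeas_cst.
- by apply: filterS F0 => xi ->; rewrite !mul0r.
Qed.

(** The sum over [K] allows vector unknowns: for the velocity only the scalar product of the
    momentum symbol with the unknown vanishes, not each component. What matters about [c] is that it
    is real. *)
Lemma energy_zero (K : finType) (c : R) (F : 'I_3 -> R3 R -> R[i]) (G : K -> R3 R -> R[i]) :
  (forall j, wint (F j)) -> (forall k, wint (G k)) ->
  (forall j, {ae L3, forall x, F j (opp3 x) = (F j x)^*}) ->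
  {ae L3, forall x, \sum_j (coord x j)%:C * F j x = 0} ->
  {ae L3, forall x, \sum_k ((enorm x ^+ 2)%:C * G k x +
     'i * c%:C * \sum_j (coord x j)%:C * conv (F j) (G k) x) * (G k x)^* = 0} ->
  forall k, {ae L3, forall x, G k x = 0}.
Proof.
move=> wF wG rF dF eq0.
pose E x := \sum_k enorm x ^+ 2 * cabs (G k x) ^+ 2.
have itri k := cintb_tri wF (wG k).
have imE : {ae L3, forall x, (E x)%:C = - ('i * c%:C) * \sum_k tri F (G k) x}.
  apply: filterS eq0 => x ex.
  have -> : (E x)%:C = \sum_k (enorm x ^+ 2)%:C * G k x * (G k x)^*.
    rewrite /E rmorph_sum; apply: eq_bigr => k _.
    by rewrite [LHS]rmorphM -mulrA -cabs2E.
  apply/eqP; rewrite mulNr -subr_eq0 opprK -[X in _ == X]ex; apply/eqP.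
  rewrite mulr_sumr -big_split /=; apply: eq_bigr => k _.
  by rewrite mulrDl; congr (_ + _); rewrite -[RHS]mulrA mulr_suml.
have iE : L3.-integrable setT (EFin \o E).
  rewrite (_ : EFin \o E = (fun x => (\sum_k (enorm x ^+ 2 * cabs (G k x) ^+ 2)%:E)%E)); last first.
    by apply/funext => x; rewrite /= sumEFin.
  apply: integrable_sum => // k _; have [mG iG] := wG k.
  apply: (rintegrable_le _ iG).
    apply: measurable_funM; apply: measurable_funX; first exact: measurable_enorm.
    exact: cmeas_cabs.
  move=> x; rewrite ger0_norm; last by apply: mulr_ge0; exact: sqr_ge0.
  by apply: ler_wpM2r; [exact: sqr_ge0|rewrite lerDr].
have mE : measurable_fun setT E by have /measurable_int/measurable_EFinP := iE.
have E0 : \int[L3]_x E x = 0.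
  have h : (\int[L3]_x E x)%:C = - ('i * c%:C) * \sum_k cint L3 (tri F (G k)).
    rewrite -cintR -cint_sum// -cintZ; last exact: cintb_sum.
    apply: cint_ae imE; first exact: cmeasR.
    by apply: cmeasM; [exact: cmeas_cst|apply: cmeas_sum => k; exact: cintb_meas].
  have h2 : (\int[L3]_x E x)%:C = - ('i * c%:C)^* * \sum_k (cint L3 (tri F (G k)))^*.
    by rewrite -[LHS]conjcR h conjcM conjcN conjc_sum.
  have ci : ('i : R[i])^* = - 'i by apply: cext => //=; rewrite oppr0.
  rewrite conjcM conjcR ci !mulNr opprK in h2.
  rewrite (eq_bigr (fun k => cint L3 (tri F (G k)))) in h2; last first.
    by move=> k _; exact: (tri_real wF (wG k) rF dF).
  have h3 : (\int[L3]_x E x)%:C = - (\int[L3]_x E x)%:C by rewrite {1}h2 h mulNr opprK.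
  by have := congr1 (@Re R) h3 => /=; lra.
have aeE : {ae L3, forall x, E x = 0}.
  have E_ge0 x : 0 <= E x by apply: sumr_ge0 => k _; rewrite mulr_ge0 ?sqr_ge0.
  have [+ _] := @ae_eq_integral_abs _ _ _ L3 setT measurableT (EFin \o E) (measurable_int _ iE).
  move=> H; have {}H := H _; apply: filterS (H _) => [x /(_ I) /= [] //|].
  under eq_integral do rewrite /= ger0_norm//.
  by rewrite rfine_int// E0.
move=> k; have ax0 := ae_coord (0 : R) ord0.
apply: filterS2 ax0 aeE => x x0 ex; apply: cabs_eq0.
have xp : 0 < enorm x ^+ 2.
  rewrite exprn_gt0//; apply: (lt_le_trans _ (coord_enorm x ord0)); by rewrite normr_gt0.
have /psumr_eq0P : \sum_k enorm x ^+ 2 * cabs (G k x) ^+ 2 = 0 by [].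
move=> /(_ (fun k _ => mulr_ge0 (sqr_ge0 _) (sqr_ge0 _)) k isT) /eqP.
by rewrite mulf_eq0 gt_eqF//= sqrf_eq0 => /eqP.
Qed.

End Vanishing.

(** * The Boussinesq system *)

Section Symbols_of_the_system.
Variable R : realType.
Local Notation L3 := (leb3s R).
Local Notation "[[ f ]]" := (distr (cfun f)).
Variables (u : R3 R -> R3 R) (theta : R3 R -> R).
Variables (U : 'I_3 -> R3 R -> R[i]) (Th : R3 R -> R[i]).
Hypothesis pU : forall i, pair (cfun (component u i)) (U i).
Hypothesis pTh : pair (cfun theta) Th.

Lemma distr_partials (f : R3 R -> R[i]) phi s :
  distr f (partials s phi) = cint L3 (fun x => f x * partials s phi x).
Proof. by []. Qed.

Lemma dlaplacianE (T : (R3 R -> R[i]) -> R[i]) phi :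
  dlaplacian T phi = \sum_(i < 3) T (partials [:: i; i] phi).
Proof.
rewrite /dlaplacian fct_sumE; apply: eq_bigr => i _.
by rewrite /dpartial opprK.
Qed.

Lemma ddivE (V : 'I_3 -> (R3 R -> R[i]) -> R[i]) phi :
  ddiv V phi = - \sum_(i < 3) V i (partials [:: i] phi).
Proof. by rewrite /ddiv fct_sumE -sumrN. Qed.

Lemma symbol1 i (z : R3 R) : symbol [:: i] z = - ('i * (coord z i)%:C).
Proof. by rewrite /symbol big_seq1. Qed.

Lemma symbol_cons i s (z : R3 R) : symbol (i :: s) z = - ('i * (coord z i)%:C) * symbol s z.
Proof. by rewrite /symbol big_cons. Qed.

Lemma mul_imag : 'i * 'i = -1 :> R[i].
Proof. by apply: cext; rewrite /=; ring. Qed.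

Lemma divergence_symbol : eq_distr (ddiv (fun i => [[ component u i ]])) 0 ->
  {ae L3, forall z, \sum_j (coord z j)%:C * U j z = 0}.
Proof.
move=> div0.
(* The divergence is linear: ['I_0] makes the bilinear sum empty. *)
have := @fourier_identity R 'I_3 'I_0 (fun=> -1) _ _ (fun i => [:: i])
  (fun=> 0) (fun=> cfun theta) (fun=> cfun theta) (fun=> Th) (fun=> Th) (fun=> [::])
  pU (fun=> pTh) (fun=> pTh).
move=> H; have {}H := H _; apply: filterS (H _) => [z|phi /tens_test_test /div0].
  rewrite big_ord0 mulr0 addr0 => E.
  apply: (mulfI (x := 'i)); first exact: neq0Ci.
  rewrite mulr0 -[RHS]E mulr_sumr; apply: eq_bigr => j _.
  by rewrite symbol1; ring.
rewrite ddivE => E; rewrite big_ord0 addr0 -[RHS]E -sumrN; apply: eq_bigr => i _.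
by rewrite mulN1r.
Qed.

Lemma enorm2C (z : R3 R) : (enorm z ^+ 2)%:C = \sum_j (coord z j)%:C ^+ 2 :> R[i].
Proof. by rewrite enorm2E rmorph_sum; apply: eq_bigr => j _; rewrite rmorphXn. Qed.

Lemma cfunM (f g : R3 R -> R) : cfun (fun x => f x * g x) = (fun x => cfun f x * cfun g x).
Proof. by apply/funext => x; rewrite /cfun rmorphM. Qed.

Lemma heat_symbol :
  eq_distr (- dlaplacian [[ theta ]] + ddiv (fun i => [[ fun x => theta x * component u i x ]])) 0 ->
  {ae L3, forall z, (enorm z ^+ 2)%:C * Th z +
    'i * (kap R)%:C * \sum_j (coord z j)%:C * conv (U j) Th z = 0}.
Proof.
move=> heat0.
have := @fourier_identity R 'I_3 'I_3 (fun=> -1) (fun=> cfun theta) (fun=> Th) (fun i => [:: i; i])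
  (fun=> -1) _ (fun=> cfun theta) _ (fun=> Th) (fun i => [:: i]) (fun=> pTh) pU (fun=> pTh).
move=> H; have {}H := H _; apply: filterS (H _) => [z E|phi /tens_test_test /heat0 E].
  rewrite -[RHS]E enorm2C mulr_suml -mulrA mulrCA; congr (_ + _ * _).
    apply: eq_bigr => j _; rewrite symbol_cons symbol1.
    have := mul_imag; move: ('i : R[i]) (Th z) ((coord z j)%:C) => I A B hI; ring: hI.
  rewrite mulr_sumr; apply: eq_bigr => j _; rewrite symbol1; ring.
rewrite -[RHS]E [RHS]/GRing.add /= /GRing.opp /= dlaplacianE ddivE.
congr (_ + _).
  by rewrite -sumrN; apply: eq_bigr => i _; rewrite mulN1r.
rewrite -sumrN; apply: eq_bigr => i _; rewrite mulN1r; congr (- _).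
rewrite distr_partials cfunM; congr cint; apply/funext => x.
by rewrite [cfun theta x * _]mulrC.
Qed.

(** The symbol of the [j]-th momentum equation without pressure and force; the factor [kap] comes
    from the convolution theorem. *)
Definition momentum j z : R[i] := (enorm z ^+ 2)%:C * U j z +
  'i * (kap R)%:C * \sum_i (coord z i)%:C * conv (U i) (U j) z.

(* Testing the j-th equation against d_k phi and the k-th one against d_j phi
   eliminates the pressure. *)
Lemma momentum_symbol (P : R3 R -> R) (S : 'I_3 -> (R3 R -> R[i]) -> R[i]) j k :
  (forall j phi, tens_test phi -> S j phi = 0) ->
  (forall j, eq_distr (- dlaplacian [[ component u j ]] + div_tensor u j + dpartial j [[ P ]]) (S j)) ->
  {ae L3, forall z, (coord z k)%:C * momentum j z = (coord z j)%:C * momentum k z}.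
Proof.
move=> S0 eqS.
have eqP j' phi : tens_test phi ->
    - \sum_i cint L3 (fun x => cfun (component u j') x * partials [:: i; i] phi x) -
    \sum_i cint L3 (fun x => cfun (component u i) x * cfun (component u j') x * partials [:: i] phi x)
    = cint L3 (fun x => cfun P x * partial j' phi x).
  move=> tphi.
  have h1 := dlaplacianE [[ component u j' ]] phi.
  have h2 : div_tensor u j' phi = - \sum_i cint L3 (fun x => cfun (component u i) x * cfun (component u j') x * partials [:: i] phi x).
    rewrite /div_tensor ddivE; congr (- _); apply: eq_bigr => i _.
    by rewrite distr_partials cfunM.
  have h3 : - (dlaplacian [[ component u j' ]] phi) + div_tensor u j' phi + dpartial j' [[ P ]] phi = 0.
    by rewrite -(S0 j' phi tphi) -(eqS j' phi (tens_test_test tphi)).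
  by move: h3; rewrite h1 h2 /dpartial => /eqP; rewrite addr_eq0 opprK => /eqP.
(* One identity for the difference of two equations: [inl] indexes the terms of the [j]-th one
   tested against [d_k phi], [inr] those of the [k]-th one tested against [d_j phi], with opposite
   signs. *)
pose I3 := ('I_3 + 'I_3)%type.
have := @fourier_identity R I3 I3
  (fun c => if c is inl _ then -1 else 1)
  (fun c => if c is inl _ then cfun (component u j) else cfun (component u k))
  (fun c => if c is inl _ then U j else U k)
  (fun c => match c with inl i => [:: i; i; k] | inr i => [:: i; i; j] end)
  (fun c => if c is inl _ then -1 else 1)
  (fun c => match c with inl i => cfun (component u i) | inr i => cfun (component u i) end)
  (fun c => if c is inl _ then cfun (component u j) else cfun (component u k))
  (fun c => match c with inl i => U i | inr i => U i end)
  (fun c => if c is inl _ then U j else U k)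
  (fun c => match c with inl i => [:: i; k] | inr i => [:: i; j] end).
move=> H; have {}H := H _ _ _ _; apply: filterS (H _ _ _ _) => [z E|[i|i]|[i|i]|[i|i]|phi tphi] //.
  move: E; rewrite !big_sumType.
  have cube i l m : U l z * symbol [:: i; i; m] z = 'i * (coord z m)%:C * ((coord z i)%:C ^+ 2 * U l z).
    rewrite 2!symbol_cons symbol1; have := mul_imag; move: ('i : R[i]) (U l z) => I V hI.
    by move: (coord z i)%:C (coord z m)%:C => p q; ring: hI.
  have square i l m : conv (U i) (U l) z * symbol [:: i; m] z = - (coord z m)%:C * ((coord z i)%:C * conv (U i) (U l) z).
    rewrite symbol_cons symbol1; have := mul_imag; move: ('i : R[i]) (conv (U i) (U l) z) => I V hI.
    by move: (coord z i)%:C (coord z m)%:C => p q; ring: hI.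
  pose D l := \sum_i (coord z i)%:C ^+ 2 * U l z.
  pose B l := \sum_i (coord z i)%:C * conv (U i) (U l) z.
  have c1 l m (e : R[i]) : \sum_i e * (U l z * symbol [:: i; i; m] z) = e * ('i * (coord z m)%:C * D l).
    by rewrite -mulr_sumr; congr (_ * _); rewrite /D mulr_sumr; apply: eq_bigr => i _; exact: cube.
  have c2 l m (e : R[i]) : \sum_i e * (conv (U i) (U l) z * symbol [:: i; m] z) = e * (- (coord z m)%:C * B l).
    by rewrite -mulr_sumr; congr (_ * _); rewrite /B mulr_sumr; apply: eq_bigr => i _; exact: square.
  rewrite (c1 j k) (c1 k j) (c2 j k) (c2 k j) /momentum !enorm2C !mulr_suml -/(D j) -/(D k) -/(B j) -/(B k).
  have := mul_imag; move: ('i : R[i]) (kap R)%:C (coord z k)%:C (coord z j)%:C (D j) (D k) (B j) (B k).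
  move=> I K p q d1 d2 b1 b2 hI E.
  apply: subr0_eq.
  (* The tested identity is [- i] times the claimed one, so multiplying it by [i] suffices. *)
  have -> : p * (d1 + I * K * b1) - q * (d2 + I * K * b2) =
    I * (-1 * (I * p * d1) + 1 * (I * q * d2) + K * (-1 * (- p * b1) + 1 * (- q * b2))) by ring: hI.
  by rewrite E mulr0.
pose A l m := \sum_i cint L3 (fun x => cfun (component u l) x * partials [:: i; i; m] phi x).
pose B l m := \sum_i cint L3 (fun x => cfun (component u i) x * cfun (component u l) x * partials [:: i; m] phi x).
have e1 : - A j k - B j k = cint L3 (fun x => cfun P x * partial j (partial k phi) x).
  exact: eqP j _ (tens_test_partial k tphi).
have e2 : - A k j - B k j = cint L3 (fun x => cfun P x * partial k (partial j phi) x).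
  exact: eqP k _ (tens_test_partial j tphi).
rewrite (partialC k j tphi) -e1 in e2.
transitivity (- A j k + A k j + (- B j k + B k j)).
  rewrite !big_sumType; congr (_ + _ + (_ + _)).
  - by rewrite -mulr_sumr mulN1r.
  - by rewrite -mulr_sumr mul1r.
  - by rewrite -mulr_sumr mulN1r.
  - by rewrite -mulr_sumr mul1r.
move: (A j k) (A k j) (B j k) (B k j) e2 => a b c d e2.
have -> : - a + b + (- c + d) = (- a - c) - (- b - d) by ring.
by rewrite e2 subrr.
Qed.

End Symbols_of_the_system.

Lemma pair_wint (R : realType) (f F : R3 R -> R[i]) : pair f F -> wint F.
Proof. by case. Qed.

Lemma cabs3_ge (R : realType) (z : 'I_3 -> R[i]) i : cabs (z i) <= cabs3 z.
Proof.
rewrite -[leLHS](ger0_norm (cabs_ge0 _)) -sqrtr_sqr ler_wsqrtr// (bigD1 i)//= lerDl.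
by apply: sumr_ge0 => j _; exact: sqr_ge0.
Qed.

(** Parallelism is used through coordinate 0, nonzero almost everywhere: [z_0] times the scalar
    product equals the first component of the momentum times [sum_k z_k conj(U_k)], the conjugate of
    the divergence. *)
Lemma momentum_orthogonal (R : realType) (U : 'I_3 -> R3 R -> R[i]) :
  {ae leb3s R, forall z, \sum_j (coord z j)%:C * U j z = 0} ->
  (forall j k, {ae leb3s R, forall z,
     (coord z k)%:C * momentum U j z = (coord z j)%:C * momentum U k z}) ->
  {ae leb3s R, forall z, \sum_k momentum U k z * (U k z)^* = 0}.
Proof.
move=> dU pU; have z0 := ae_coord (0 : R) ord0.
have h := ae_forall3 (fun j => pU j ord0).
apply: filterS3 z0 dU h => z z0 dz hz.
have c0 : (coord z ord0)%:C != 0 :> R[i] by rewrite fmorph_eq0.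
apply: (mulfI c0); rewrite mulr0 mulr_sumr.
have d' : \sum_j (coord z j)%:C * (U j z)^* = 0.
  transitivity ((\sum_j (coord z j)%:C * U j z)^*); last by rewrite dz (conjcR 0).
  by rewrite conjc_sum; apply: eq_bigr => j _; rewrite conjcM conjcR.
transitivity (momentum U ord0 z * \sum_j (coord z j)%:C * (U j z)^*); last by rewrite d' mulr0.
by rewrite mulr_sumr; apply: eq_bigr => k _; rewrite [LHS]mulrA hz -mulrA mulrCA.
Qed.

Theorem theorem1p3 (R : realType) (r : R) (hr : 0 < r)
    (g u : R3 R -> R3 R) (theta : R3 R -> R)
    (hg : Gspace_field (1 / 2) r g)
    (hu : Hdot_field 1 u) (htheta : Hdot_fun 1 theta)
    (hsol : weak_solution g u theta)
    (uhat : 'I_3 -> R3 R -> R[i]) (thetahat : R3 R -> R[i])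
    (huhat : forall i : 'I_3, has_fourier (distr (cfun (component u i))) (uhat i))
    (hthetahat : has_fourier (distr (cfun theta)) thetahat)
    (C : R) (hC : 0 < C)
    (hbound : forall k : nat,
      (Linfty_norm (annulus R k) (fun xi => cabs3 (fun i => uhat i xi)) +
       Linfty_norm (annulus R k) (fun xi => cabs (thetahat xi))
         <= (C * 2 ^+ k)%:E)%E) :
  {ae leb3 R, forall x, u x = 0} /\ {ae leb3 R, forall x, theta x = 0}.
Proof.
have bu i k : {ae leb3s R, forall x, annulus R k x -> cabs (uhat i x) <= C * 2 ^+ k}.
  have h := le_trans (leeDl _ (Lnorm_ge0 _ _ _)) (hbound k).
  apply: filterS (Linfty_annulus h) => x hx /hx; apply: le_trans.
  exact: (cabs3_ge (fun i => uhat i x)).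
have bth k : {ae leb3s R, forall x, annulus R k x -> cabs (thetahat x) <= C * 2 ^+ k}.
  exact: Linfty_annulus (le_trans (leeDr _ (Lnorm_ge0 _ _ _)) (hbound k)).
have pu i := fourier_pair (ltW hC) (hu i) (huhat i) (bu i).
have pth := fourier_pair (ltW hC) htheta hthetahat bth.
have [P [_ [hmom hdiv hheat]]] := hsol.
have du := divergence_symbol pu pth hdiv.
have wu i := pair_wint (pu i).
have ru i := fourier_real (hu i).1 (huhat i).
have thetahat0 : {ae leb3s R, forall x, thetahat x = 0}.
  (* The temperature is a single unknown transported by [uhat], whence ['I_1]. *)
  apply: (@energy_zero _ 'I_1 (kap R) uhat (fun=> thetahat) wu _ ru du _ ord0).
    by move=> _; exact: pair_wint pth.
  by apply: filterS (heat_symbol pu pth hheat) => x hx; rewrite big_ord1 hx mul0r.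
have theta0 := zero_pair pth thetahat0.
have force0 j phi : tens_test phi ->
    distr (cfun (fun x => theta x * component g j x)) phi = 0.
  move=> [J [L [jJ _ ->]]]; rewrite /distr cintegralE.
  rewrite (@cint_ae _ _ _ (leb3s R) _ (fun=> 0)); first by rewrite cint0.
  - apply: cmeasM; last by apply: cmeas_prod3 => i; exact: cder_cmeas (jJ i 0%N).
    rewrite cfunM; apply: cmeasM; first by case: pth => [[]].
    by have [[]] := hg j.
  - exact: cmeas_cst.
  - by apply: filterS theta0 => x hx; rewrite cfunM hx !mul0r.
have orth := momentum_orthogonal du (fun j k => momentum_symbol pu j k force0 hmom).
(* Here the unknown and the transporting field coincide: both are [uhat]. *)
have u0 i := zero_pair (pu i) (energy_zero wu wu ru du orth i).
have re0 (f : R3 R -> R) : {ae leb3s R, forall x, cfun f x = 0} -> {ae leb3 R, forall x, f x = 0}.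
  by apply: filterS => x /(congr1 (@Re R)).
split; last exact: re0.
have := ae_forall3 (fun i => re0 _ (u0 i)); apply: filterS => x hx.
by apply: coord_ext => i; rewrite coord0; exact: hx.
Qed.
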